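(* There is a polynomial-time procedure that transforms every $\forall\mathsf{Exp{+}Res}$-for-DQBF (D-IR-calc) refutation $\pi$ of an S-form DQBF with CNF matrix into a D-Frege+$\forall$red refutation of the same DQBF of size $O(w^2 l)$, where $l$ is the number of lines of $\pi$ and $w$ is the size of the largest clause of $\pi$, the size of a clause $C$ being $\sum_{a^\alpha\in C}(1+|\alpha|)$.
   Context: An S-form DQBF is a formula $\forall U\exists E\,\phi$ where $U$ is a finite set of universal variables, $E$ a finite set of existential variables, each $x\in E$ carries a dependency set $D_x\subseteq U$, and $\phi$ is a quantifier-free propositional formula over $U\cup E$ (the matrix). For a universal variable $u$ set $D_u=\{u\}$, for a literal use the dependency set of its variable. The DQBF is true iff there are functions $f_x:\{0,1\}^{D_x}\to\{0,1\}$ ($x\in E$) such that for every assignment $\tau$ to $U$, $\tau$ extended by $x\mapsto f_x(\tau|_{D_x})$ satisfies $\phi$. D-Frege+$\forall$red: a refutation of $\forall U\exists E\,\phi$ is a sequence of propositional formulas ending in the constant $0$, each obtained by one of: (Frege) an axiom or rule of a fixed Frege system (finite, sound, implicationally complete set of schematic propositional axioms and inference rules) applied to earlier lines; (Axiom) a conjunct of $\phi$; (IndExt) a formula $\alpha\to(v\leftrightarrow\bigwedge_{y\in Y}y)$ or $\alpha\to(v\leftrightarrow\bigvee_{y\in Y}y)$, where $\alpha$ is a conjunction of universal literals, $Y$ a set of literals of existing variables, and $v$ a fresh variable added to the prefix as existential with $D_v=(\bigcup_{y\in Y}D_{\mathrm{var}(y)})\setminus\mathrm{var}(\alpha)$;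 ($\forall$-red) from an earlier line $L(u)$ derive $L(0)$ or $L(1)$, where $u$ is universal and no existential variable $x$ occurring in $L$ has $u\in D_x$; (prefix weakening) the prefix may be extended by a new variable not occurring in the matrix. D-IR-calc: for an S-form DQBF with CNF matrix $\phi$, an annotated literal is $a^\tau$ with $a$ an existential literal and $\tau$ a partial assignment (set of literals) to universal variables. Lines are clauses of annotated literals. Rules: (Axiom) for a clause $C$ of $\phi$, derive $\{a^{\tau|_{D_a}}\mid a\in C,\ \mathrm{var}(a)\in E\}$ where $\tau|_{D_a}=\{\neg l\mid l\in C,\ \mathrm{var}(l)\in U,\ \mathrm{var}(l)\in D_{\mathrm{var}(a)}\}$; (Instantiation) from $C$ and a partial assignment $\beta$ to universal variables derive $\{a^{(\alpha\circ\beta)|_{D_a}}\mid a^\alpha\in C\}$, where $\alpha\circ\beta=\{l\mid l\in\alpha\text{ or }(l\in\beta\text{ and }\bar l\notin\alpha)\}$ and $(\alpha\circ\beta)|_{D_a}$ keeps the literals whose variable is in $D_{\mathrm{var}(a)}$; (Resolution) from $C_1\ni x^\tau$ and $C_2\ni\neg x^\tau$ derive $(C_1\cup C_2)\setminus\{x^\tau,\neg x^\tau\}$. A refutation derives the empty clause.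
   Formalization: w is taken to be at least 1 and also counts the matrix clauses used by axiom steps; axiom steps need a non-tautological universal part; resolution removes each pivot literal only from its own premise. As literally stated, the bound or the soundness of D-IR-calc fails. *)

(* Defs.v *)
(* Mathematical Components, with finmap for finite sets over a choiceType. *)
From HB Require Import structures.
From Corelib Require Import BinNums.
From mathcomp Require Import all_boot.
From mathcomp Require Import finmap.

Set Implicit Arguments.
Unset Strict Implicit.
Unset Printing Implicit Defensive.

Local Open Scope nat_scope.
Local Open Scope fset_scope.

(** * Propositional formulas *)

Inductive form :=
| FVar of nat
| FFalse
| FTrue
| FNot of form
| FAnd of form & form
| FOr of form & form
| FImp of form & form
| FIff of form & form.

Lemma form_comparable : comparable form.
Proof. by move=> A B; rewrite /decidable; decide equality; apply: eq_comparable. Qed.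

HB.instance Definition _ := hasDecEq.Build form (compareP form_comparable).

Fixpoint fvars (A : form) : seq nat :=
  match A with
  | FVar x => [:: x]
  | FFalse | FTrue => [::]
  | FNot B => fvars B
  | FAnd B C | FOr B C | FImp B C | FIff B C => fvars B ++ fvars C
  end.

Fixpoint fsize (A : form) : nat :=
  match A with
  | FVar _ | FFalse | FTrue => 1
  | FNot B => (fsize B).+1
  | FAnd B C | FOr B C | FImp B C | FIff B C => (fsize B + fsize C).+1
  end.

Fixpoint fsubst (s : nat -> form) (A : form) : form :=
  match A with
  | FVar x => s x
  | FFalse => FFalse
  | FTrue => FTrue
  | FNot B => FNot (fsubst s B)
  | FAnd B C => FAnd (fsubst s B) (fsubst s C)
  | FOr B C => FOr (fsubst s B) (fsubst s C)
  | FImp B C => FImp (fsubst s B) (fsubst s C)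
  | FIff B C => FIff (fsubst s B) (fsubst s C)
  end.

Definition fsubst1 (u : nat) (b : bool) : form -> form :=
  fsubst (fun x => if x == u then if b then FTrue else FFalse else FVar x).

Fixpoint feval (v : nat -> bool) (A : form) : bool :=
  match A with
  | FVar x => v x
  | FFalse => false
  | FTrue => true
  | FNot B => ~~ feval v B
  | FAnd B C => feval v B && feval v C
  | FOr B C => feval v B || feval v C
  | FImp B C => feval v B ==> feval v C
  | FIff B C => feval v B == feval v C
  end.

Definition entails (G : seq form) (A : form) : Prop :=
  forall v : nat -> bool, {in G, forall B, feval v B} -> feval v A.

(** * Literals and clauses *)

(* [(true, x)] is the literal x, [(false, x)] is its negation. *)
Definition lit : Type := (bool * nat)%type.

Definition negl (l : lit) : lit := (~~ l.1, l.2).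

Definition lit_form (l : lit) : form :=
  if l.1 then FVar l.2 else FNot (FVar l.2).

Fixpoint big_form (op : form -> form -> form) (unit : form) (s : seq lit)
    : form :=
  match s with
  | [::] => unit
  | [:: l] => lit_form l
  | l :: s' => op (lit_form l) (big_form op unit s')
  end.

Definition conj_form : seq lit -> form := big_form FAnd FTrue.
Definition disj_form : seq lit -> form := big_form FOr FFalse.

(** * S-form DQBFs *)

Record qprefix := QPrefix {
  univ : seq nat;
  exis : seq (nat * seq nat)  (* the pairs (x, D_x) *)
}.

Definition pvars (P : qprefix) : seq nat := univ P ++ map fst (exis P).

(* D_u = {u} for universal u; the value is empty off the prefix. *)
Definition dep (P : qprefix) (x : nat) : seq nat :=
  if x \in univ P then [:: x]
  else flatten [seq xD.2 | xD <- exis P & xD.1 == x].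

Record dqbf := Dqbf { dprefix : qprefix; matrix : seq (seq lit) }.

Definition wf_dqbf (Phi : dqbf) : Prop :=
  [/\ uniq (pvars (dprefix Phi)),
      {in exis (dprefix Phi), forall xD, {subset xD.2 <= univ (dprefix Phi)}}
    & {in matrix Phi, forall C,
         {in C, forall l, l.2 \in pvars (dprefix Phi)}}].

Definition conjuncts (Phi : dqbf) : seq form := map disj_form (matrix Phi).

(** * Frege systems *)

(* A rule scheme lists its premises and its conclusion; the variables of these
   formulas play the role of metavariables. Axiom schemes have no premises. *)
Definition frege_rule : Type := (seq form * form)%type.

Inductive frege_derives (F : seq frege_rule) (G : seq form) : form -> Prop :=
| FregeHyp A of A \in G : frege_derives F G A
| FregeRule (r : frege_rule) (s : nat -> form) of r \in F &
    (forall B, B \in r.1 -> frege_derives F G (fsubst s B)) :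
    frege_derives F G (fsubst s r.2).

Definition frege_system (F : seq frege_rule) : Prop :=
  {in F, forall r, entails r.1 r.2} /\
  (forall G A, entails G A -> frege_derives F G A).

(** * D-Frege+forall-red *)

(* [Ext b a Y v] is the extension axiom introducing v as the conjunction
   ([b = true]) or the disjunction ([b = false]) of Y under the condition a. *)
Inductive dfr_step :=
| Line of form
| Ext of bool & seq lit & seq lit & nat
| WeakU of nat
| WeakE of nat & seq nat.

Definition ext_form (b : bool) (a Y : seq lit) (v : nat) : form :=
  FImp (conj_form a)
       (FIff (FVar v) (if b then conj_form Y else disj_form Y)).

Definition ext_dep (P : qprefix) (a Y : seq lit) : seq nat :=
  [seq u <- flatten [seq dep P y.2 | y <- Y] | u \notin map snd a].

Definition add_exis (P : qprefix) (x : nat) (D : seq nat) : qprefix :=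
  QPrefix (univ P) ((x, D) :: exis P).

Definition add_univ (P : qprefix) (u : nat) : qprefix :=
  QPrefix (u :: univ P) (exis P).

Definition by_frege (F : seq frege_rule) (L : seq form) (A : form) : Prop :=
  exists r : frege_rule, exists s : nat -> form,
    [/\ r \in F, {in r.1, forall B, fsubst s B \in L} & A = fsubst s r.2].

Definition by_red (P : qprefix) (L : seq form) (A : form) : Prop :=
  exists B : form, exists u : nat, exists b : bool,
    [/\ B \in L, u \in univ P,
        {in exis P, forall xD, xD.1 \in fvars B -> u \notin xD.2}
      & A = fsubst1 u b B].

Definition fresh (M : seq form) (P : qprefix) (x : nat) : Prop :=
  x \notin pvars P /\ {in M, forall A, x \notin fvars A}.

(* Validity of the remaining steps, given the conjuncts M of the matrix, the
   current prefix P and the formulas L derived so far. Every line is a formula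
   over the variables of the current prefix. *)
Fixpoint dfr_valid (F : seq frege_rule) (M : seq form) (P : qprefix) (L : seq form)
    (pi : seq dfr_step) : Prop :=
  match pi with
  | [::] => True
  | Line A :: pi' =>
      [/\ {subset fvars A <= pvars P},
          [\/ by_frege F L A, A \in M | by_red P L A]
        & dfr_valid F M P (A :: L) pi']
  | Ext b a Y v :: pi' =>
      [/\ {in a, forall l, l.2 \in univ P},
          uniq Y /\ {in Y, forall y, y.2 \in pvars P},
          fresh M P v
        & dfr_valid F M (add_exis P v (ext_dep P a Y))
            (ext_form b a Y v :: L) pi']
  | WeakU u :: pi' => fresh M P u /\ dfr_valid F M (add_univ P u) L pi'
  | WeakE x D :: pi' =>
      [/\ fresh M P x, {subset D <= univ P}
        & dfr_valid F M (add_exis P x D) L pi']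
  end.

Definition dfr_refutation (F : seq frege_rule) (Phi : dqbf) (pi : seq dfr_step)
    : Prop :=
  dfr_valid F (conjuncts Phi) (dprefix Phi) [::] pi /\
  exists pi', pi = rcons pi' (Line FFalse).

Definition dfr_step_size (s : dfr_step) : nat :=
  match s with
  | Line A => fsize A
  | Ext b a Y v => fsize (ext_form b a Y v)
  | WeakU _ => 1
  | WeakE _ D => (size D).+1
  end.

(* The number of symbols, each occurrence of a variable counting as one. *)
Definition dfr_size (pi : seq dfr_step) : nat := \sum_(s <- pi) dfr_step_size s.

(** * D-IR-calc *)

Definition annot : Type := {fset lit}.
Definition alit : Type := (lit * annot)%type.
Definition aclause : Type := {fset alit}.

Definition consistent (a : annot) : bool := all (fun l => negl l \notin a) a.

Definition restr (D : seq nat) (a : annot) : annot :=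
  [fset l in a | l.2 \in D].

Definition annot_comp (a b : annot) : annot :=
  a `|` [fset l in b | negl l \notin a].

Definition ax_annot (P : qprefix) (C : seq lit) : annot :=
  [fset negl l | l in C & l.2 \in univ P].

Definition ax_concl (P : qprefix) (C : seq lit) : aclause :=
  [fset (a, restr (dep P a.2) (ax_annot P C))
    | a in C & a.2 \in map fst (exis P)].

Definition inst_concl (P : qprefix) (C : aclause) (b : annot) : aclause :=
  [fset (p.1, restr (dep P p.1.2) (annot_comp p.2 b)) | p in C].

(* Each pivot literal is removed from the premise it resolves, which agrees with
   removing both from the union unless a premise is tautological in the pivot
   (see [res_concl_union]). In that case removing both is unsound: from
   x \/ y and ~x \/ ~y one would obtain y \/ ~y, and from two copies of that
   the empty clause. *)
Definition res_concl (C1 C2 : aclause) (x : nat) (t : annot) : aclause :=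
  (C1 `\ ((true, x), t)) `|` (C2 `\ ((false, x), t)).

Lemma res_concl_union (C1 C2 : aclause) (x : nat) (t : annot) :
  ((false, x), t) \notin C1 -> ((true, x), t) \notin C2 ->
  res_concl C1 C2 x t =
  (C1 `|` C2) `\` [fset ((true, x), t); ((false, x), t)].
Proof.
move=> h1 h2; apply/fsetP => p; rewrite !inE.
case: (eqVneq p ((true, x), t)) => [->|_] /=; first by rewrite (negbTE h2).
by case: (eqVneq p ((false, x), t)) => [->|_] //=; rewrite (negbTE h1).
Qed.

Inductive ir_rule :=
| IRAxiom of seq lit
| IRInst of aclause & annot
| IRRes of aclause & aclause & nat & annot.

(* A line together with the inference it is the conclusion of. *)
Definition ir_line : Type := (aclause * ir_rule)%type.

(* Partial assignments are consistent sets of literals; so an axiom step needs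
   the universal part of its clause to be non-tautological. *)
Definition ir_ok (Phi : dqbf) (L : seq aclause) (p : ir_line) : Prop :=
  let P := dprefix Phi in
  match p.2 with
  | IRAxiom C =>
      [/\ C \in matrix Phi, consistent (ax_annot P C) & p.1 = ax_concl P C]
  | IRInst C b =>
      [/\ C \in L, consistent b, {in b, forall l, l.2 \in univ P}
        & p.1 = inst_concl P C b]
  | IRRes C1 C2 x t =>
      [/\ C1 \in L /\ C2 \in L, ((true, x), t) \in C1, ((false, x), t) \in C2
        & p.1 = res_concl C1 C2 x t]
  end.

Fixpoint ir_valid (Phi : dqbf) (L : seq aclause) (pi : seq ir_line) : Prop :=
  if pi is p :: pi' then ir_ok Phi L p /\ ir_valid Phi (p.1 :: L) pi' else True.

Definition ir_refutation (Phi : dqbf) (pi : seq ir_line) : Prop :=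
  ir_valid Phi [::] pi /\ fset0 \in map fst pi.

Definition aclause_size (C : aclause) : nat := \sum_(p <- C) (1 + #|` p.2|).

(* A clause of the matrix downloaded by an axiom step counts as a clause of the
   refutation, its literals having empty annotations: its universal literals may
   leave no trace in the derived line, but any refutation that uses the clause
   has to write them. *)
Definition ir_line_width (p : ir_line) : nat :=
  maxn (aclause_size p.1) (if p.2 is IRAxiom C then size C else 0).

Definition ir_width (pi : seq ir_line) : nat := \max_(p <- pi) ir_line_width p.

(** * Polynomial time *)

(* First-order functional programs over binary trees with a unit-cost
   call-by-value semantics. *)

Inductive tree := Leaf | Node of tree & tree.

Fixpoint tsize (t : tree) : nat :=
  if t is Node l r then (tsize l + tsize r).+1 else 1.

(* Variables are de Bruijn indices. [EMatch e e0 e1] runs e0 if e is a leaf and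
   otherwise e1 with the left subtree as variable 0 and the right subtree as
   variable 1; [ECall f e] calls the f-th function of the program on e. *)
Inductive expr :=
| EVar of nat
| ELeaf
| ENode of expr & expr
| ELet of expr & expr
| EMatch of expr & expr & expr
| ECall of nat & expr.

Definition program : Type := seq expr.

Inductive evals (p : program) : seq tree -> expr -> tree -> nat -> Prop :=
| EvVar env i : evals p env (EVar i) (nth Leaf env i) 1
| EvLeaf env : evals p env ELeaf Leaf 1
| EvNode env e1 e2 v1 v2 n1 n2 of
    evals p env e1 v1 n1 & evals p env e2 v2 n2 :
    evals p env (ENode e1 e2) (Node v1 v2) (n1 + n2).+1
| EvLet env e1 e2 v1 v2 n1 n2 of
    evals p env e1 v1 n1 & evals p (v1 :: env) e2 v2 n2 :
    evals p env (ELet e1 e2) v2 (n1 + n2).+1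
| EvMatchLeaf env e e0 e1 v n n0 of
    evals p env e Leaf n & evals p env e0 v n0 :
    evals p env (EMatch e e0 e1) v (n + n0).+1
| EvMatchNode env e e0 e1 l r v n n1 of
    evals p env e (Node l r) n & evals p (l :: r :: env) e1 v n1 :
    evals p env (EMatch e e0 e1) v (n + n1).+1
| EvCall env f e v1 v n1 n of
    evals p env e v1 n1 & evals p [:: v1] (nth ELeaf p f) v n :
    evals p env (ECall f e) v (n1 + n).+1.

(* Function 0 is the entry point. Trees are shared at run time, so the size of
   the output is not controlled by the running time and is bounded as well. *)
Definition polytime (A B : Type) (encA : A -> tree) (encB : B -> tree)
    (f : A -> B) : Prop :=
  exists p : program, exists c : nat, forall a : A,
    tsize (encB (f a)) <= c * tsize (encA a) ^ c /\
    exists2 n, n <= c * tsize (encA a) ^ c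
             & evals p [:: encA a] (ECall 0 (EVar 0)) (encB (f a)) n.

(** * Encodings *)

Definition enc_bool (b : bool) : tree := if b then Node Leaf Leaf else Leaf.

Definition enc_pair (A B : Type) (eA : A -> tree) (eB : B -> tree)
    (x : A * B) : tree := Node (eA x.1) (eB x.2).

Definition enc_seq (A : Type) (eA : A -> tree) (s : seq A) : tree :=
  foldr (fun x t => Node (eA x) t) Leaf s.

Definition enc_fset (K : choiceType) (eK : K -> tree) (A : {fset K}) : tree :=
  enc_seq eK (enum_fset A).

(* Numbers are written in binary, least significant digit first. *)
Fixpoint pos_digits (k : positive) : seq bool :=
  match k with
  | xH => [:: true]
  | xO k' => false :: pos_digits k'
  | xI k' => true :: pos_digits k'
  end.

Definition digits (n : nat) : seq bool :=
  if bin_of_nat n is Npos k then pos_digits k else [::].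

Definition enc_nat (n : nat) : tree := enc_seq enc_bool (digits n).

Definition enc_lit : lit -> tree := enc_pair enc_bool enc_nat.
Definition enc_annot : annot -> tree := enc_fset enc_lit.
Definition enc_aclause : aclause -> tree :=
  enc_fset (enc_pair enc_lit enc_annot).

Definition enc_dqbf (Phi : dqbf) : tree :=
  Node (Node (enc_seq enc_nat (univ (dprefix Phi)))
             (enc_seq (enc_pair enc_nat (enc_seq enc_nat))
                      (exis (dprefix Phi))))
       (enc_seq (enc_seq enc_lit) (matrix Phi)).

Definition tagged_tree (k : nat) (t : tree) : tree := Node (enc_nat k) t.

Definition enc_ir_rule (r : ir_rule) : tree :=
  match r with
  | IRAxiom C => tagged_tree 0 (enc_seq enc_lit C)
  | IRInst C b => tagged_tree 1 (Node (enc_aclause C) (enc_annot b))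
  | IRRes C1 C2 x t =>
      tagged_tree 2 (Node (Node (enc_aclause C1) (enc_aclause C2))
                          (Node (enc_nat x) (enc_annot t)))
  end.

Definition enc_input : dqbf * seq ir_line -> tree :=
  enc_pair enc_dqbf (enc_seq (enc_pair enc_aclause enc_ir_rule)).

Fixpoint enc_form (A : form) : tree :=
  match A with
  | FVar x => tagged_tree 0 (enc_nat x)
  | FFalse => tagged_tree 1 Leaf
  | FTrue => tagged_tree 2 Leaf
  | FNot B => tagged_tree 3 (enc_form B)
  | FAnd B C => tagged_tree 4 (Node (enc_form B) (enc_form C))
  | FOr B C => tagged_tree 5 (Node (enc_form B) (enc_form C))
  | FImp B C => tagged_tree 6 (Node (enc_form B) (enc_form C))
  | FIff B C => tagged_tree 7 (Node (enc_form B) (enc_form C))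
  end.

Definition enc_dfr_step (s : dfr_step) : tree :=
  match s with
  | Line A => tagged_tree 0 (enc_form A)
  | Ext b a Y v =>
      tagged_tree 1 (Node (Node (enc_bool b) (enc_nat v))
                          (Node (enc_seq enc_lit a) (enc_seq enc_lit Y)))
  | WeakU u => tagged_tree 2 (enc_nat u)
  | WeakE x D => tagged_tree 3 (Node (enc_nat x) (enc_seq enc_nat D))
  end.

Definition enc_output : seq dfr_step -> tree := enc_seq enc_dfr_step.

(* Main.v *)
(* Each annotated variable x^a gets an extension variable v with
   a -> (v <-> x).  Its dependency set misses the variables of a, so v stands
   for the restriction of x by a, and a clause of annotated literals becomes
   the disjunction of the corresponding literals.  A resolution step is then
   propositional.  For an axiom or instantiation step let B be the relevant
   part of the universal assignment.  If a literal x^a of the premise becomes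
   x^c, then c -> (v_a <-> v_c) follows from the two extensions; the literals
   of c outside B lie in a, so none of the two variables depends on them and
   they can be reduced, which leaves a formula guarded by literals of B only.
   Hence B implies the new clause, in which no variable depends on B any more,
   and B can be reduced as well.  All formulas have size O(w); the number of
   lines per step is O(w) because the formulas that only concern c are derived
   once for each literal of the conclusion, and the rest costs O(1 + |a|) lines
   for each literal of the premise.  The table of all annotated variables of the
   refutation supplies the names. *)
From Corelib Require Import BinNums.
From mathcomp Require Import all_boot.
From mathcomp Require Import finmap zify.
Require Import Defs.

Set Implicit Arguments.
Unset Strict Implicit.
Unset Printing Implicit Defensive.

(** * Polynomially bounded programs *)

(** An arbitrary Frege system promises derivations but bounds neither their length nor their size.
    Hence every propositional inference below is an instance of one of finitely many schemes in five
    metavariables: a proof of each scheme is fixed once for [F], and only substitution instances of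
    it occur in the output. This costs a constant factor, and it keeps the procedure effective,
    since the fixed proofs are constants of the program. The reduction rule substitutes a truth
    constant instead of deleting a literal, so each reduction is followed by a propositional
    clean-up. Polynomial time rests on closure properties of functions between encoded types. Apart
    from equality of trees, the only recursion that is programmed runs along a list, and each step
    may enlarge the result only by an amount independent of that result. Output sizes are tracked
    next to running times, because a short run can build a large shared tree. *)

Lemma tsize_gt0 t : 0 < tsize t.
Proof. by case: t. Qed.

(** A single [c] is both coefficient and exponent, the shape demanded by [polytime]; a larger [c]
    only weakens the bound because sizes are positive. *)
Definition pbounded (X : Type) (i : X -> tree) (f : X -> nat) : Prop :=
  exists c, forall x, f x <= c * tsize (i x) ^ c.

Section Bounds.
Context (X : Type) (i : X -> tree).
Implicit Types f g : X -> nat.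

Lemma pbounded_le f g : (forall x, f x <= g x) -> pbounded i g -> pbounded i f.
Proof. by move=> fg [c gc]; exists c => x; apply: leq_trans (fg x) (gc x). Qed.

Lemma poly_mono c d m n : c <= d -> 0 < n -> m <= n -> c * m ^ c <= d * n ^ d.
Proof.
move=> cd n0 mn; apply: leq_mul => //; apply: leq_trans (_ : n ^ c <= _).
  by case: c {cd} => // c; rewrite leq_exp2r.
exact: leq_pexp2l.
Qed.

Lemma pbounded_const k : pbounded i (fun=> k).
Proof. by exists k => x; rewrite leq_pmulr // expn_gt0 tsize_gt0. Qed.

Lemma pbounded_size : pbounded i (fun x => tsize (i x)).
Proof. by exists 1 => x; rewrite mul1n expn1. Qed.

Lemma pbounded_add f g :
  pbounded i f -> pbounded i g -> pbounded i (fun x => f x + g x).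
Proof.
move=> [c fc] [d gd]; exists (c + d) => x; rewrite mulnDl.
apply: leq_add; [apply: leq_trans (fc x) _ | apply: leq_trans (gd x) _].
  by apply: leq_mul => //; apply: leq_pexp2l; rewrite ?tsize_gt0 ?leq_addr.
by apply: leq_mul => //; apply: leq_pexp2l; rewrite ?tsize_gt0 ?leq_addl.
Qed.

Lemma pbounded_mul f g :
  pbounded i f -> pbounded i g -> pbounded i (fun x => f x * g x).
Proof.
move=> [c fc] [d gd]; exists (c * d + (c + d)) => x.
apply: leq_trans (leq_mul (fc x) (gd x)) _; rewrite mulnACA -expnD.
by apply: leq_mul; rewrite ?leq_addr // leq_pexp2l ?tsize_gt0 ?leq_addl.
Qed.

(** Substituting [d * n ^ d] into [c * m ^ c] gives coefficient [c * d ^ c] and exponent [d * c];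
    their sum dominates both, as the single constant must. *)
Lemma pbounded_comp (Y : Type) (j : Y -> tree) (u : X -> Y) (g : Y -> nat) :
  pbounded j g -> pbounded i (fun x => tsize (j (u x))) ->
  pbounded i (fun x => g (u x)).
Proof.
move=> [c gc] [d jd]; exists (c * d ^ c + d * c) => x.
apply: leq_trans (gc _) _; apply: leq_trans (_ : c * (d * tsize (i x) ^ d) ^ c <= _).
  by apply: leq_mul => //; case: {gc} c => // c; rewrite leq_exp2r.
rewrite expnMn mulnA -expnM; apply: leq_mul; first exact: leq_addr.
by rewrite leq_pexp2l ?tsize_gt0 ?leq_addl.
Qed.

Lemma pbounded_poly c f :
  pbounded i f -> pbounded i (fun x => c * f x ^ c).
Proof.
move=> [d fd]; exists (c * d ^ c + d * c) => x.
apply: leq_trans (_ : c * (d * tsize (i x) ^ d) ^ c <= _).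
  by apply: leq_mul => //; case: c => // c; rewrite leq_exp2r.
rewrite expnMn mulnA -expnM; apply: leq_mul; first exact: leq_addr.
by rewrite leq_pexp2l ?tsize_gt0 ?leq_addl.
Qed.

End Bounds.

Ltac pb := repeat (first
  [ assumption
  | match goal with
    | |- pbounded ?i (fun x => @?f x + @?g x) => apply: (@pbounded_add _ i f g)
    | |- pbounded ?i (fun x => ?c * @?f x ^ ?c) => apply: (@pbounded_poly _ i c f)
    | |- pbounded ?i (fun x => @?f x * @?g x) => apply: (@pbounded_mul _ i f g)
    | |- pbounded ?i (fun x => ?k) => exact: (@pbounded_const _ i k)
    | |- pbounded ?i (fun x => tsize (?i x)) => exact: (@pbounded_size _ i)
    end ]).

(* A call to a missing function yields [Leaf]; it is redirected so that it still
   does so once other functions follow. *)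
Fixpoint reloc (k m : nat) (e : expr) : expr :=
  match e with
  | EVar i => EVar i
  | ELeaf => ELeaf
  | ENode e1 e2 => ENode (reloc k m e1) (reloc k m e2)
  | ELet e1 e2 => ELet (reloc k m e1) (reloc k m e2)
  | EMatch e1 e2 e3 => EMatch (reloc k m e1) (reloc k m e2) (reloc k m e3)
  | ECall f e1 =>
      if f < m then ECall (k + f) (reloc k m e1) else ELet (reloc k m e1) ELeaf
  end.

Definition reloc_prog (k : nat) (p : program) : program :=
  map (reloc k (size p)) p.

(** Even the step count survives: a missing call runs [ELeaf] for one step, exactly what the [ELet]
    put in its place costs. *)
Lemma evals_reloc (q p r : program) env e v n : evals p env e v n ->
  evals (q ++ reloc_prog (size q) p ++ r) env (reloc (size q) (size p) e) v n.
Proof.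
elim=> {env e v n} /=; try by econstructor; eauto.
move=> env f e v1 v n1 n _ IH1 H2 IH2; case: ltnP => fp.
  econstructor; first exact: IH1.
  rewrite nth_cat ltnNge leq_addr /= addKn nth_cat size_map fp.
  by rewrite (nth_map ELeaf).
rewrite nth_default // in H2; inversion H2; subst.
by econstructor; [exact: IH1|exact: EvLeaf].
Qed.

Lemma evals_call_reloc (q r : program) e0 p env e v w n1 n :
  evals (e0 :: p) [:: v] e0 w n ->
  evals (q ++ reloc_prog (size q) (e0 :: p) ++ r) env e v n1 ->
  evals (q ++ reloc_prog (size q) (e0 :: p) ++ r) env (ECall (size q) e) w
    (n1 + n).+1.
Proof.
move=> /(evals_reloc q r) H1 H2; econstructor; first exact: H2.
by rewrite nth_cat ltnn subnn.
Qed.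

(** The output size is a separate conjunct because shared subtrees let a short run build an
    exponentially large tree; without it time bounds could not be composed. *)
Definition computes (X : Type) (i o : X -> tree) : Prop :=
  pbounded i (fun x => tsize (o x)) /\
  exists e0 p t, pbounded i t /\
    forall x, exists2 n, n <= t x & evals (e0 :: p) [:: i x] e0 (o x) n.

Definition callable (X : Type) P m (i o : X -> tree) (t : X -> nat) : Prop :=
  forall x, exists2 n, n <= t x & forall env e n1, evals P env e (i x) n1 ->
    evals P env (ECall m e) (o x) (n1 + n).+1.

(** The code may start at any offset [k] with arbitrary code on both sides, so several routines can
    live in one program. The time bound is chosen before the offset. *)
Lemma install (X : Type) (i o : X -> tree) : computes i o ->
  exists t, pbounded i t /\ forall k, exists p, forall hs r, size hs = k ->
    callable (hs ++ p ++ r) k i o t.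
Proof.
move=> [_ [e [p [t [bt ev]]]]]; exists t; split=> // k.
exists (reloc_prog k (e :: p)) => hs r <- x; have [n nt E] := ev x.
by exists n => // env e1 n1 E1; apply: evals_call_reloc E E1.
Qed.

Section Computes.
Context (X : Type) (i : X -> tree).
Implicit Types o a b : X -> tree.

Lemma computes_ext o o' : o =1 o' -> computes i o -> computes i o'.
Proof.
move=> oo' [bo [e0 [p [t [bt ev]]]]]; split.
  by apply: pbounded_le bo => x; rewrite oo'.
exists e0, p, t; split=> // x; have [n nt evn] := ev x.
by exists n => //; rewrite -oo'.
Qed.

Lemma computes_id : computes i i.
Proof.
split; first exact: pbounded_size.
exists (EVar 0), [::], (fun=> 1); split; first exact: pbounded_const.
by move=> x; exists 1 => //; apply: (EvVar _ [:: i x] 0).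
Qed.

Fixpoint quote (t : tree) : expr :=
  if t is Node l r then ENode (quote l) (quote r) else ELeaf.

Lemma evals_quote p env t : evals p env (quote t) t (tsize t).
Proof. by elim: t => /= [|l IHl r IHr]; constructor. Qed.

Lemma computes_const t : computes i (fun=> t).
Proof.
split; first exact: pbounded_const.
exists (quote t), [::], (fun=> tsize t); split; first exact: pbounded_const.
by move=> x; exists (tsize t) => //; apply: evals_quote.
Qed.


Lemma computes_comp (Y : Type) (j k : Y -> tree) (u : X -> Y) :
  computes i (fun x => j (u x)) -> computes j k -> computes i (fun x => k (u x)).
Proof.
move=> Hj Hk; have [bj _] := Hj; have [bk _] := Hk.
have [t1 [bt1 c1]] := install Hj; have [t2 [bt2 c2]] := install Hk.
have [p1 {}c1] := c1 1; have [p2 {}c2] := c2 (1 + size p1).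
split; first exact: (pbounded_comp bk).
(* Function 0 is the driver [e]; the two routines start at offsets 1 and [1 + size p1]. *)
pose e := ECall (1 + size p1) (ECall 1 (EVar 0)).
exists e, (p1 ++ p2), (fun x => t1 x + t2 (u x) + 4); split.
  apply: pbounded_add; last exact: pbounded_const.
  by apply: pbounded_add => //; apply: pbounded_comp bt2 bj.
move=> x; have [n1 n1t E1] := c1 [:: e] p2 erefl x.
have [n2 n2t E2] := c2 (e :: p1) [::] erefl (u x).
exists ((1 + n1).+1 + n2).+1; first by lia.
have -> : e :: p1 ++ p2 = (e :: p1) ++ p2 ++ [::] by rewrite cats0.
apply: E2; rewrite cats0; apply: E1; exact: EvVar.
Qed.

Lemma computes_node a b : computes i a -> computes i b ->
  computes i (fun x => Node (a x) (b x)).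
Proof.
move=> Ha Hb; have [ba _] := Ha; have [bb _] := Hb.
have [t1 [bt1 c1]] := install Ha; have [t2 [bt2 c2]] := install Hb.
have [p1 {}c1] := c1 1; have [p2 {}c2] := c2 (1 + size p1).
split.
  apply: (@pbounded_le _ _ _ (fun x => tsize (a x) + tsize (b x) + 1)) => [x|].
    by rewrite /= addn1.
  by pb.
pose e := ENode (ECall 1 (EVar 0)) (ECall (1 + size p1) (EVar 0)).
exists e, (p1 ++ p2), (fun x => t1 x + t2 x + 5); split.
  by pb.
move=> x; have [n1 n1t E1] := c1 [:: e] p2 erefl x.
have [n2 n2t E2] := c2 (e :: p1) [::] erefl x.
exists ((1 + n1).+1 + (1 + n2).+1).+1; first by lia.
rewrite cats0 in E2.
by constructor; [apply: E1|apply: E2]; apply: EvVar.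
Qed.

Lemma computes_fst a b : computes i (fun x => Node (a x) (b x)) -> computes i a.
Proof.
move=> H; have [bH _] := H; have [t [bt c]] := install H.
have [p {}c] := c 1; split.
  by apply: pbounded_le bH => x /=; lia.
pose e := EMatch (ECall 1 (EVar 0)) ELeaf (EVar 0).
exists e, p, (fun x => t x + 4); split.
  by pb.
move=> x; have [n nt E] := c [:: e] [::] erefl x; rewrite cats0 in E.
exists ((1 + n).+1 + 1).+1; first by lia.
apply: EvMatchNode; first by apply: E; apply: EvVar.
exact: EvVar.
Qed.

Lemma computes_snd a b : computes i (fun x => Node (a x) (b x)) -> computes i b.
Proof.
move=> H; have [bH _] := H; have [t [bt c]] := install H.
have [p {}c] := c 1; split.
  by apply: pbounded_le bH => x /=; lia.
pose e := EMatch (ECall 1 (EVar 0)) ELeaf (EVar 1).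
exists e, p, (fun x => t x + 4); split.
  by pb.
move=> x; have [n nt E] := c [:: e] [::] erefl x; rewrite cats0 in E.
exists ((1 + n).+1 + 1).+1; first by lia.
apply: EvMatchNode; first by apply: E; apply: EvVar.
exact: EvVar.
Qed.

Definition is_leaf (t : tree) : bool := if t is Leaf then true else false.

(** Each branch has to be computed only on the inputs that reach it, hence the subset types. Their
    bounds are unfolded to explicit polynomials in [tsize (i x)], which make sense for every [x] and
    can be added. *)
Lemma computes_match (t o : X -> tree) : computes i t ->
  computes (fun x : {x | is_leaf (t x)} => i (sval x)) (fun x => o (sval x)) ->
  computes (fun x : {x | ~~ is_leaf (t x)} => i (sval x)) (fun x => o (sval x)) ->
  computes i o.
Proof.
move=> Ht H1 H2; have [b1 _] := H1; have [b2 _] := H2.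
have [t0 [bt0 c0]] := install Ht.
have [t1 [bt1 c1]] := install H1; have [t2 [bt2 c2]] := install H2.
have [p0 {}c0] := c0 1; have [p1 {}c1] := c1 (1 + size p0).
have [p2 {}c2] := c2 (1 + size p0 + size p1).
have [d1 {}bt1] := bt1; have [d2 {}bt2] := bt2.
have [d3 {}b1] := b1; have [d4 {}b2] := b2.
have bsz d : pbounded i (fun x => d * tsize (i x) ^ d).
  by apply: pbounded_poly; apply: pbounded_size.
split.
  apply: pbounded_le (pbounded_add (bsz d3) (bsz d4)) => x.
  case lf: (is_leaf (t x)); first exact: leq_trans (b1 (exist _ x lf)) (leq_addr _ _).
  by apply: leq_trans (b2 (exist _ x (negbT lf))) (leq_addl _ _).
(* In the node branch two subtrees have been pushed on the environment, so the input is [EVar 2]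
   there. *)
pose e := EMatch (ECall 1 (EVar 0)) (ECall (1 + size p0) (EVar 0))
  (ECall (1 + size p0 + size p1) (EVar 2)).
exists e, (p0 ++ p1 ++ p2),
  (fun x => t0 x + (d1 * tsize (i x) ^ d1 + d2 * tsize (i x) ^ d2) + 5); split.
  by pb.
move=> x; have [n nt E] := c0 [:: e] (p1 ++ p2) erefl x.
have {}E := E _ _ _ (EvVar _ [:: i x] 0).
case lf: (is_leaf (t x)).
  have [m mt M] := c1 (e :: p0) p2 erefl (exist _ x lf).
  have {}mt := leq_trans mt (bt1 _); rewrite /= in mt M.
  exists ((1 + n).+1 + (1 + m).+1).+1; first by lia.
  apply: EvMatchLeaf; first by case: (t x) lf E.
  by rewrite -cat_cons; apply: M; apply: EvVar.
have [m mt M] := c2 (e :: p0 ++ p1) [::] (congr1 S (size_cat _ _)) (exist _ x (negbT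
  lf)).
have {}mt := leq_trans mt (bt2 _); rewrite /= cats0 -catA in mt M.
exists ((1 + n).+1 + (1 + m).+1).+1; first by lia.
case: (t x) lf E => // l r _ E; apply: EvMatchNode E _.
by apply: M; apply: EvVar.
Qed.

End Computes.

(** * Equality of trees and recursion along lists *)

Fixpoint eqtree (t u : tree) : bool :=
  match t, u with
  | Leaf, Leaf => true
  | Node a b, Node c d => eqtree a c && eqtree b d
  | _, _ => false
  end.

Lemma eqtreeP t u : reflect (t = u) (eqtree t u).
Proof.
apply: (iffP idP) => [|->]; last by elim: u => //= a -> b ->.
by elim: t u => [|a IHa b IHb] [|c d] //= /andP[/IHa -> /IHb ->].
Qed.

Lemma computes_eqtree (X : Type) (i a b : X -> tree) :
  computes i a -> computes i b ->
  computes i (fun x => enc_bool (eqtree (a x) (b x))).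
Proof.
move=> Ha Hb; have [ba _] := Ha.
have [t1 [bt1 c1]] := install Ha; have [t2 [bt2 c2]] := install Hb.
have [p1 {}c1] := c1 2; have [p2 {}c2] := c2 (2 + size p1).
split.
  apply: pbounded_le (pbounded_const _ 3) => x.
  by case: eqtree.
pose e := ECall 1 (ENode (ECall 2 (EVar 0)) (ECall (2 + size p1) (EVar 0))).
pose e1 := EMatch (EVar 0) ELeaf
  (EMatch (EVar 0) (EMatch (EVar 1) (ENode ELeaf ELeaf) ELeaf)
    (EMatch (EVar 3) ELeaf
      (EMatch (ECall 1 (ENode (EVar 2) (EVar 0))) ELeaf
        (ECall 1 (ENode (EVar 5) (EVar 3)))))).
exists e, (e1 :: p1 ++ p2), (fun x => t1 x + t2 x + 20 * tsize (a x) + 7); split.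
  by pb.
move=> x; have [n1 n1t E1] := c1 [:: e; e1] p2 erefl x.
have [n2 n2t E2] := c2 (e :: e1 :: p1) [::] erefl x.
pose P := e :: e1 :: p1 ++ p2; rewrite -/P.
rewrite cats0 -[_ ++ _]/P in E2; rewrite -[_ ++ _]/P in E1.
(* The recursion descends in both trees at once, so the first one alone bounds the time; 20 steps
   pay for the matches and calls at one node. *)
have ev u v : exists2 n, n <= 20 * tsize u &
    evals P [:: Node u v] e1 (enc_bool (eqtree u v)) n.
  elim: u v => [|l IHl r IHr] v.
    have M0 : evals P [:: Node Leaf v] (EVar 0) (Node Leaf v) 1 by exact: EvVar.
    case: v M0 => [|vl vr] M0 /=.
      exists (1 + (1 + (1 + 3).+1).+1).+1; first by lia.
      apply: EvMatchNode M0 _; apply: EvMatchLeaf; first exact: EvVar.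
      by apply: EvMatchLeaf; [exact: EvVar|apply: (EvNode (n1 := 1) (n2 := 1));
        constructor].
    exists (1 + (1 + (1 + 1).+1).+1).+1; first by lia.
    apply: EvMatchNode M0 _; apply: EvMatchLeaf; first exact: EvVar.
    by apply: EvMatchNode; [exact: EvVar|constructor].
  have M0 : evals P [:: Node (Node l r) v] (EVar 0) (Node (Node l r) v) 1.
    exact: EvVar.
  case: v M0 => [|vl vr] M0 /=.
    exists (1 + (1 + (1 + 1).+1).+1).+1; first by lia.
    apply: EvMatchNode M0 _; apply: EvMatchNode; first exact: EvVar.
    by apply: EvMatchLeaf; [exact: EvVar|constructor].
  have [m1 m1b F1] := IHl vl; have [m2 m2b F2] := IHr vr.
  have C1 : evals P (vl :: vr :: l :: r :: [:: Node l r; Node vl vr;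
    Node (Node l r) (Node vl vr)])
      (ECall 1 (ENode (EVar 2) (EVar 0))) (enc_bool (eqtree l vl)) ((1 + 1).+1 +
        m1).+1.
    by apply: (@EvCall P _ 1 _ _ _ _ _ _ F1); apply: EvNode; exact: EvVar.
  case: (eqtree l vl) C1 => C1 /=.
    exists (1 + (1 + (1 + (((1 + 1).+1 + m1).+1 + ((1 + 1).+1 +
      m2).+1).+1).+1).+1).+1.
      by lia.
    apply: EvMatchNode M0 _; apply: EvMatchNode; first exact: EvVar.
    apply: EvMatchNode; first exact: EvVar.
    apply: EvMatchNode C1 _.
    by apply: (@EvCall P _ 1 _ _ _ _ _ _ F2); apply: EvNode; exact: EvVar.
  exists (1 + (1 + (1 + (((1 + 1).+1 + m1).+1 + 1).+1).+1).+1).+1; first by lia.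
  apply: EvMatchNode M0 _; apply: EvMatchNode; first exact: EvVar.
  apply: EvMatchNode; first exact: EvVar.
  by apply: EvMatchLeaf C1 _; constructor.
have [n nb En] := ev (a x) (b x).
exists (((1 + n1).+1 + (1 + n2).+1).+1 + n).+1; first by lia.
apply: (@EvCall P _ 1 _ _ _ _ _ _ En); apply: EvNode; first by apply: E1;
  exact: EvVar.
by apply: E2; exact: EvVar.
Qed.

(** A right fold whose step also sees the remaining list: blocks of lines, and names, depend on that
    tail. *)
Fixpoint lrec (A R : Type) (g : A -> seq A -> R -> R) (b : R) (s : seq A) : R :=
  if s is a :: s' then g a s' (lrec g b s') else b.

Lemma tsize_enc_seq_drop (A : Type) (eA : A -> tree) (s : seq A) a s' k :
  drop k s = a :: s' ->
  tsize (eA a) + tsize (enc_seq eA s') < tsize (enc_seq eA s).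
Proof.
elim: s k => [|x s IH] [|k] //=; first by case=> -> ->.
by move/IH; lia.
Qed.

(* Additive growth keeps all intermediate results of polynomial size. *)
Lemma computes_lrec (X A R : Type) (i : X -> tree) (eA : A -> tree)
    (eR : R -> tree) (s : X -> seq A) (b : X -> R)
    (g : X -> A -> seq A -> R -> R) (k : X * (A * seq A) -> nat) :
  let ey := enc_pair i (enc_pair eA (enc_seq eA)) in
  computes i (fun x => enc_seq eA (s x)) ->
  computes i (fun x => eR (b x)) ->
  computes (fun y : X * (A * seq A) * R => Node (ey y.1) (eR y.2))
    (fun y => eR (g y.1.1 y.1.2.1 y.1.2.2 y.2)) ->
  pbounded ey k ->
  (forall x a l r, tsize (eR (g x a l r)) <= tsize (eR r) + k (x, (a, l))) ->
  computes i (fun x => eR (lrec (g x) (b x) (s x))).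
Proof.
move=> ey Hs Hb Hg [ck bk] gr.
have [bs _] := Hs; have [bb _] := Hb.
have [t1 [bt1 c1]] := install Hs; have [t2 [bt2 c2]] := install Hb.
have [t3 [[d3 bt3] c3]] := install Hg.
have [p1 {}c1] := c1 2; have [p2 {}c2] := c2 (2 + size p1).
have [p3 {}c3] := c3 (2 + size p1 + size p2).
pose N x := tsize (i x) + tsize (enc_seq eA (s x)) + 3.
have bN : pbounded i N.
  by rewrite /N; pb.
(* [S] bounds all intermediate results: the starting value plus one increment for each list element,
   where [N] bounds the size of the arguments of a step. *)
pose S x := tsize (eR (b x)) + N x * (ck * N x ^ ck).
have bS : pbounded i S.
  by apply: pbounded_add => //; apply: pbounded_mul => //; apply: pbounded_poly.
have szS x m l : drop m (s x) = l ->
    tsize (eR (lrec (g x) (b x) l)) <= tsize (eR (b x)) + size l * (ck * N x ^ ck).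
  elim: l m => [|a l IH] m dm /=; first exact: leq_addr.
  apply: leq_trans (gr _ _ _ _) _; rewrite mulSn addnCA addnC.
  apply: leq_add.
    apply: leq_trans (bk _) _; apply: poly_mono => //; first by rewrite /N addn3.
    by have := tsize_enc_seq_drop eA dm; rewrite /ey /enc_pair /= /N; lia.
  by apply: (IH m.+1); rewrite -addn1 addnC -drop_drop dm /= drop0.
have szl l : size l <= tsize (enc_seq eA l) by elim: l => //= a l; lia.
have leS x m l : drop m (s x) = l -> tsize (eR (lrec (g x) (b x) l)) <= S x.
  move=> dm; apply: leq_trans (szS _ _ _ dm) _.
  rewrite leq_add2l leq_mul2r; apply/orP; right.
  rewrite -dm size_drop; have := szl (s x); rewrite /N; lia.
split; first by apply: pbounded_le bS => x; apply: (leS x 0); rewrite drop0.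
pose e := ECall 1 (ENode (EVar 0) (ECall 2 (EVar 0))).
pose e1 := EMatch (EVar 0) ELeaf
  (EMatch (EVar 1) (ECall (2 + size p1) (EVar 0))
    (ECall (2 + size p1 + size p2)
       (ENode (ENode (EVar 2) (ENode (EVar 0) (EVar 1)))
              (ECall 1 (ENode (EVar 2) (EVar 1)))))).
(* For each element: the step function on an input of size at most [N x + S x], plus 40 for the
   surrounding matches, pairs and calls. *)
pose T x := t2 x + N x * (d3 * (N x + S x) ^ d3 + 40) + 10.
exists e, (e1 :: p1 ++ p2 ++ p3), (fun x => t1 x + T x + 10); split.
  rewrite /T; pb; by apply: pbounded_poly; pb.
move=> x; have [n1 n1t E1] := c1 [:: e; e1] (p2 ++ p3) erefl x.
have [n2 n2t E2] := c2 (e :: e1 :: p1) p3 erefl x.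
have {}c3 := c3 (e :: e1 :: p1 ++ p2) [::] (congr1 (fun n => n.+2) (size_cat _ _)).
pose P := e :: e1 :: p1 ++ p2 ++ p3; rewrite -/P.
rewrite -[_ ++ _]/P in E1; rewrite -[_ ++ _]/P in E2.
rewrite cats0 !cat_cons -catA -/P in c3.
have ev l m : drop m (s x) = l -> exists2 n,
    n <= t2 x + size l * (d3 * (N x + S x) ^ d3 + 40) + 10 &
    evals P [:: Node (i x) (enc_seq eA l)] e1 (eR (lrec (g x) (b x) l)) n.
  elim: l m => [|a l IH] m dm.
    exists (1 + (1 + (1 + n2).+1).+1).+1; first by lia.
    apply: EvMatchNode; first exact: EvVar.
    apply: EvMatchLeaf; first exact: EvVar.
    by apply: E2; exact: EvVar.
  have dm' : drop m.+1 (s x) = l.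
    by rewrite -addn1 addnC -drop_drop dm /= drop0.
  have [n nb En] := IH _ dm'.
  have [n3 n3b E3] := c3 ((x, (a, l)), lrec (g x) (b x) l).
  have {}n3b : n3 <= d3 * (N x + S x) ^ d3.
    apply: leq_trans n3b _; apply: leq_trans (bt3 _) _.
    apply: poly_mono => //; first by rewrite /N; lia.
    have := tsize_enc_seq_drop eA dm; have := leS _ _ _ dm'.
    by rewrite /ey /enc_pair /= /N; lia.
  exists (1 + (1 + ((((1 + (1 + 1).+1).+1 + ((1 + 1).+1 + n).+1).+1 + n3).+1)).+1).+1.
    by rewrite /= mulSn; lia.
  apply: EvMatchNode; first exact: EvVar.
  apply: EvMatchNode; first exact: EvVar.
  apply: E3; apply: EvNode.
    by apply: EvNode; [exact: EvVar|apply: EvNode; exact: EvVar].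
  by apply: (@EvCall P _ 1 _ _ _ _ _ _ En); apply: EvNode; exact: EvVar.
have [n nb En] := ev (s x) 0 (drop0 _).
exists ((1 + (1 + n1).+1).+1 + n).+1.
  have : size (s x) * (d3 * (N x + S x) ^ d3 + 40) <= N x * (d3 * (N x + S x) ^ d3 +
    40).
    by rewrite leq_mul2r; apply/orP; right; have := szl (s x); rewrite /N; lia.
  by rewrite /T; lia.
apply: (@EvCall P _ 1 _ _ _ _ _ _ En); apply: EvNode; first exact: EvVar.
by apply: E1; exact: EvVar.
Qed.

(** * Typed polynomial-time functions *)

Definition pt (X B : Type) (eX : X -> tree) (eB : B -> tree) (f : X -> B) : Prop :=
  computes eX (fun x => eB (f x)).

Lemma pt_polytime (X B : Type) (eX : X -> tree) (eB : B -> tree) (f : X -> B) :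
  pt eX eB f -> polytime eX eB f.
Proof.
(* The summand 2 pays for the entry call and the evaluation of its argument. *)
move=> [[c1 b1] [e0 [p [t [[c2 b2] ev]]]]]; exists (e0 :: p), (c1 + c2 + 2) => x.
have x0 := tsize_gt0 (eX x); split.
  by apply: leq_trans (b1 x) _; apply: poly_mono => //; lia.
have [n nt En] := ev x; exists (1 + n).+1.
  apply: leq_trans (_ : 2 + c2 * tsize (eX x) ^ c2 <= _).
    by have := leq_trans nt (b2 x); lia.
  have h : c2 * tsize (eX x) ^ c2 <= c2 * tsize (eX x) ^ (c1 + c2 + 2).
    by rewrite leq_mul2l leq_pexp2l ?orbT //; lia.
  have h2 : 0 < tsize (eX x) ^ (c1 + c2 + 2) by rewrite expn_gt0 x0.
  by rewrite !mulnDl; lia.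
by apply: (@EvCall (e0 :: p) _ 0 _ _ _ _ _ _ En); exact: EvVar.
Qed.

Lemma enc_bool_inj : injective enc_bool.
Proof. by case; case. Qed.

Lemma enc_pair_inj (A B : Type) (eA : A -> tree) (eB : B -> tree) :
  injective eA -> injective eB -> injective (enc_pair eA eB).
Proof. by move=> iA iB [a b] [c d] [/iA -> /iB ->]. Qed.

Lemma enc_seq_inj (A : Type) (eA : A -> tree) :
  injective eA -> injective (enc_seq eA).
Proof. by move=> iA; elim=> [|a s IH] [|b t] //= [/iA -> /IH ->]. Qed.

Definition nat_of_digits (s : seq bool) : nat :=
  foldr (fun (b : bool) n => b + n.*2) 0 s.

Lemma digitsK : cancel digits nat_of_digits.
Proof.
have pd k : nat_of_digits (pos_digits k) = BinPos.Pos.to_nat k.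
  elim: k => [k IH|k IH|] //=; rewrite /nat_of_digits /= -/(nat_of_digits _) IH.
    by rewrite Pnat.Pos2Nat.inj_xI; lia.
  by rewrite Pnat.Pos2Nat.inj_xO; lia.
move=> n; rewrite /digits -{2}[n]bin_of_natK; case: (bin_of_nat n) => //= k.
rewrite pd; elim: k => [k IH|k IH|] //=.
  by rewrite Pnat.Pos2Nat.inj_xI IH NatTrec.doubleE; lia.
by rewrite Pnat.Pos2Nat.inj_xO IH NatTrec.doubleE; lia.
Qed.

Lemma enc_nat_inj : injective enc_nat.
Proof. by move=> m n /(enc_seq_inj enc_bool_inj) /(can_inj digitsK). Qed.

(* [2 ^ k - 1], whose binary representation is unary notation for [k]. *)
Definition ones (k : nat) : nat := nat_of_digits (nseq k true).

Lemma digits_ones k : digits (ones k) = nseq k true.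
Proof.
case: k => // k.
pose p := iter k xI xH.
have dp : pos_digits p = nseq k.+1 true by rewrite /p; elim: k {p} => //= k ->.
have -> : ones k.+1 = nat_of_bin (Npos p).
  rewrite /ones -dp /=; elim: (p) => [q IH|q IH|] //=;
    by rewrite /nat_of_digits /= -/(nat_of_digits _) IH NatTrec.doubleE.
by rewrite /digits nat_of_binK.
Qed.

Notation elit := (enc_pair enc_bool enc_nat).

Lemma elit_inj : injective elit.
Proof. exact: enc_pair_inj enc_bool_inj enc_nat_inj. Qed.

Section Combinators.
Context (X : Type) (eX : X -> tree).

Lemma pt_id : pt eX eX (fun x => x).
Proof. exact: computes_id. Qed.

Lemma pt_const (B : Type) (eB : B -> tree) (b : B) : pt eX eB (fun=> b).
Proof. exact: computes_const. Qed.

Lemma pt_comp (A B : Type) (eA : A -> tree) (eB : B -> tree) (u : X -> A) (f : A ->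
  B) :
  pt eX eA u -> pt eA eB f -> pt eX eB (fun x => f (u x)).
Proof. move=> Hu Hf; exact: (computes_comp Hu Hf). Qed.

Lemma pt_ext (B : Type) (eB : B -> tree) (f g : X -> B) :
  f =1 g -> pt eX eB f -> pt eX eB g.
Proof. by move=> fg; apply: computes_ext => x; rewrite fg. Qed.

Lemma pt_pair (A B : Type) (eA : A -> tree) (eB : B -> tree) f g :
  pt eX eA f -> pt eX eB g -> pt eX (enc_pair eA eB) (fun x => (f x, g x)).
Proof. exact: computes_node. Qed.

Lemma pt_fst (A B : Type) (eA : A -> tree) (eB : B -> tree) (f : X -> A * B) :
  pt eX (enc_pair eA eB) f -> pt eX eA (fun x => (f x).1).
Proof. exact: computes_fst. Qed.

Lemma pt_snd (A B : Type) (eA : A -> tree) (eB : B -> tree) (f : X -> A * B) :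
  pt eX (enc_pair eA eB) f -> pt eX eB (fun x => (f x).2).
Proof. exact: computes_snd. Qed.

Lemma pt_cons (A : Type) (eA : A -> tree) f g :
  pt eX eA f -> pt eX (enc_seq eA) g -> pt eX (enc_seq eA) (fun x => f x :: g x).
Proof. exact: computes_node. Qed.

Lemma pt_if (B : Type) (eB : B -> tree) (c : X -> bool) f g :
  pt eX enc_bool c -> pt eX eB f -> pt eX eB g ->
  pt eX eB (fun x => if c x then f x else g x).
Proof.
move=> Hc Hf Hg; apply: (computes_match Hc).
  (* [false] is encoded by [Leaf], so the leaf branch is the negative one. *)
  apply: (@computes_ext _ _ (fun x => eB (g (sval x)))) => [[x /=]|].
    by case: (c x).
  exact: (computes_comp (j := eX) (computes_id _) Hg).
apply: (@computes_ext _ _ (fun x => eB (f (sval x)))) => [[x /=]|].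
  by case: (c x).
exact: (computes_comp (j := eX) (computes_id _) Hf).
Qed.

Lemma pt_eq (A : eqType) (eA : A -> tree) (f g : X -> A) : injective eA ->
  pt eX eA f -> pt eX eA g -> pt eX enc_bool (fun x => f x == g x).
Proof.
move=> iA Hf Hg; apply: computes_ext (computes_eqtree Hf Hg) => x.
by congr enc_bool; apply/eqtreeP/eqP => [/iA|->].
Qed.

Lemma pt_lrec (A R : Type) (eA : A -> tree) (eR : R -> tree)
    (s : X -> seq A) (b : X -> R) (g : X -> A -> seq A -> R -> R)
    (k : X * (A * seq A) -> nat) :
  let ey := enc_pair eX (enc_pair eA (enc_seq eA)) in
  pt eX (enc_seq eA) s -> pt eX eR b ->
  pt (enc_pair ey eR) eR (fun y => g y.1.1 y.1.2.1 y.1.2.2 y.2) ->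
  pbounded ey k ->
  (forall x a l r, tsize (eR (g x a l r)) <= tsize (eR r) + k (x, (a, l))) ->
  pt eX eR (fun x => lrec (g x) (b x) (s x)).
Proof. exact: computes_lrec. Qed.

Lemma pt_pbounded (B : Type) (eB : B -> tree) (f : X -> B) :
  pt eX eB f -> pbounded eX (fun x => tsize (eB (f x))).
Proof. by case. Qed.

End Combinators.

Lemma pt_proj1 (A B : Type) (eA : A -> tree) (eB : B -> tree) :
  pt (enc_pair eA eB) eA fst.
Proof. exact: pt_fst (pt_id _). Qed.

Lemma pt_proj2 (A B : Type) (eA : A -> tree) (eB : B -> tree) :
  pt (enc_pair eA eB) eB snd.
Proof. exact: pt_snd (pt_id _). Qed.

Ltac pt_basic :=
  repeat (first
  [ assumption
  | simple eapply pt_id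
  | simple eapply pt_proj1
  | simple eapply pt_proj2
  | simple eapply pt_const
  | simple eapply pt_pair
  | simple eapply pt_cons
  | simple eapply pt_if
  | simple eapply pt_fst
  | simple eapply pt_snd ]).

(** * Recursion schemes that produce lists of lines *)

Definition sweep (A B : Type) (g : A -> seq A -> seq B) : seq A -> seq B :=
  lrec (fun a s r => g a s ++ r) [::].

(** The mirror image of [sweep]: blocks of later elements come first. It serves derivations that
    build a formula from its innermost part outwards, since a line may use only earlier lines. *)
Definition sweepr (A B : Type) (g : A -> seq A -> seq B) : seq A -> seq B :=
  lrec (fun a s r => r ++ g a s) [::].

(** Stopping at the first hit gives one block for each premise literal, however many conclusion
    literals fit it. *)
Definition onfirst (A B : Type) (p : pred A) (g : A -> seq B) : seq A -> seq B :=
  lrec (fun a _ r => if p a then g a else r) [::].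

Arguments sweep : simpl never.
Arguments sweepr : simpl never.
Arguments onfirst : simpl never.

Lemma tsize_enc_seq_cat (A : Type) (eA : A -> tree) (s t : seq A) :
  tsize (enc_seq eA (s ++ t)) <= tsize (enc_seq eA s) + tsize (enc_seq eA t).
Proof. by elim: s => //= a s; lia. Qed.

Section Cat.
Context (X : Type) (eX : X -> tree).

Lemma pt_cat (A : Type) (eA : A -> tree) f g :
  pt eX (enc_seq eA) f -> pt eX (enc_seq eA) g ->
  pt eX (enc_seq eA) (fun x => f x ++ g x).
Proof.
move=> Hf Hg;
  apply: (@pt_ext _ _ _ _ (fun x => lrec (fun a _ r => a :: r) (g x) (f x))).
  by move=> x; elim: (f x) => //= a s ->.
apply: (@pt_lrec _ _ _ _ eA _ _ _ (fun _ a _ r => a :: r)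
  (fun y => tsize (enc_pair eX (enc_pair eA (enc_seq eA)) y))) => //.
- by pt_basic.
- exact: pbounded_size.
- by move=> x a l r /=; lia.
Qed.

End Cat.

Section ListCombinators.
Context (X : Type) (eX : X -> tree).

Lemma pt_sweep (A B : Type) (eA : A -> tree) (eB : B -> tree) s g :
  pt eX (enc_seq eA) s ->
  pt (enc_pair eX (enc_pair eA (enc_seq eA))) (enc_seq eB)
    (fun y => g y.1 y.2.1 y.2.2) ->
  pt eX (enc_seq eB) (fun x => sweep (g x) (s x)).
Proof.
move=> Hs Hg.
apply: (@pt_lrec _ _ _ _ eA _ _ _ (fun x a l r => g x a l ++ r)
  (fun y => tsize (enc_seq eB (g y.1 y.2.1 y.2.2)))) => //.
- exact: pt_const.
- apply: pt_cat; last by pt_basic.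
  by apply: (pt_comp (f := fun y => g y.1 y.2.1 y.2.2) _ Hg); pt_basic.
- exact: pt_pbounded Hg.
- by move=> x a l r; rewrite addnC; apply: tsize_enc_seq_cat.
Qed.

Lemma pt_sweepr (A B : Type) (eA : A -> tree) (eB : B -> tree) s g :
  pt eX (enc_seq eA) s ->
  pt (enc_pair eX (enc_pair eA (enc_seq eA))) (enc_seq eB)
    (fun y => g y.1 y.2.1 y.2.2) ->
  pt eX (enc_seq eB) (fun x => sweepr (g x) (s x)).
Proof.
move=> Hs Hg.
apply: (@pt_lrec _ _ _ _ eA _ _ _ (fun x a l r => r ++ g x a l)
  (fun y => tsize (enc_seq eB (g y.1 y.2.1 y.2.2)))) => //.
- exact: pt_const.
- apply: pt_cat; first by pt_basic.
  by apply: (pt_comp (f := fun y => g y.1 y.2.1 y.2.2) _ Hg); pt_basic.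
- exact: pt_pbounded Hg.
- by move=> x a l r; apply: tsize_enc_seq_cat.
Qed.

Lemma pt_onfirst (A B : Type) (eA : A -> tree) (eB : B -> tree) s p g :
  pt eX (enc_seq eA) s ->
  pt (enc_pair eX eA) enc_bool (fun y => p y.1 y.2) ->
  pt (enc_pair eX eA) (enc_seq eB) (fun y => g y.1 y.2) ->
  pt eX (enc_seq eB) (fun x => onfirst (p x) (g x) (s x)).
Proof.
move=> Hs Hp Hg.
have Hg' : pt (enc_pair eX (enc_pair eA (enc_seq eA))) (enc_seq eB)
    (fun y => g y.1 y.2.1).
  by apply: (pt_comp (u := fun y => (y.1, y.2.1)) _ Hg); pt_basic.
apply: (@pt_lrec _ _ _ _ eA _ _ _ (fun x a l r => if p x a then g x a else r)
  (fun y => tsize (enc_seq eB (g y.1 y.2.1)))) => //.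
- exact: pt_const.
- apply: pt_if; last by pt_basic.
    by apply: (pt_comp (u := fun y => (y.1.1, y.1.2.1)) _ Hp); pt_basic.
  by apply: (pt_comp (u := fun y => y.1) _ Hg'); pt_basic.
- exact: pt_pbounded Hg'.
- by move=> x a l r; case: ifP => _ /=; lia.
Qed.

Lemma pt_lift (A B D : Type) (eA : A -> tree) (eB : B -> tree) (eD : D -> tree) g :
  pt (enc_pair eX eA) eD (fun y => g y.1 y.2) ->
  pt (enc_pair eX (enc_pair eA eB)) eD (fun y => g y.1 y.2.1).
Proof. by move=> Hg; apply: (pt_comp (u := fun y => (y.1, y.2.1)) _ Hg);
  pt_basic. Qed.

Lemma pt_flatmap (A B : Type) (eA : A -> tree) (eB : B -> tree) s g :
  pt eX (enc_seq eA) s ->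
  pt (enc_pair eX eA) (enc_seq eB) (fun y => g y.1 y.2) ->
  pt eX (enc_seq eB) (fun x => flatten [seq g x a | a <- s x]).
Proof.
move=> Hs Hg; apply: (@pt_ext _ _ _ _ (fun x => sweep (fun a _ => g x a) (s x))).
  by move=> x; rewrite /sweep; elim: (s x) => //= a l ->.
by apply: (pt_sweep (g := fun x a _ => g x a) Hs); apply: pt_lift Hg.
Qed.

Lemma pt_map (A B : Type) (eA : A -> tree) (eB : B -> tree) s g :
  pt eX (enc_seq eA) s ->
  pt (enc_pair eX eA) eB (fun y => g y.1 y.2) ->
  pt eX (enc_seq eB) (fun x => [seq g x a | a <- s x]).
Proof.
move=> Hs Hg; apply: (@pt_ext _ _ _ _ (fun x => flatten [seq [:: g x a] | a <- s x])).
  by move=> x; elim: (s x) => //= a l ->.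
by apply: (pt_flatmap (g := fun x a => [:: g x a]) Hs); pt_basic.
Qed.

Lemma pt_filter (A : Type) (eA : A -> tree) s p :
  pt eX (enc_seq eA) s ->
  pt (enc_pair eX eA) enc_bool (fun y => p y.1 y.2) ->
  pt eX (enc_seq eA) (fun x => [seq a <- s x | p x a]).
Proof.
move=> Hs Hp; apply: (@pt_ext _ _ _ _
    (fun x => flatten [seq if p x a then [:: a] else [::] | a <- s x])).
  by move=> x; elim: (s x) => //= a l ->; case: ifP.
by apply: (pt_flatmap (g := fun x a => if p x a then [:: a] else [::]) Hs); pt_basic.
Qed.

Lemma pt_has (A : Type) (eA : A -> tree) s p :
  pt eX (enc_seq eA) s ->
  pt (enc_pair eX eA) enc_bool (fun y => p y.1 y.2) ->
  pt eX enc_bool (fun x => has (p x) (s x)).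
Proof.
move=> Hs Hp; apply: (@pt_ext _ _ _ _
    (fun x => lrec (fun a _ r => if p x a then true else r) false (s x))).
  by move=> x; elim: (s x) => //= a l ->; case: (p x a).
apply: (@pt_lrec _ _ _ _ eA _ _ _ (fun x a _ r => if p x a then true else r)
  (fun=> 3)) => //.
- exact: pt_const.
- apply: pt_if; last by pt_basic.
    by apply: (pt_comp (u := fun y => (y.1.1, y.1.2.1)) _ Hp); pt_basic.
  exact: pt_const.
- exact: pbounded_const.
- by move=> x a l r; case: ifP => _ /=; lia.
Qed.

Lemma pt_not (b : X -> bool) : pt eX enc_bool b -> pt eX enc_bool (fun x => ~~ b x).
Proof. by move=> H; apply: pt_if H _ _; apply: pt_const. Qed.

Lemma pt_and (b c : X -> bool) :
  pt eX enc_bool b -> pt eX enc_bool c -> pt eX enc_bool (fun x => b x && c x).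
Proof. by move=> Hb Hc; apply: pt_if Hb Hc _; apply: pt_const. Qed.

Lemma pt_or (b c : X -> bool) :
  pt eX enc_bool b -> pt eX enc_bool c -> pt eX enc_bool (fun x => b x || c x).
Proof. by move=> Hb Hc; apply: pt_if Hb _ Hc; apply: pt_const. Qed.

End ListCombinators.

Section MoreListCombinators.
Context (X : Type) (eX : X -> tree).

Lemma pt_all (A : Type) (eA : A -> tree) s p :
  pt eX (enc_seq eA) s ->
  pt (enc_pair eX eA) enc_bool (fun y => p y.1 y.2) ->
  pt eX enc_bool (fun x => all (p x) (s x)).
Proof.
move=> Hs Hp; apply: (@pt_ext _ _ _ _ (fun x => ~~ has (fun a => ~~ p x a) (s x))).
  by move=> x; rewrite has_predC negbK.
by apply: pt_not; apply: (pt_has (p := fun x a => ~~ p x a) Hs); apply: pt_not.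
Qed.

Lemma pt_mem (A : eqType) (eA : A -> tree) s f : injective eA ->
  pt eX (enc_seq eA) s -> pt eX eA f -> pt eX enc_bool (fun x => f x \in s x).
Proof.
move=> iA Hs Hf.
apply: (@pt_ext _ _ _ _ (fun x => has (fun a => a == f x) (s x))).
  by move=> x; rewrite has_pred1.
apply: (pt_has (p := fun x a => a == f x) Hs); apply: (pt_eq iA).
  exact: pt_proj2.
by apply: (pt_comp (u := fst) _ Hf); pt_basic.
Qed.

Lemma pt_nilp (A : Type) (eA : A -> tree) s :
  pt eX (enc_seq eA) s -> pt eX enc_bool (fun x => nilp (s x)).
Proof.
move=> Hs; apply: (@pt_ext _ _ _ _ (fun x => ~~ has xpredT (s x))).
  by move=> x; rewrite has_predT /nilp; case: (s x).
by apply: pt_not; apply: (pt_has (p := fun _ _ => true) Hs); apply: pt_const.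
Qed.

(** The length of a list becomes a number by mapping every element to the digit [true]; no
    arithmetic is programmed. *)
Lemma pt_ones (A : Type) (eA : A -> tree) s :
  pt eX (enc_seq eA) s -> pt eX enc_nat (fun x => ones (size (s x))).
Proof.
move=> Hs; apply: (@computes_ext _ _ (fun x =>
  enc_seq enc_bool [seq true | _ <- s x])).
  by move=> x; rewrite /enc_nat digits_ones; elim: (s x) => //= a l ->.
exact: (pt_map (g := fun _ _ => true) Hs (pt_const _ _ _)).
Qed.

End MoreListCombinators.

Lemma pt_undup (X : Type) (eX : X -> tree) (A : eqType) (eA : A -> tree) s :
  injective eA ->
  pt eX (enc_seq eA) s -> pt eX (enc_seq eA) (fun x => undup (s x)).
Proof.
move=> iA Hs; apply: (@pt_ext _ _ _ _
    (fun x => sweep (fun a l => if a \in l then [::] else [:: a]) (s x))).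
  by move=> x; rewrite /sweep; elim: (s x) => //= a l ->; case: ifP.
apply: (pt_sweep (g := fun _ a l => if a \in l then [::] else [:: a]) Hs).
by apply: pt_if; [apply: (pt_mem iA)| |]; pt_basic.
Qed.

(** * Frege proofs and the translation *)

Fixpoint frege_proof (F : seq frege_rule) (L pf : seq form) : Prop :=
  if pf is A :: pf' then by_frege F L A /\ frege_proof F (A :: L) pf' else True.

Lemma by_frege_sub F (L L' : seq form) A :
  {subset L <= L'} -> by_frege F L A -> by_frege F L' A.
Proof. by move=> LL' [r [s [rF H ->]]]; exists r, s; split=> // B /H /LL'. Qed.

Lemma frege_proof_sub F (L L' pf : seq form) :
  {subset L <= L'} -> frege_proof F L pf -> frege_proof F L' pf.
Proof.
elim: pf L L' => //= A pf IH L L' LL' [/(by_frege_sub LL') bA vpf].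
by split=> //; apply: IH vpf => B; rewrite !inE => /orP[->|/LL' ->]; rewrite ?orbT.
Qed.

Lemma frege_proof_cat F (L p q : seq form) :
  frege_proof F L p -> frege_proof F (p ++ L) q -> frege_proof F L (p ++ q).
Proof.
elim: p L => //= A p IH L [bA vp] vq; split=> //; apply: IH => //.
by apply: frege_proof_sub vq => B; rewrite !(inE, mem_cat) => /or3P[] ->;
  rewrite ?orbT.
Qed.

(** Linearises a derivation tree. The conclusion is left off the list: a hypothesis has no line of
    its own, and any other conclusion follows by one more rule. *)
Lemma frege_derives_proof F G A : frege_derives F G A ->
  exists2 pf, frege_proof F G pf & A \in G \/ by_frege F (pf ++ G) A.
Proof.
elim=> {A} [A AG|r s rF _ IH]; first by exists [::] => //; left.
have [pf vpf inpf] : exists2 pf, frege_proof F G pf &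
    {in r.1, forall B, fsubst s B \in pf ++ G}.
  (* Induction over a list of premises that remembers their membership in [r.1], because the
     induction hypothesis covers only those. *)
  elim: {-2}r.1 (fun B (h : B \in r.1) => h) => [|B l IHl] sub.
    by exists [::].
  have [|pf1 v1 in1] := IHl; first by move=> C Cl; apply: sub; rewrite inE Cl orbT.
  have [pf2 v2 [BG|bB]] := IH B (sub _ (mem_head _ _)).
    by exists pf1 => // C; rewrite inE => /predU1P[->|/in1 //];
      rewrite mem_cat BG orbT.
  exists (pf1 ++ rcons pf2 (fsubst s B)).
    rewrite -cats1; apply: frege_proof_cat => //.
    apply: frege_proof_cat; first by apply: frege_proof_sub v2 => C CG;
      rewrite mem_cat CG orbT.
    split=> //; apply: by_frege_sub bB => C.
    by rewrite !mem_cat => /orP[] ->; rewrite ?orbT.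
  move=> C; rewrite inE => /predU1P[->|/in1]; rewrite !mem_cat mem_rcons.
    by rewrite mem_head orbT.
  by move=> /orP[] ->; rewrite ?orbT.
by exists pf => //; right; exists r, s.
Qed.

(* A conclusion that is not a premise is obtained by a rule, so it can be listed
   as the last line of its proof. *)
Lemma frege_proofs F (hF : frege_system F) (rs : seq frege_rule) :
  (forall r, r \in rs -> entails r.1 r.2 /\ r.2 \notin r.1) ->
  exists pfs, forall i, i < size rs ->
    let r := nth ([::], FTrue) rs i in
    frege_proof F r.1 (rcons (nth [::] pfs i) r.2).
Proof.
elim: rs => [|r rs IH] H; first by exists [::].
have [|pfs Hp] := IH; first by move=> r' r'rs; apply: H; rewrite inE r'rs orbT.
have [ent nin] := H r (mem_head _ _).
have [pf vpf [rr|br]] := frege_derives_proof (hF.2 _ _ ent);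
  first by rewrite rr in nin.
exists (pf :: pfs) => -[_|i ilt]; last exact: Hp.
by move=> r0; rewrite /r0 /= -cats1; apply: frege_proof_cat.
Qed.

Lemma fsubst_comp s t A : fsubst s (fsubst t A) = fsubst (fun x => fsubst s (t x)) A.
Proof. by elim: A => //= [B ->|B -> C ->|B -> C ->|B -> C ->|B -> C ->]. Qed.

(** No conclusion is among its own premises, as [frege_proofs] requires. This is why [FFalse] is
    repeated by way of [FAnd FFalse FFalse]. *)
Definition schemes : seq frege_rule :=
  let a := FVar 0 in let b := FVar 1 in let c := FVar 2 in let d := FVar 3 in
  let e := FVar 4 in
  [:: ([::], FImp a a);
      ([:: FImp (FOr a b) c], FImp a c);
      ([:: FImp (FOr a b) c], FImp b c);
      ([::], FImp FFalse a);
      ([:: FImp a c; FImp b c], FImp (FOr a b) c);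
      ([:: FImp a (FAnd b c)], FImp a b);
      ([:: FImp a (FAnd b c)], FImp a c);
      ([::], FImp a FTrue);
      ([:: FImp a b; FImp a c], FImp a (FAnd b c));
      ([:: FImp a b; FImp b c], FImp a c);
      ([:: FImp a (FIff b c); FImp a (FIff d c)], FImp a (FIff b d));
      ([:: FImp a (FIff b c); FImp d a; FImp c e], FImp b (FImp d e));
      ([:: FImp a (FIff b c); FImp d a; FImp (FNot c) e],
         FImp (FNot b) (FImp d e));
      ([:: FImp b (FNot a)], FImp a (FImp b c));
      ([:: FImp b a], FImp (FNot a) (FImp b c));
      ([:: a; FImp a b], b);
      ([:: FImp (FAnd FTrue a) b], FImp a b);
      ([:: FImp (FAnd (FNot FFalse) a) b], FImp a b);
      ([:: FImp FTrue a], a);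
      ([:: FImp a c], FImp a (FImp b c));
      ([::], FImp (FNot a) (FImp a b));
      ([::], FImp FTrue (FIff a a));
      ([:: FFalse], FAnd FFalse FFalse);
      ([:: FAnd FFalse FFalse], FFalse)].

Notation s_id := 0 (only parsing).
Notation s_or_l := 1 (only parsing).
Notation s_or_r := 2 (only parsing).
Notation s_false := 3 (only parsing).
Notation s_case := 4 (only parsing).
Notation s_and_l := 5 (only parsing).
Notation s_and_r := 6 (only parsing).
Notation s_true := 7 (only parsing).
Notation s_and := 8 (only parsing).
Notation s_trans := 9 (only parsing).
Notation s_iff := 10 (only parsing).
Notation s_pos_item := 11 (only parsing).
Notation s_neg_item := 12 (only parsing).
Notation s_pos_univ := 13 (only parsing).
Notation s_neg_univ := 14 (only parsing).
Notation s_mp := 15 (only parsing).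
Notation s_red_pos := 16 (only parsing).
Notation s_red_neg := 17 (only parsing).
Notation s_top := 18 (only parsing).
Notation s_weaken := 19 (only parsing).
Notation s_pivot := 20 (only parsing).
Notation s_refl := 21 (only parsing).
Notation s_dup_false := 22 (only parsing).
Notation s_undup_false := 23 (only parsing).

Lemma schemes_sound r : r \in schemes -> entails r.1 r.2 /\ r.2 \notin r.1.
Proof.
suff: all (fun r : frege_rule => r.2 \notin r.1) schemes /\
    (forall v, all (fun r => all (feval v) r.1 ==> feval v r.2) schemes).
  move=> [/allP H1 H2] rS; split; last exact: H1.
  by move=> v /allP; have /allP/(_ r rS)/implyP := H2 v.
split.
  by rewrite /= !inE; do ?[apply/andP; split]; rewrite ?negb_or //;
    do ?[apply/andP; split]; apply/eqP; discriminate.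
(* Only five metavariables occur, so soundness is a check of 32 valuations. *)
move=> v; rewrite /schemes /=; move: (v 0) (v 1) (v 2) (v 3) (v 4).
by do 5 case.
Qed.

(** Always closed by [FTrue], unlike the [conj_form] prescribed by the extension axioms: the head is
    a conjunct even when it is the only literal, so all literals are reduced in the same way and the
    exhausted guard is [FTrue]. *)
Definition hconj (s : seq lit) : form :=
  lrec (fun l _ A => FAnd (lit_form l) A) FTrue s.

Arguments hconj : simpl never.
Arguments disj_form : simpl never.
Arguments conj_form : simpl never.

(* Annotated clauses with finite sets replaced by their enumerations, which have
   the same encodings. *)
Definition rclause : Type := seq (lit * seq lit).

Inductive rrule :=
| RAx of seq lit
| RInst of rclause & seq lit
| RRes of rclause & rclause & nat & seq lit.

Section Translation.
Context (pfs : seq (seq form)).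

(** The list ends with the conclusion of scheme [i]. Variables of the fixed proof beyond the
    arguments become [FFalse], so they bring in neither new variables nor large formulas. *)
Definition instance (i : nat) (args : seq form) : seq form :=
  [seq fsubst (nth FFalse args) A
     | A <- rcons (nth [::] pfs i) (nth ([::], FTrue) schemes i).2].

(** Starting from [Z -> Z], the left side is split literal by literal while the right side stays.
    One pass serves all literals; a separate derivation for each would need quadratically many
    lines. *)
Definition disj_inj (ls : seq lit) : seq form :=
  let Z := disj_form ls in
  instance s_id [:: Z] ++
  sweep (fun l s => if nilp s then [::] else
    instance s_or_l [:: lit_form l; disj_form s; Z] ++
    instance s_or_r [:: lit_form l; disj_form s; Z]) ls.

Definition disj_elim (Z : form) (ls : seq lit) : seq form :=
  instance s_false [:: Z] ++
  sweepr (fun l s => if nilp s then [::] else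
    instance s_case [:: lit_form l; disj_form s; Z]) ls.

Definition conj_proj (ls : seq lit) : seq form :=
  let H := hconj ls in
  instance s_id [:: H] ++
  sweep (fun l s => instance s_and_l [:: H; lit_form l; hconj s] ++
                    instance s_and_r [:: H; lit_form l; hconj s]) ls.

Definition conj_build (H : form) (ls : seq lit) : seq form :=
  instance s_true [:: H] ++
  sweepr (fun l s => if nilp s then [::] else
    instance s_and [:: H; lit_form l; conj_form s]) ls.

Definition hconj_build (H : form) (ls : seq lit) : seq form :=
  instance s_true [:: H] ++
  sweepr (fun l s => instance s_and [:: H; lit_form l; hconj s]) ls.

(** The constant substituted for the variable satisfies the literal, so [FTrue] or [FNot FFalse] is
    left in its place, according to its sign; a scheme then drops it. *)
Definition reduce_step (X : form) (t : seq lit) (l : lit) (s : seq lit) : seq form :=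
  FImp (FAnd (if l.1 then FTrue else FNot FFalse) (hconj (s ++ t))) X ::
  (if l.1 then instance s_red_pos [:: hconj (s ++ t); X]
   else instance s_red_neg [:: hconj (s ++ t); X]).

Definition reduce (X : form) (t ls : seq lit) : seq form :=
  sweep (reduce_step X t) ls.

Section Naming.
Context (name_of : nat * seq lit -> nat).

Definition lits (C : rclause) : seq lit :=
  [seq (p.1.1, name_of (p.1.2, p.2)) | p <- C].

Definition fixed (B a : seq lit) : seq lit := [seq l <- a | l \notin B].
Definition moved (B a : seq lit) : seq lit := [seq l <- a | l \in B].

(* The literals outside [B] come first so that they can be reduced first. *)
Definition hyp (B a : seq lit) : form := hconj (fixed B a ++ moved B a).

Definition group (B : seq lit) (q : lit * seq lit) : seq form :=
  let G := hyp B q.2 in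
  conj_proj (fixed B q.2 ++ moved B q.2) ++ conj_build G q.2 ++
  instance s_trans [:: G; conj_form q.2;
    FIff (FVar (name_of (q.1.2, q.2))) (FVar q.1.2)] ++
  hconj_build (hconj B) (moved B q.2).

(* [((s, f), (x, a))] is the literal of sign [s] over the variable [f], which
   agrees with [x] under [a]. *)
Definition item : Type := (bool * nat) * (nat * seq lit).

(** Recognises the image of a premise literal by containments instead of recomputing the composition
    of annotations; any match will do for [itemP]. *)
Definition matches (B : seq lit) (it : item) (q : lit * seq lit) : bool :=
  [&& q.1 == (it.1.1, it.2.1), all (fun l => l \in q.2) it.2.2
    & all (fun l => (l \in it.2.2) || (l \in B)) q.2].

Definition item_step (B : seq lit) (Z : form) (it : item) (q : lit * seq lit)
    : seq form :=
  let G := hyp B q.2 in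
  let f := FVar it.1.2 in
  let v := FVar (name_of (q.1.2, q.2)) in
  let K := hconj (moved B q.2) in
  conj_build G it.2.2 ++
  instance s_trans [:: G; conj_form it.2.2; FIff f (FVar it.2.1)] ++
  instance s_iff [:: G; f; FVar it.2.1; v] ++
  reduce (FIff f v) (moved B q.2) (fixed B q.2) ++
  (if it.1.1 then instance s_pos_item [:: K; f; v; hconj B; Z]
   else instance s_neg_item [:: K; f; v; hconj B; Z]).

(* From the clause [ls], whose literals are those of [its] and the universal
   literals [us] falsified by [B], derives the clause [C']. *)
Definition link (B us : seq lit) (its : seq item) (C' : rclause) (ls : seq lit)
    : seq form :=
  let Z := disj_form (lits C') in
  let H := hconj B in
  let X := FImp H Z in
  disj_inj (lits C') ++ conj_proj B ++ flatten [seq group B q | q <- C'] ++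
  flatten [seq onfirst (matches B it) (item_step B Z it) C' | it <- its] ++
  flatten [seq if l.1 then instance s_pos_univ [:: FVar l.2; H; Z]
               else instance s_neg_univ [:: FVar l.2; H; Z] | l <- us] ++
  disj_elim X ls ++ instance s_mp [:: disj_form ls; X] ++
  reduce Z [::] B ++ instance s_top [:: Z].

(** The clause with the negated pivot yields [v -> Z]: its pivot literal by explosion, its other
    literals because they imply [Z]. Then every literal of the other clause, [v] included, implies
    [Z]. *)
Definition res_lines (C1 C2 : rclause) (x : nat) (t : seq lit) (C' : rclause)
    : seq form :=
  let Z := disj_form (lits C') in
  let v := name_of (x, t) in
  let X := FImp (FVar v) Z in
  disj_inj (lits C') ++
  flatten [seq if l == (false, v) then instance s_pivot [:: FVar v; Z]
               else instance s_weaken [:: lit_form l; FVar v; Z] | l <- lits C2] ++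
  disj_elim X (lits C2) ++ instance s_mp [:: disj_form (lits C2); X] ++
  disj_elim Z (lits C1) ++ instance s_mp [:: disj_form (lits C1); Z].

(** An existential literal of a matrix clause is treated as one with empty annotation that is its
    own extension variable, witnessed by [FTrue -> (x <-> x)]. Thus axioms and instantiations share
    [link]. *)
Definition ax_lines (U : seq nat) (C : seq lit) (C' : rclause) : seq form :=
  let us := [seq l <- C | l.2 \in U] in
  let es := [seq l <- C | l.2 \notin U] in
  [:: disj_form C] ++ flatten [seq instance s_refl [:: FVar l.2] | l <- es] ++
  link (undup [seq (~~ l.1, l.2) | l <- us]) us
    [seq ((l.1, l.2), (l.2, [::])) | l <- es] C' C.

(** [b] may be much longer than any clause. Only its literals that occur in some annotation of the
    conclusion enter the guard, which keeps the guard no larger than a clause. *)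
Definition inst_lines (C : rclause) (b : seq lit) (C' : rclause) : seq form :=
  link [seq l <- b | has (fun q : lit * seq lit => l \in q.2) C'] [::]
    [seq ((p.1.1, name_of (p.1.2, p.2)), (p.1.2, p.2)) | p <- C] C' (lits C).

Definition line_lines (U : seq nat) (p : rclause * rrule) : seq form :=
  match p.2 with
  | RAx C => ax_lines U C p.1
  | RInst C b => inst_lines C b p.1
  | RRes C1 C2 x t => res_lines C1 C2 x t p.1
  end.

End Naming.

(* The digits of a name are longer than [k], hence than those of any variable of
   the input; names are told apart by the length of the table suffix [s]. *)
Definition name (k : seq bool) (s : seq (nat * seq lit)) : nat :=
  ones (size (true :: k ++ [seq true | _ <- s])).

Definition name_of (k : seq bool) (T : seq (nat * seq lit)) (q : nat * seq lit)
    : nat :=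
  lrec (fun a s r => if a == q then name k s else r) 0 T.

Definition exts (k : seq bool) (T : seq (nat * seq lit)) : seq dfr_step :=
  sweepr (fun q s => [:: Ext true q.2 [:: (true, q.1)] (name k s)]) T.

(** Repetitions are harmless: every entry gets a variable of its own, and [name_of] always returns
    the one of the first matching entry. *)
Definition table (pi : seq (rclause * rrule)) : seq (nat * seq lit) :=
  flatten [seq [seq (p.1.2, p.2) | p <- ln.1] | ln <- pi].

(* The last two instances derive [FFalse] once more, so that it is the last line
   whichever line of the refutation is empty. *)
Definition translate (x : dqbf * seq (rclause * rrule)) : seq dfr_step :=
  let P := dprefix x.1 in
  let k := flatten [seq digits v | v <- pvars P] in
  let T := table x.2 in
  exts k T ++
  [seq Line A | A <- flatten [seq line_lines (name_of k T) (univ P) ln | ln <- x.2] ++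
                     instance s_dup_false [::] ++ instance s_undup_false [::]].

End Translation.

Definition raw_clause (C : aclause) : rclause :=
  [seq (p.1, enum_fset p.2) | p <- enum_fset C].

Definition raw_rule (r : ir_rule) : rrule :=
  match r with
  | IRAxiom C => RAx C
  | IRInst C b => RInst (raw_clause C) (enum_fset b)
  | IRRes C1 C2 x t => RRes (raw_clause C1) (raw_clause C2) x (enum_fset t)
  end.

Definition raw_line (p : ir_line) : rclause * rrule := (raw_clause p.1, raw_rule p.2).

(** * Validity of the derived lines *)

Lemma fvars_subst s A x :
  x \in fvars (fsubst s A) -> exists2 y, y \in fvars A & x \in fvars (s y).
Proof.
elim: A => //= [y|B IHB C IHC|B IHB C IHC|B IHB C IHC|B IHB C IHC].
  by exists y; rewrite ?inE.
all: rewrite mem_cat => /orP[/IHB|/IHC] [y yA xy]; exists y => //;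
  by rewrite mem_cat yA ?orbT.
Qed.

Lemma fsize_subst s A m :
  0 < m -> (forall y, y \in fvars A -> fsize (s y) <= m) ->
  fsize (fsubst s A) <= fsize A * m.
Proof.
move=> m0; elim: A =>
  /= [y| | |B IHB|B IHB C IHC|B IHB C IHC|B IHB C IHC|B IHB C IHC] H.
- by rewrite mul1n; apply: H; rewrite inE.
- by rewrite mul1n.
- by rewrite mul1n.
- by rewrite mulSn; have := IHB H; lia.
all: rewrite mulSn mulnDl -add1n; apply: leq_add => //; apply: leq_add;
  [apply: IHB => y yB|apply: IHC => y yC]; by apply: H; rewrite mem_cat ?yB ?yC ?orbT.
Qed.

Lemma fsubst_id s A : (forall y, y \in fvars A -> s y = FVar y) -> fsubst s A = A.
Proof.
elim: A => //= [y|B IHB|B IHB C IHC|B IHB C IHC|B IHB C IHC|B IHB C IHC] H.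
- by apply: H; rewrite inE.
- by rewrite IHB.
all: by rewrite IHB ?IHC // => y yA; apply: H; rewrite mem_cat yA ?orbT.
Qed.

Lemma fvars_lit l : fvars (lit_form l) = [:: l.2].
Proof. by case: l => [[] x]. Qed.

Lemma fsize_lit l : fsize (lit_form l) <= 2.
Proof. by case: l => [[] x]. Qed.

Lemma disj_cons l s : ~~ nilp s ->
  disj_form (l :: s) = FOr (lit_form l) (disj_form s).
Proof. by case: s. Qed.

Lemma conj_cons l s : ~~ nilp s ->
  conj_form (l :: s) = FAnd (lit_form l) (conj_form s).
Proof. by case: s. Qed.

Lemma fvars_disj ls : fvars (disj_form ls) = map snd ls.
Proof.
elim: ls => // l s IH; case: (boolP (nilp s)) => [/nilP ->|ns];
  first exact: fvars_lit.
by rewrite disj_cons //= fvars_lit IH. Qed.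

Lemma fvars_conj ls : fvars (conj_form ls) = map snd ls.
Proof.
elim: ls => // l s IH; case: (boolP (nilp s)) => [/nilP ->|ns];
  first exact: fvars_lit.
by rewrite conj_cons //= fvars_lit IH. Qed.

Lemma hconj_cons l s : hconj (l :: s) = FAnd (lit_form l) (hconj s).
Proof. by []. Qed.

Lemma fvars_hconj ls : fvars (hconj ls) = map snd ls.
Proof. by elim: ls => // l s IH; rewrite hconj_cons /= fvars_lit IH. Qed.

Lemma fsize_disj ls : fsize (disj_form ls) <= 3 * size ls + 1.
Proof.
elim: ls => // l s IH; have := fsize_lit l.
case: (boolP (nilp s)) => [/nilP ->|ns]; first by move/leq_trans; apply.
by rewrite disj_cons //=; lia.
Qed.

Lemma fsize_conj ls : fsize (conj_form ls) <= 3 * size ls + 1.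
Proof.
elim: ls => // l s IH; have := fsize_lit l.
case: (boolP (nilp s)) => [/nilP ->|ns]; first by move/leq_trans; apply.
by rewrite conj_cons //=; lia.
Qed.

Lemma fsize_hconj ls : fsize (hconj ls) <= 3 * size ls + 1.
Proof.
by elim: ls => // l s IH; have := fsize_lit l; rewrite hconj_cons /=; lia.
Qed.

(** Sums stand in for maxima. The 10 covers the conclusions of the schemes and the line of a
    reduction before its clean-up. *)
Definition pf_bound (pfs : seq (seq form)) : nat :=
  10 + \sum_(pf <- pfs) \sum_(A <- pf) fsize A.

Lemma scheme_size i : i < size schemes -> fsize (nth ([::], FTrue) schemes i).2 <= 10.
Proof. by do 24 case: i => [//|i]. Qed.

Lemma leq_sum_mem (T : eqType) (f : T -> nat) (s : seq T) x :
  x \in s -> f x <= \sum_(y <- s) f y.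
Proof. by move=> xs; rewrite (big_rem x) //= leq_addr. Qed.

Section Lines.
Context (F : seq frege_rule) (M : seq form) (P : qprefix) (b : nat).

(** The size bound travels with validity, so one pass over the blocks yields both the correctness
    and the size of every line. *)
Definition valid_line (L : seq form) (A : form) : Prop :=
  [/\ {subset fvars A <= pvars P}, fsize A <= b
    & [\/ by_frege F L A, A \in M | by_red P L A]].

Fixpoint valid_lines (L s : seq form) : Prop :=
  if s is A :: s' then valid_line L A /\ valid_lines (A :: L) s' else True.

Lemma valid_line_sub (L L' : seq form) A : {subset L <= L'} -> valid_line L A ->
  valid_line L' A.
Proof.
move=> LL' [vA sA jA]; split=> //; case: jA => [bF|AM|[B [u [c [BL ? ? ?]]]]].
- by constructor 1; apply: by_frege_sub bF.
- by constructor 2.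
- by constructor 3; exists B, u, c; split=> //; apply: LL'.
Qed.

Lemma valid_lines_sub (L L' s : seq form) : {subset L <= L'} -> valid_lines L s ->
  valid_lines L' s.
Proof.
elim: s L L' => //= A s IH L L' LL' [/(valid_line_sub LL') vA vs].
by split=> //; apply: IH vs => B; rewrite !inE => /orP[->|/LL' ->]; rewrite ?orbT.
Qed.

Lemma valid_lines_cat (L s t : seq form) :
  valid_lines L s -> valid_lines (s ++ L) t -> valid_lines L (s ++ t).
Proof.
elim: s L => //= A s IH L [vA vs] vt; split=> //; apply: IH => //.
by apply: valid_lines_sub vt => B; rewrite !(inE, mem_cat) => /or3P[] ->;
  rewrite ?orbT.
Qed.

Lemma valid_lines_flatten (T : eqType) (L : seq form) (g : T -> seq form) (r : seq T) :
  {in r, forall a, valid_lines L (g a)} -> valid_lines L (flatten [seq g a | a <- r]).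
Proof.
elim: r => //= a r IH H; apply: valid_lines_cat; first by apply: H; rewrite mem_head.
apply: valid_lines_sub (IH _); first by move=> B BL; rewrite mem_cat BL orbT.
by move=> c cr; apply: H; rewrite inE cr orbT.
Qed.

Lemma valid_lines_dfr (L s : seq form) : valid_lines L s ->
  dfr_valid F M P L [seq Line A | A <- s].
Proof. by elim: s L => //= A s IH L [[vA _ jA] /IH]. Qed.

Lemma valid_lines_size (L s : seq form) : valid_lines L s -> \sum_(A <- s) fsize A <=
  size s * b.
Proof.
elim: s L => [|A s IH] L /=; first by rewrite big_nil.
by case=> [[_ sA _] /IH]; rewrite big_cons mulSn; apply: leq_add.
Qed.

End Lines.

Section Good.
Context (P : qprefix) (W : nat).
Local Notation m := (9 * W + 9).

Definition good (A : form) : bool := all (mem (pvars P)) (fvars A) && (fsize A <= m).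

Definition small (ls : seq lit) : bool :=
  all (fun l => l.2 \in pvars P) ls && (size ls <= W).

Lemma good_lit l s : small (l :: s) -> good (lit_form l).
Proof.
rewrite /small /good fvars_lit /= => /andP[/andP[-> _] _] /=.
by have := fsize_lit l; lia.
Qed.

Lemma good_mem l s : small s -> l \in s -> good (lit_form l).
Proof.
rewrite /small /good fvars_lit /= => /andP[/allP sP _] /sP -> /=.
by have := fsize_lit l; lia.
Qed.

Lemma small_behead l s : small (l :: s) -> small s.
Proof. by rewrite /small /= => /andP[/andP[_ ->] /ltnW ->]. Qed.

Lemma good_disj s : small s -> good (disj_form s).
Proof.
rewrite /small /good fvars_disj all_map => /andP[-> sW] /=.
by have := fsize_disj s; lia.
Qed.

Lemma good_conj s : small s -> good (conj_form s).
Proof.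
rewrite /small /good fvars_conj all_map => /andP[-> sW] /=.
by have := fsize_conj s; lia.
Qed.

Lemma good_hconj s : small s -> good (hconj s).
Proof.
rewrite /small /good fvars_hconj all_map => /andP[-> sW] /=.
by have := fsize_hconj s; lia.
Qed.

Lemma small_univ a : all (fun l => l.2 \in univ P) a -> size a <= W -> small a.
Proof.
move=> /allP aU aW; rewrite /small aW andbT; apply/allP => l la.
by rewrite /pvars mem_cat aU.
Qed.

Lemma perm_split B a : perm_eq (fixed B a ++ moved B a) a.
Proof. by rewrite perm_catC; apply/permPl; apply: (perm_filterC (mem B)). Qed.

Lemma good_iff f x : f \in pvars P -> x \in pvars P -> good (FIff (FVar f) (FVar x)).
Proof. by move=> fP xP; rewrite /good /= fP xP; lia. Qed.

Lemma good_var x : x \in pvars P -> good (FVar x).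
Proof. by move=> xP; rewrite /good /= xP; lia. Qed.

Lemma small_perm a c : perm_eq a c -> small c -> small a.
Proof. by move=> ac; rewrite /small (perm_all _ ac) (perm_size ac). Qed.

Lemma small_moved B a : small a -> small (moved B a).
Proof.
rewrite /small => /andP[/allP aP aW]; apply/andP; split.
  by apply/allP => l; rewrite mem_filter => /andP[_ /aP].
by rewrite size_filter; apply: leq_trans (count_size _ _) aW.
Qed.

End Good.

Arguments good : simpl never.
Arguments good_var {P W x}.
Arguments good_iff {P W f x}.

(** * Correctness of the blocks of lines *)

Section Blocks.
Context (F : seq frege_rule) (pfs : seq (seq form)) (M : seq form) (P : qprefix).
Context (W : nat).
Context (hpfs : forall i, i < size schemes ->
  let r := nth ([::], FTrue) schemes i in
  frege_proof F r.1 (rcons (nth [::] pfs i) r.2)).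

Local Notation m := (9 * W + 9).
Local Notation good := (good P W).
Local Notation small := (small P W).
Let b := pf_bound pfs * m.
Local Notation valid_lines := (valid_lines F M P b).
Local Notation instance := (instance pfs).

(** Frege proofs are closed under substitution, and substituting formulas of size at most [m]
    multiplies sizes by at most [m]. *)
Lemma instanceP i args L : i < size schemes -> all good args ->
  all (fun B => fsubst (nth FFalse args) B \in L) (nth ([::], FTrue) schemes i).1 ->
  valid_lines L (instance i args).
Proof.
move=> ilt /allP gargs /allP prem.
have gs y : good (nth FFalse args y).
  have [ylt|yge] := ltnP y (size args); first by apply: gargs; apply: mem_nth.
  by rewrite nth_default // /good /=; lia.
have := hpfs ilt; rewrite /instance; cbv zeta.
have : {in rcons (nth [::] pfs i) (nth ([::], FTrue) schemes i).2,
    forall A, fsize A <= pf_bound pfs}.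
  move=> A; rewrite mem_rcons inE => /predU1P[->|Ai].
    by apply: leq_trans (scheme_size ilt) _; rewrite leq_addr.
  have [lt|ge] := ltnP i (size pfs); last by rewrite nth_default in Ai.
  apply: leq_trans (leq_addl _ _); apply: leq_trans (leq_sum_mem _ Ai) _.
  exact: (leq_sum_mem (fun pf => \sum_(A <- pf) fsize A) (mem_nth _ lt)).
(* The lines known to the fixed proof and the lines available here grow in parallel; the invariant
   is that the former, substituted, are among the latter. *)
elim: rcons (nth _ schemes i).1 L prem => //= A pf IH L0 L prem szs [bA vpf].
split; last first.
  apply: IH vpf; last by move=> C Cpf; apply: szs; rewrite inE Cpf orbT.
  by move=> C; rewrite !inE => /predU1P[->|/prem ->]; rewrite ?eqxx ?orbT.
split.
- move=> x /fvars_subst [y _ xy]; have /andP[/allP gy _] := gs y; exact: gy.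
- apply: leq_trans (_ : fsize A * m <= _).
    apply: fsize_subst => [|y _]; first by rewrite addnS.
    by have /andP[] := gs y.
  by rewrite leq_mul2r szs ?orbT // mem_head.
- have [r [t [rF H ->]]] := bA; constructor 1.
  exists r, (fun x => fsubst (nth FFalse args) (t x)); split=> //.
    by move=> B Br; rewrite -fsubst_comp; apply: prem; apply: H.
  by rewrite fsubst_comp.
Qed.

Lemma mem_instance i args :
  fsubst (nth FFalse args) (nth ([::], FTrue) schemes i).2 \in instance i args.
Proof. by rewrite /instance map_rcons mem_rcons mem_head. Qed.

Lemma disj_injP L ls : small ls ->
  valid_lines L (disj_inj pfs ls) /\
  {in ls, forall l, FImp (lit_form l) (disj_form ls) \in disj_inj pfs ls}.
Proof.
rewrite /disj_inj => sm; set Z := disj_form ls; have gZ : good Z by apply: good_disj.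
(* Generalised to the tails [s] of the clause with the target [Z] fixed; only the line
   [disj_form s -> Z] is carried along. *)
suff H L' s : small s -> FImp (disj_form s) Z \in L' ->
    let t := sweep (fun l s => if nilp s then [::] else
       instance s_or_l [:: lit_form l; disj_form s;
         Z] ++ instance s_or_r [:: lit_form l; disj_form s; Z]) s in
    valid_lines L' t /\ {in s, forall l, FImp (lit_form l) Z \in t ++ L'}.
  have v0 : valid_lines L (instance s_id [:: Z]) by apply: instanceP; rewrite //= gZ.
  have [vt int] := H (instance s_id [:: Z]) ls sm (mem_instance s_id [:: Z]).
  split.
    apply: valid_lines_cat => //; apply: valid_lines_sub vt => A.
    by rewrite mem_cat => ->.
  by move=> l /int; rewrite !mem_cat orbC.
elim: s L' => // l s IH L' sms inL t.
have sms' := small_behead sms; have gl := good_lit sms; have gs := good_disj sms'.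
rewrite {}/t /sweep /= -/(sweep _ s).
case: (boolP (nilp s)) inL => [/nilP -> /= inL|ns]; first by split=> // k;
  rewrite inE => /eqP ->.
rewrite disj_cons // => inL; set B1 := instance s_or_l _; set B2 := instance s_or_r _.
have v1 : valid_lines L' B1 by apply: instanceP; rewrite //= ?gl ?gs ?gZ ?inL.
have v2 : valid_lines L' B2 by apply: instanceP; rewrite //= ?gl ?gs ?gZ ?inL.
have [|vt int] := IH ((B1 ++ B2) ++ L') sms'.
  by rewrite !mem_cat (mem_instance s_or_r [:: lit_form l; disj_form s; Z]) orbT.
split.
  apply: valid_lines_cat vt; apply: valid_lines_cat => //;
    apply: valid_lines_sub v2 => A AL.
  by rewrite mem_cat AL orbT.
move=> k; rewrite inE => /predU1P[->|/int].
  by rewrite !mem_cat (mem_instance s_or_l [:: lit_form l; disj_form s; Z]).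
by rewrite !mem_cat; do ?case/orP; move=> ->; rewrite ?orbT.
Qed.

Lemma valid_lines_app L s t : valid_lines L s -> valid_lines L t -> valid_lines L (s
  ++ t).
Proof.
move=> vs vt; apply: valid_lines_cat => //; apply: valid_lines_sub vt => A AL.
by rewrite mem_cat AL orbT.
Qed.

Lemma sweep_cons (T U : Type) (g : T -> seq T -> seq U) a s :
  sweep g (a :: s) = g a s ++ sweep g s.
Proof. by []. Qed.

Lemma sweepr_cons (T U : Type) (g : T -> seq T -> seq U) a s :
  sweepr g (a :: s) = sweepr g s ++ g a s.
Proof. by []. Qed.

Lemma disj_elimP L Z ls : small ls -> good Z ->
  {in ls, forall l, FImp (lit_form l) Z \in L} ->
  valid_lines L (disj_elim pfs Z ls) /\ FImp (disj_form ls) Z \in disj_elim pfs Z ls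
    ++ L.
Proof.
rewrite /disj_elim => sm gZ inL; pose L' := instance s_false [:: Z] ++ L.
have v0 : valid_lines L (instance s_false [:: Z]) by apply: instanceP; rewrite //= gZ.
set g := fun l s => _; suff [vt it] : valid_lines L' (sweepr g ls) /\
    FImp (disj_form ls) Z \in sweepr g ls ++ L'.
  split; first exact: valid_lines_cat vt.
  by move: it; rewrite !mem_cat orbA [(_ \in sweepr _ _) || _]orbC.
elim: ls sm inL => [|l s IH] sm inL.
  split=> //; rewrite /L' !mem_cat; apply/orP; right; apply/orP; left.
  exact: (mem_instance s_false [:: Z]).
have [||vt it] := IH; [exact: small_behead sm|by move=> k ks; apply: inL;
  rewrite inE ks orbT|].
(* At the last literal nothing is derived: [disj_form [:: l]] is the literal itself, whose
   implication is already in [L]. *)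
rewrite sweepr_cons /g; case: (boolP (nilp s)) vt it => [/nilP -> vt it|ns vt it].
  by split=> //; rewrite /L' !mem_cat inL ?orbT // mem_head.
set B := instance s_case _; have gs := good_disj (small_behead sm).
split; last by rewrite disj_cons // !mem_cat (mem_instance s_case [:: lit_form l;
  disj_form s; Z]) ?orbT.
apply: valid_lines_cat => //; apply: instanceP; rewrite //= ?(good_lit sm) ?gs ?gZ //.
by rewrite it /L' !mem_cat inL ?orbT // mem_head.
Qed.

Lemma conj_projP L ls : small ls ->
  valid_lines L (conj_proj pfs ls) /\
  {in ls, forall l, FImp (hconj ls) (lit_form l) \in conj_proj pfs ls}.
Proof.
rewrite /conj_proj => sm; set H := hconj ls; have gH : good H by apply: good_hconj.
have v0 : valid_lines L (instance s_id [:: H]) by apply: instanceP; rewrite //= gH.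
set g := fun l s => _; suff K L' s : small s -> FImp H (hconj s) \in L' ->
    valid_lines L' (sweep g s) /\ {in s, forall l, FImp H (lit_form l) \in sweep g s}.
  have [|vt int] := K (instance s_id [:: H] ++ L) ls sm.
    by rewrite mem_cat (mem_instance s_id [:: H]).
  split; first exact: valid_lines_cat.
  by move=> l /int lt; rewrite mem_cat lt orbT.
elim: s L' => // l s IH L' sms inL.
have sms' := small_behead sms; have gl := good_lit sms; have gs := good_hconj sms'.
rewrite hconj_cons in inL; rewrite sweep_cons.
have v1 : valid_lines L' (g l s).
  by apply: valid_lines_app; apply: instanceP; rewrite //= ?gl ?gs ?gH ?inL.
have [|vt int] := IH (g l s ++ L') sms'.
  by rewrite !mem_cat (mem_instance s_and_r [:: H; lit_form l; hconj s]) orbT.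
split; first exact: valid_lines_cat.
move=> k; rewrite inE !mem_cat => /predU1P[->|/int ->]; last by rewrite orbT.
by rewrite (mem_instance s_and_l [:: H; lit_form l; hconj s]).
Qed.

Lemma conj_buildP L H ls : small ls -> good H ->
  {in ls, forall l, FImp H (lit_form l) \in L} ->
  valid_lines L (conj_build pfs H ls) /\ FImp H (conj_form ls) \in conj_build pfs H
    ls ++ L.
Proof.
rewrite /conj_build => sm gH inL; pose L' := instance s_true [:: H] ++ L.
have v0 : valid_lines L (instance s_true [:: H]) by apply: instanceP; rewrite //= gH.
set g := fun l s => _; suff [vt it] : valid_lines L' (sweepr g ls) /\
    FImp H (conj_form ls) \in sweepr g ls ++ L'.
  split; first exact: valid_lines_cat vt.
  by move: it; rewrite !mem_cat orbA [(_ \in sweepr _ _) || _]orbC.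
elim: ls sm inL => [|l s IH] sm inL.
  split=> //; rewrite /L' !mem_cat; apply/orP; right; apply/orP; left.
  exact: (mem_instance s_true [:: H]).
have [||vt it] := IH; [exact: small_behead sm|by move=> k ks; apply: inL;
  rewrite inE ks orbT|].
rewrite sweepr_cons /g; case: (boolP (nilp s)) vt it => [/nilP -> vt it|ns vt it].
  by split=> //; rewrite /L' !mem_cat inL ?orbT // mem_head.
set B := instance s_and _; have gs := good_conj (small_behead sm).
split; last by rewrite conj_cons // !mem_cat (mem_instance s_and [:: H; lit_form l;
  conj_form s]) ?orbT.
apply: valid_lines_cat => //; apply: instanceP; rewrite //= ?(good_lit sm) ?gs ?gH //.
by rewrite it /L' !mem_cat inL ?orbT // mem_head.
Qed.

Lemma hconj_buildP L H ls : small ls -> good H ->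
  {in ls, forall l, FImp H (lit_form l) \in L} ->
  valid_lines L (hconj_build pfs H ls) /\ FImp H (hconj ls) \in hconj_build pfs H ls.
Proof.
rewrite /hconj_build => sm gH inL.
have v0 : valid_lines L (instance s_true [:: H]) by apply: instanceP; rewrite //= gH.
set g := fun l s => _;
  suff [vt it] : valid_lines (instance s_true [:: H] ++ L) (sweepr g ls) /\
    FImp H (hconj ls) \in sweepr g ls ++ instance s_true [:: H].
  split; first exact: valid_lines_cat vt.
  by move: it; rewrite !mem_cat orbC.
elim: ls sm inL => [|l s IH] sm inL; first by split=> //;
  apply: (mem_instance s_true [:: H]).
have [||vt it] := IH; [exact: small_behead sm|by move=> k ks; apply: inL;
  rewrite inE ks orbT|].
rewrite sweepr_cons {2 4}/g; set B := instance s_and _.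
have gs := good_hconj (small_behead sm).
split; last by rewrite !mem_cat (mem_instance s_and [:: H; lit_form l;
  hconj s]) ?orbT.
apply: valid_lines_cat => //; apply: instanceP; rewrite //= ?(good_lit sm) ?gs ?gH //.
rewrite andbT; apply/andP; split; first by rewrite !mem_cat inL ?orbT // mem_head.
by rewrite catA mem_cat it.
Qed.

Context (uniqP : uniq (pvars P)).

Definition indep (u y : nat) : Prop :=
  {in exis P, forall xD, xD.1 = y -> u \notin xD.2}.

Lemma univ_exis xD : xD \in exis P -> xD.1 \notin univ P.
Proof.
move: uniqP; rewrite /pvars cat_uniq => /and3P[_ /hasPn nin _] xDe.
by apply: nin; apply: map_f.
Qed.

(** A reduction is blocked only by existential variables depending on the reduced one. The guard
    consists of universal literals, so only the variables of [X] matter; since the guard variables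
    are distinct, the substitution touches the head alone. The literals of [t] stay behind as
    guard. *)
Lemma reduceP L X t ls :
  small (ls ++ t) -> good X -> FImp (hconj (ls ++ t)) X \in L ->
  all (fun l => l.2 \in univ P) (ls ++ t) -> uniq (map snd (ls ++ t)) ->
  {in fvars X, forall y, y \notin univ P /\ {in ls, forall l, indep l.2 y}} ->
  valid_lines L (reduce pfs X t ls) /\ FImp (hconj t) X \in reduce pfs X t ls ++ L.
Proof.
rewrite /reduce; set g := reduce_step pfs X t; elim: ls L => // l s IH L sm gX inL.
rewrite sweep_cons cat_cons => /andP[lU sU] /andP[nls us] indX.
have sms := small_behead sm.
have gh := good_hconj sms.
have v1 : valid_lines L (g l s).
  have lin : valid_line F M P b L
      (FImp (FAnd (if l.1 then FTrue else FNot FFalse) (hconj (s ++ t))) X).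
    move: gX gh => /andP[/allP vX sX] /andP[/allP vh sh].
    split.
    - move=> y; rewrite /= mem_cat mem_cat -orbA => /or3P[|/vh //|/vX //].
      by case: l.1.
    - have : fsize (if l.1 then FTrue else FNot FFalse) <= 2 by case: l.1.
      have m0 : 9 <= m by rewrite leq_addl.
      (* This line is no instance of a scheme and needs its own room: its size is at most
         [2 * m + 4], within the 10 reserved in [pf_bound]. *)
      move=> c2; apply: (@leq_trans (10 * m)).
        apply: (@leq_trans ((2 + m).+1 + m).+1); last by lia.
        by rewrite [fsize (FImp _ _)]/= ltnS leq_add // ltnS leq_add.
      by rewrite leq_mul2r leq_addr orbT.
    - constructor 3; exists (FImp (hconj (l :: s ++ t)) X), l.2, l.1; split=> //.
        move=> xD xDe; rewrite hconj_cons /= fvars_lit fvars_hconj !inE mem_cat.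
        case/or3P=> [/eqP xl|/mapP[k ks xk]|xX].
        + by have := univ_exis xDe; rewrite xl lU.
        + by have := univ_exis xDe; rewrite xk (allP sU).
        + by have [_ /(_ l (mem_head _ _))] := indX _ xX; apply.
      rewrite hconj_cons /fsubst1 /=; congr (FImp (FAnd _ _) _).
      + by case: (l) => [[] y] /=; rewrite eqxx.
      + rewrite fsubst_id // => y; rewrite fvars_hconj => yst.
        by case: eqP => // yl; rewrite yl (negbTE nls) in yst.
      + rewrite fsubst_id // => y yX; case: eqP => // yl.
        by have [] := indX _ yX; rewrite yl lU.
  rewrite /g /reduce_step; split=> //.
  by case: (l.1); apply: instanceP; rewrite //= ?gh ?gX // mem_head.
have [||vt it] := IH (g l s ++ L) sms gX _ sU us.
- rewrite mem_cat /g /reduce_step inE; case: (l.1).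
    by rewrite (mem_instance s_red_pos [:: hconj (s ++ t); X]) !orbT.
  by rewrite (mem_instance s_red_neg [:: hconj (s ++ t); X]) !orbT.
- by move=> y /indX[yU ind]; split=> // k ks; apply: ind; rewrite inE ks orbT.
split; first exact: valid_lines_cat.
by move: it; rewrite !mem_cat orbCA orbA.
Qed.

Context (name_of : nat * seq lit -> nat).

(* [f] plays the role of [x] restricted by [a]. *)
Definition linked (L : seq form) (f x : nat) (a : seq lit) : Prop :=
  [/\ f \in pvars P /\ f \notin univ P, x \in pvars P,
      all (fun l => l.2 \in univ P) a /\ size a <= W,
      FImp (conj_form a) (FIff (FVar f) (FVar x)) \in L
    & {in a, forall l, indep l.2 f}].

Lemma linked_sub L L' f x a : {subset L <= L'} -> linked L f x a -> linked L' f x a.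
Proof. by move=> LL' [? ? ? aL ?]; split=> //; apply: LL'. Qed.

Lemma groupP L B q : small B ->
  linked L (name_of (q.1.2, q.2)) q.1.2 q.2 ->
  {in B, forall l, FImp (hconj B) (lit_form l) \in L} ->
  [/\ valid_lines L (group pfs name_of B q),
      {in q.2, forall l, FImp (hyp B q.2) (lit_form l) \in group pfs name_of B q},
      FImp (hyp B q.2) (FIff (FVar (name_of (q.1.2, q.2))) (FVar q.1.2))
        \in group pfs name_of B q
    & FImp (hconj B) (hconj (moved B q.2)) \in group pfs name_of B q].
Proof.
move: q => [[s x] a] /=; set v := name_of _ => sB [[vP _] xP [aU aW] aL _] BL.
rewrite /group /=; set G := hyp B a; set s1 := conj_proj _ _;
  set s2 := conj_build _ _ _.
rewrite -/v; set s3 := instance s_trans _; set s4 := hconj_build _ _ _.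
have sa := small_univ aU aW.
have sp : small (fixed B a ++ moved B a) := small_perm (perm_split B a) sa.
have gG : good G by apply: good_hconj.
have [v1 in1] : valid_lines L s1 /\ {in a, forall l, FImp G (lit_form l) \in s1}.
  have [v1 in1] := conj_projP L sp; split=> // l la; apply: in1.
  by rewrite (perm_mem (perm_split B a)).
have [v2 in2] : valid_lines (s1 ++ L) s2 /\ FImp G (conj_form a) \in s2 ++ s1 ++ L.
  by apply: conj_buildP => // l /in1 h; rewrite mem_cat h.
have v3 : valid_lines (s2 ++ s1 ++ L) s3.
  apply: instanceP => //=; first by rewrite gG good_conj // good_iff.
  by rewrite in2 !mem_cat aL !orbT.
have [v4 in4] : valid_lines L s4 /\ FImp (hconj B) (hconj (moved B a)) \in s4.
  apply: hconj_buildP; rewrite ?good_hconj ?small_moved //.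
  by move=> l; rewrite mem_filter => /andP[/BL].
have m3 : FImp G (FIff (FVar v) (FVar x)) \in s3.
  exact: (mem_instance s_trans [:: G; conj_form a; FIff (FVar v) (FVar x)]).
clearbody s1 s2 s3 s4; split.
- apply: valid_lines_cat => //; apply: valid_lines_cat => //;
  apply: valid_lines_cat => //.
  by apply: valid_lines_sub v4 => A AL; rewrite !mem_cat AL !orbT.
- by move=> l /in1 ls1; rewrite mem_cat ls1.
- by rewrite !mem_cat m3 !orbT.
- by rewrite !mem_cat in4 !orbT.
Qed.

Lemma itemP L B Z it q : small B -> good Z ->
  matches B it q ->
  linked L it.1.2 it.2.1 it.2.2 ->
  linked L (name_of (q.1.2, q.2)) q.1.2 q.2 -> uniq (map snd q.2) ->
  {in q.2, forall l, FImp (hyp B q.2) (lit_form l) \in L} ->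
  FImp (hyp B q.2) (FIff (FVar (name_of (q.1.2, q.2))) (FVar q.1.2)) \in L ->
  FImp (hconj B) (hconj (moved B q.2)) \in L ->
  FImp (lit_form (q.1.1, name_of (q.1.2, q.2))) Z \in L ->
  valid_lines L (item_step pfs name_of B Z it q) /\
  FImp (lit_form it.1) (FImp (hconj B) Z) \in item_step pfs name_of B Z it q.
Proof.
move: it q => [[s f] [x a]] [[s' x'] c] sB gZ; rewrite /matches /=.
case/and3P=> /eqP[-> ->] /allP ac /allP cab [[fP fU] xP [aU aW] aL fa].
set v := name_of _ => -[[vP vU] _ [cU cW] _ vc] uc GL GvL HK vZ.
rewrite /item_step /= -/v; set G := hyp B c in GL GvL *.
set K := hconj (moved B c) in HK *; set s1 := conj_build _ _ _.
set s2 := instance s_trans _; set s3 := instance s_iff _; set s4 := reduce _ _ _ _;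
  set s5 := if s then _ else _.
have sa := small_univ aU aW; have sc := small_univ cU cW.
have pc := perm_split B c.
have gG : good G by apply: good_hconj; apply: small_perm pc sc.
have gK : good K by apply: good_hconj; apply: small_moved.
have gfx := good_iff fP xP; have gfv := good_iff fP vP.
have gf := good_var fP; have gv := good_var vP; have gx := good_var xP.
have [v1 in1] : valid_lines L s1 /\ FImp G (conj_form a) \in s1 ++ L.
  by apply: conj_buildP => // l /ac /GL.
have v2 : valid_lines (s1 ++ L) s2.
  apply: instanceP => //=; first by rewrite gG good_conj // gfx.
  by rewrite in1 !mem_cat aL !orbT.
have m2 : FImp G (FIff (FVar f) (FVar x)) \in s2.
  exact: (mem_instance s_trans [:: G; conj_form a; FIff (FVar f) (FVar x)]).
have v3 : valid_lines (s2 ++ s1 ++ L) s3.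
  apply: instanceP => //=; first by rewrite gG gf gx gv.
  by rewrite !mem_cat m2 GvL !orbT.
have m3 : FImp G (FIff (FVar f) (FVar v)) \in s3.
  exact: (mem_instance s_iff [:: G; FVar f; FVar x; FVar v]).
have [v4 in4] : valid_lines (s3 ++ s2 ++ s1 ++ L) s4 /\
    FImp K (FIff (FVar f) (FVar v)) \in s4 ++ s3 ++ s2 ++ s1 ++ L.
  apply: reduceP.
  - exact: small_perm pc sc.
  - by [].
  - by rewrite mem_cat; apply/orP; left.
  - by rewrite (perm_all _ pc).
  - by rewrite (perm_uniq (perm_map _ pc)).
  move=> y; rewrite /= !inE => yfv; split; first by case/orP: yfv => /eqP ->.
  (* For [v] independence is part of being linked with annotation [c]; for [f] the matching
     condition first places [l] in [a]. *)
  move=> l; rewrite mem_filter => /andP[lB lc]; case/orP: yfv => /eqP ->;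
    last exact: vc.
  by apply: fa; have := cab l lc; rewrite (negbTE lB) orbF.
have gH := good_hconj sB.
have v5 : valid_lines (s4 ++ s3 ++ s2 ++ s1 ++ L) s5.
  move: vZ; rewrite /s5; case: (s) => vZ; apply: instanceP;
    rewrite //= ?gK ?gf ?gv ?gH ?gZ //.
    by rewrite in4 !mem_cat HK vZ !orbT.
  by rewrite in4 !mem_cat HK vZ !orbT.
split.
  apply: valid_lines_cat => //; apply: valid_lines_cat => //;
    apply: valid_lines_cat => //.
  by apply: valid_lines_cat.
rewrite !mem_cat /s5; case: (s).
  by rewrite (mem_instance s_pos_item [:: K; FVar f; FVar v; hconj B; Z]) !orbT.
by rewrite (mem_instance s_neg_item [:: K; FVar f; FVar v; hconj B; Z]) !orbT.
Qed.

Lemma onfirstP (T U : eqType) (p : pred T) (g : T -> seq U) s :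
  (exists2 q, q \in s & p q) ->
  exists2 q, q \in s & p q /\ onfirst p g s = g q.
Proof.
elim: s => [|a s IH]; first by case.
rewrite /onfirst /= -/(onfirst p g s); case: (boolP (p a)) => [pa _|pa [q]].
  by exists a; rewrite ?mem_head.
rewrite inE => /predU1P[->|qs pq]; first by rewrite (negbTE pa).
by have [|r rs [pr ->]] := IH; [exists q|exists r; rewrite ?inE ?rs ?orbT].
Qed.

Lemma mem_flatmap (T U : eqType) (g : T -> seq U) (s : seq T) a y :
  a \in s -> y \in g a -> y \in flatten [seq g x | x <- s].
Proof. by move=> ias yg; apply/flatten_mapP; exists a. Qed.

(** Each literal of [ls] is either falsified by [B] or an item whose image lies in [C'], so each
    implies [B -> Z], and so does the clause. The names in [C'] are independent of [B], which
    discharges the guard. *)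
Lemma linkP L B us its C' ls :
  all (fun l => l.2 \in univ P) B -> size B <= W -> uniq (map snd B) ->
  {in C', forall q, [/\ linked L (name_of (q.1.2, q.2)) q.1.2 q.2, uniq (map snd q.2)
                      & {in B, forall l, indep l.2 (name_of (q.1.2, q.2))}]} ->
  size C' <= W ->
  {in its, forall it, linked L it.1.2 it.2.1 it.2.2 /\
                      exists2 q, q \in C' & matches B it q} ->
  {in us, forall l, l.2 \in univ P /\ (~~ l.1, l.2) \in B} ->
  {in ls, forall l, l \in us \/ exists2 it, it \in its & it.1 = l} ->
  size ls <= W -> disj_form ls \in L ->
  valid_lines L (link pfs name_of B us its C' ls) /\
  disj_form (lits name_of C') \in link pfs name_of B us its C' ls.
Proof.
move=> BU BW uB hC CW hits hus hls lsW lsL; rewrite /link.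
have smB := small_univ BU BW.
have smC : small (lits name_of C').
  rewrite /small size_map CW andbT;
    apply/allP => l /mapP[q /hC[[[vP _] _ _ _ _] _ _] ->].
  exact: vP.
have smls : small ls.
  rewrite /small lsW andbT;
    apply/allP => l /hls[/hus[lU _]|[it /hits[[[fP _] _ _ _ _] _] <-]] //.
  by rewrite /pvars mem_cat lU.
set Z := disj_form (lits name_of C'); set H := hconj B; set X := FImp H Z.
have gZ : good Z := good_disj smC; have gH : good H := good_hconj smB.
have gls := good_disj smls.
have gX : good X.
  move: smC smB gZ gH;
    rewrite /small /good => /andP[_ lW] /andP[_ BW'] /andP[vZ _] /andP[vH _].
  rewrite /X /= all_cat vZ vH /=.
  by have := fsize_disj (lits name_of C'); have := fsize_hconj B; rewrite -/Z -/H;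
    lia.
set t1 := disj_inj _ _; set t2 := conj_proj _ _; set t3 := flatten _;
  set t4 := flatten _.
set t5 := flatten _; set t6 := disj_elim _ _ _; set t7 := instance s_mp _;
  set t8 := reduce _ _ _ _.
have [v1 in1] : valid_lines L t1 /\ {in lits name_of C', forall l, FImp (lit_form l)
  Z \in t1}.
  exact: disj_injP.
have [v2 in2] : valid_lines L t2 /\ {in B, forall l, FImp H (lit_form l) \in t2}.
  exact: conj_projP.
have sub A L1 L2 : A \in L2 -> A \in L1 ++ L2 by rewrite mem_cat => ->; rewrite orbT.
have sub2 L1 L2 : {subset L2 <= L1 ++ L2} by move=> A; apply: (sub).
have grp q : q \in C' -> [/\ valid_lines (t2 ++ L) (group pfs name_of B q),
    {in q.2, forall l, FImp (hyp B q.2) (lit_form l) \in t3},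
    FImp (hyp B q.2) (FIff (FVar (name_of (q.1.2, q.2))) (FVar q.1.2)) \in t3
  & FImp (hconj B) (hconj (moved B q.2)) \in t3].
  move=> qC; have [lq _ _] := hC q qC.
  have [||v i1 i2 i3] := @groupP (t2 ++ L) B q smB.
  - by apply: linked_sub lq => A; apply: (sub).
  - by move=> l /in2 h; rewrite mem_cat h.
  split=> //; first by move=> l /i1; apply: mem_flatmap.
  - exact: mem_flatmap i2.
  - exact: mem_flatmap i3.
have v3 : valid_lines (t2 ++ L) t3 by apply: valid_lines_flatten => q /grp[].
have itm it : it \in its ->
    valid_lines (t3 ++ t2 ++ t1 ++ L) (onfirst (matches B it) (item_step pfs name_of
      B Z it) C') /\
    FImp (lit_form it.1) X \in t4.
  move=> itI; have [lf ex] := hits it itI.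
  have [q qC [mq eq]] := onfirstP (item_step pfs name_of B Z it) ex.
  have [lq uq _] := hC q qC; have [_ g1 g2 g3] := grp q qC.
  have [||||||vi ini] := @itemP (t3 ++ t2 ++ t1 ++ L) B Z it q smB gZ mq _ _ uq.
  - by apply: linked_sub lf => A AL; do 3 apply: (sub).
  - by apply: linked_sub lq => A AL; do 3 apply: (sub).
  - by move=> l /g1 h; rewrite mem_cat h.
  - by rewrite mem_cat g2.
  - by rewrite mem_cat g3.
  - have h := in1 (q.1.1, name_of (q.1.2, q.2)) (map_f _ qC).
    by do 2 apply: (sub); rewrite mem_cat h.
  by split; [rewrite eq|apply: mem_flatmap itI _; rewrite eq].
have v4 : valid_lines (t3 ++ t2 ++ t1 ++ L) t4 by apply: valid_lines_flatten =>
  it /itm[].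
have ust l : l \in us ->
    valid_lines (t2 ++ L) (if l.1 then instance s_pos_univ [:: FVar l.2; H; Z]
                      else instance s_neg_univ [:: FVar l.2; H;
                        Z]) /\ FImp (lit_form l) X \in t5.
  move=> lus; have [lU nlB] := hus l lus; have nlin := in2 _ nlB.
  have gl : good (FVar l.2) by apply: good_var; rewrite /pvars mem_cat lU.
  split.
    by case: (l.1) nlin => nlin; apply: instanceP;
      rewrite //= ?gl ?gH ?gZ // mem_cat nlin.
  apply: mem_flatmap lus _; case: (l) => [[] y] /=.
    exact: (mem_instance s_pos_univ [:: FVar y; H; Z]).
  exact: (mem_instance s_neg_univ [:: FVar y; H; Z]).
have v5 : valid_lines (t2 ++ L) t5 by apply: valid_lines_flatten => l /ust[].
pose L6 := t5 ++ t4 ++ t3 ++ t2 ++ t1 ++ L.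
have [v6 in6] : valid_lines L6 t6 /\ FImp (disj_form ls) X \in t6 ++ L6.
  apply: disj_elimP => // l /hls[/ust[_ h]|[it /itm[_ h] <-]].
    by rewrite mem_cat h.
  by apply: (sub); rewrite mem_cat h.
have v7 : valid_lines (t6 ++ L6) t7.
  apply: instanceP => //=; first by rewrite gls gX.
  by rewrite in6 !andbT; do 6 apply: (sub).
have m7 : X \in t7 by exact: (mem_instance s_mp [:: disj_form ls; X]).
(* Once all of [B] is reduced, the empty guard remains as [FTrue]; [s_top] removes it afterwards. *)
have [v8 in8] : valid_lines (t7 ++ t6 ++ L6) t8 /\ FImp FTrue Z \in t8 ++ t7 ++ t6 ++
  L6.
  apply: reduceP; rewrite ?cats0 //; first by rewrite mem_cat m7.
  move=> y; rewrite fvars_disj => /mapP[l /mapP[q qC ->] ->] /=.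
  have [[[_ vU] _ _ _ _] _ ind] := hC q qC.
  by split=> // k kB; apply: ind.
have v9 : valid_lines (t8 ++ t7 ++ t6 ++ L6) (instance s_top [:: Z]).
  by apply: instanceP; rewrite //= ?gZ // in8.
have m9 : Z \in instance s_top [:: Z] by exact: (mem_instance s_top [:: Z]).
clearbody t1 t2 t3 t4 t5 t6 t7 t8; split; last first.
  by do 8 apply: (sub).
have s21 : {subset t2 ++ L <= t2 ++ t1 ++ L}.
  by move=> A; rewrite !mem_cat => /orP[] ->; rewrite ?orbT.
apply: valid_lines_cat v1 _; apply: valid_lines_cat;
  first by apply: valid_lines_sub v2 => A; apply: (sub).
apply: valid_lines_cat; first by apply: valid_lines_sub v3.
apply: valid_lines_cat v4 _; apply: valid_lines_cat.
  by apply: valid_lines_sub v5 => A /s21 h; do 2 apply: (sub).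
by apply: valid_lines_cat v6 _; apply: valid_lines_cat v7 _;
  apply: valid_lines_cat v8 _.
Qed.

Lemma resP L C1 C2 x t C' :
  name_of (x, t) \in pvars P -> size C1 <= W -> size C2 <= W -> size C' <= W ->
  {in C1 ++ C2 ++ C', forall q, name_of (q.1.2, q.2) \in pvars P} ->
  {in C1, forall q, q \in C' \/ q = ((true, x), t)} ->
  {in C2, forall q, q \in C' \/ q = ((false, x), t)} ->
  disj_form (lits name_of C1) \in L -> disj_form (lits name_of C2) \in L ->
  valid_lines L (res_lines pfs name_of C1 C2 x t C') /\
  disj_form (lits name_of C') \in res_lines pfs name_of C1 C2 x t C'.
Proof.
move=> vP W1 W2 W' hC h1 h2 L1 L2; rewrite /res_lines.
have sm C : size C <= W -> {subset C <= C1 ++ C2 ++ C'} -> small (lits name_of C).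
  move=> CW CC; rewrite /small size_map CW andbT;
    apply/allP => l /mapP[q /CC /hC ? ->] //.
have sm1 : small (lits name_of C1) by apply: sm => // q; rewrite !mem_cat => ->.
have sm2 : small (lits name_of C2) by apply: sm => // q; rewrite !mem_cat => ->;
  rewrite orbT.
have sm3 : small (lits name_of C') by apply: sm => // q; rewrite !mem_cat => ->;
  rewrite !orbT.
set Z := disj_form (lits name_of C'); set v := name_of (x, t) in vP *;
  set X := FImp (FVar v) Z.
have gZ : good Z := good_disj sm3; have gv := good_var vP.
have gX : good X.
  move: gZ sm3; rewrite /good /small => /andP[vZ _] /andP[_ sW].
  by rewrite /X /= vP vZ /=; have := fsize_disj (lits name_of C'); rewrite -/Z; lia.
set t1 := disj_inj _ _; set t2 := flatten _; set t3 := disj_elim _ _ _;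
  set t4 := instance s_mp _.
set t5 := disj_elim _ _ _.
have sub A K1 K2 : A \in K2 -> A \in K1 ++ K2 by rewrite mem_cat => ->; rewrite orbT.
have [v1 in1] : valid_lines L t1 /\ {in lits name_of C', forall l, FImp (lit_form l)
  Z \in t1}.
  exact: disj_injP.
have st l : l \in lits name_of C2 ->
    valid_lines (t1 ++ L) (if l == (false, v) then instance s_pivot [:: FVar v; Z]
       else instance s_weaken [:: lit_form l; FVar v;
         Z]) /\ FImp (lit_form l) X \in t2.
  move=> lC; split; last first.
    apply: mem_flatmap lC _; case: eqP => [->|_];
      first exact: (mem_instance s_pivot [:: FVar v; Z]).
    exact: (mem_instance s_weaken [:: lit_form l; FVar v; Z]).
  case: eqP => [_|lv]; first by apply: instanceP; rewrite //= gv gZ.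
  have gl : good (lit_form l) := good_mem sm2 lC.
  apply: instanceP; rewrite //= ?gl ?gv ?gZ //.
  case/mapP: lC => q qC lq; have [qC'|qx] := h2 q qC; last by rewrite lq qx in lv.
  by rewrite mem_cat in1 // lq;
    apply: (map_f (fun q => (q.1.1, name_of (q.1.2, q.2)))).
have v2 : valid_lines (t1 ++ L) t2 by apply: valid_lines_flatten => l /st[].
have [v3 in3] : valid_lines (t2 ++ t1 ++ L) t3 /\
    FImp (disj_form (lits name_of C2)) X \in t3 ++ t2 ++ t1 ++ L.
  by apply: disj_elimP => // l /st[_ h]; rewrite mem_cat h.
have v4 : valid_lines (t3 ++ t2 ++ t1 ++ L) t4.
  apply: instanceP => //=; first by rewrite gX good_disj.
  by rewrite in3 !andbT; do 3 apply: (sub).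
have m4 : X \in t4 by exact: (mem_instance s_mp [:: disj_form (lits name_of C2); X]).
pose L5 := t4 ++ t3 ++ t2 ++ t1 ++ L.
have [v5 in5] : valid_lines L5 t5 /\ FImp (disj_form (lits name_of C1)) Z \in t5 ++
  L5.
  apply: disj_elimP => // l /mapP[q qC ->]; have [qC'|->] := h1 q qC;
    last by rewrite mem_cat m4.
  by do 3 apply: (sub); rewrite mem_cat in1 //;
    apply: (map_f (fun q => (q.1.1, name_of (q.1.2, q.2)))).
have v6 : valid_lines (t5 ++ L5) (instance s_mp [:: disj_form (lits name_of C1); Z]).
  apply: instanceP => //=; first by rewrite gZ good_disj.
  by rewrite in5 !andbT; do 5 apply: (sub).
split; last by do 5 apply: (sub);
  exact: (mem_instance s_mp [:: disj_form (lits name_of C1); Z]).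
apply: valid_lines_cat v1 _; apply: valid_lines_cat v2 _; apply: valid_lines_cat v3 _.
by apply: valid_lines_cat v4 _; apply: valid_lines_cat v5 _.
Qed.

End Blocks.

(** * Extension variables and the simulation *)

Section Extension.
Context (F : seq frege_rule) (M : seq form) (k : seq bool).

Fixpoint ext_prefix (P : qprefix) (T : seq (nat * seq lit)) : qprefix :=
  if T is q :: s then
    let P' := ext_prefix P s in
    add_exis P' (name k s) (ext_dep P' q.2 [:: (true, q.1)])
  else P.

Fixpoint ext_lines (T : seq (nat * seq lit)) : seq form :=
  if T is q :: s then
    ext_form true q.2 [:: (true, q.1)] (name k s) :: ext_lines s
  else [::].

Lemma name_inj s t : name k s = name k t -> size s = size t.
Proof.
move=> /(congr1 digits); rewrite !digits_ones => /(congr1 size).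
by rewrite !size_nseq /= !size_cat !size_map; lia.
Qed.

Lemma univ_ext P T : univ (ext_prefix P T) = univ P.
Proof. by elim: T. Qed.

Context (P : qprefix).
Context (longk : {in pvars P, forall x, size (digits x) <= size k}).

Lemma name_fresh s : name k s \notin pvars P.
Proof.
apply/negP => /longk; rewrite digits_ones size_nseq /= size_cat; lia.
Qed.

Lemma mem_pvars_ext T x : x \in pvars (ext_prefix P T) ->
  x \in pvars P \/ exists2 s, size s < size T & x = name k s.
Proof.
elim: T => [|q T IH]; first by left.
rewrite /pvars /= mem_cat inE orbCA => /predU1P[->|]; first by right; exists T.
rewrite -mem_cat => /IH[|[s sT ->]]; first by left.
by right; exists s => //; apply: ltnW.
Qed.

Lemma sub_pvars_ext T : {subset pvars P <= pvars (ext_prefix P T)}.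
Proof.
elim: T => // q T IH x /IH; rewrite /pvars /= !mem_cat inE => /orP[] ->;
by rewrite ?orbT.
Qed.

Lemma name_fresh_ext s T : size T <= size s -> name k s \notin pvars (ext_prefix P T).
Proof.
move=> Ts; apply/negP => /mem_pvars_ext[|[t tT /name_inj st]].
  by rewrite (negbTE (name_fresh s)).
by rewrite st leqNgt tT in Ts.
Qed.

Lemma uniq_ext T : uniq (pvars P) -> uniq (pvars (ext_prefix P T)).
Proof.
move=> uP; elim: T => // q T IH; rewrite /pvars /= -cat_rcons -cats1 -catA.
rewrite uniq_catCA /= -/(pvars _) IH andbT.
exact: name_fresh_ext.
Qed.

Lemma dep_ext T x : x \in pvars P -> dep (ext_prefix P T) x = dep P x.
Proof.
move=> xP; rewrite /dep univ_ext; case: ifP => // _; congr flatten.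
elim: T => //= q T IH; case: eqP => // nx.
by have := name_fresh T; rewrite nx xP.
Qed.

Definition table_ok (T : seq (nat * seq lit)) : Prop :=
  {in T, forall q, q.1 \in pvars P /\ all (fun l => l.2 \in univ P) q.2}.

(** [sweepr] introduces the last table entry first, in step with [ext_prefix]. [rest] is arbitrary
    so that the axiom of the head can be moved into it before the induction hypothesis is
    applied. *)
Lemma exts_valid T rest L :
  {in M, forall A, {subset fvars A <= pvars P}} -> table_ok T ->
  dfr_valid F M (ext_prefix P T) (ext_lines T ++ L) rest ->
  dfr_valid F M P L (exts k T ++ rest).
Proof.
move=> hM; rewrite /exts; elim: T rest => // q T IH rest hT v.
have [qP qU] := hT q (mem_head _ _).
rewrite sweepr_cons -catA; apply: IH; first by move=> r rT; apply: hT;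
  rewrite inE rT orbT.
split=> //.
- by move=> l /(allP qU); rewrite univ_ext.
- split=> // y; rewrite inE => /eqP ->; exact: sub_pvars_ext.
- split; first exact: name_fresh_ext.
  by move=> A /hM AP; apply/negP => /AP; rewrite (negbTE (name_fresh T)).
Qed.

(** The dependency set lacks the annotated variables, which is the source of all later independence.
    With repeated entries the first one decides both the variable and its axiom. *)
Lemma name_ofP T q : table_ok T -> q \in T ->
  (name_of k T q, [seq u <- dep P q.1 | u \notin map snd q.2]) \in exis (ext_prefix P
    T) /\
  FImp (conj_form q.2) (FIff (FVar (name_of k T q)) (FVar q.1)) \in ext_lines T.
Proof.
elim: T => // a T IH hT; rewrite /name_of /=; case: eqP => [aq _|aq].
  subst a; have [qP _] := hT q (mem_head _ _).
  split; last exact: mem_head.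
  by rewrite /= /ext_dep /= cats0 dep_ext // mem_head.
rewrite inE eq_sym (introF eqP aq) /= => qT.
have [|i1 i2] := IH _ qT; first by move=> r rT; apply: hT; rewrite inE rT orbT.
by rewrite !inE i1 i2 !orbT.
Qed.

End Extension.

(** * Invariants of annotated clauses *)

Section Invariant.
Context (Phi : dqbf).
Let P := dprefix Phi.
Context (wf : wf_dqbf Phi).

(** Confinement to the dependency set makes every literal of an annotation universal, and
    consistency makes their variables distinct; the reductions use both. *)
Definition proper (C : aclause) : Prop :=
  {in C, forall p, [/\ p.1.2 \in map fst (exis P),
     {in p.2, forall l, l.2 \in dep P p.1.2} & consistent p.2]}.

Lemma exis_univ x : x \in map fst (exis P) -> x \notin univ P.
Proof.
by case: wf; rewrite /pvars cat_uniq => /and3P[_ /hasPn nin _] _ _ /nin.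
Qed.

Lemma dep_univ x : x \in map fst (exis P) -> {subset dep P x <= univ P}.
Proof.
move=> xe u; rewrite /dep (negbTE (exis_univ xe)) => /flattenP[D /mapP[xD]].
rewrite mem_filter => /andP[_ xDe] ->; case: wf => _ sub _; exact: sub.
Qed.

Lemma mem_restr D a l : (l \in restr D a) = (l \in a) && (l.2 \in D).
Proof. by rewrite /restr !inE. Qed.

Lemma mem_comp a b l :
  (l \in annot_comp a b) = (l \in a) || (l \in b) && (negl l \notin a).
Proof. by rewrite /annot_comp !inE. Qed.

Lemma neglK : involutive negl.
Proof. by case=> s x; rewrite /negl /= negbK. Qed.

Lemma consistentP a : reflect {in a, forall l, negl l \notin a} (consistent a).
Proof. exact: allP. Qed.

Lemma consistent_restr D a : consistent a -> consistent (restr D a).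
Proof.
move=> /consistentP ca; apply/consistentP => l; rewrite !mem_restr => /andP[/ca la _].
by rewrite negb_and la.
Qed.

Lemma consistent_comp a b : consistent a -> consistent b ->
  consistent (annot_comp a b).
Proof.
move=> /consistentP ca /consistentP cb; apply/consistentP => l.
rewrite !mem_comp neglK => /orP[la|/andP[lb nla]].
  by rewrite (negbTE (ca l la)) la andbF.
by rewrite (negbTE nla) (negbTE (cb l lb)).
Qed.

Lemma mem_ax_annot C l : (l \in ax_annot P C) = (negl l \in C) && (l.2 \in univ P).
Proof.
apply/imfsetP/andP => [[k /=]|[nlC lU]].
  by rewrite !inE => /andP[kC kU] ->; rewrite neglK.
by exists (negl l); rewrite /= ?inE ?nlC ?neglK.
Qed.

Lemma mem_ax_concl C p : reflect
  (exists2 a, (a \in C) && (a.2 \in map fst (exis P)) &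
     p = (a, restr (dep P a.2) (ax_annot P C))) (p \in ax_concl P C).
Proof.
apply: (iffP (imfsetP _ _ _ _)) => -[a].
  by rewrite /= !inE => aC ->; exists a.
by move=> aC ->; exists a; rewrite //= !inE.
Qed.

Lemma mem_inst_concl C b p : reflect
  (exists2 q, q \in C & p = (q.1, restr (dep P q.1.2) (annot_comp q.2 b)))
  (p \in inst_concl P C b).
Proof.
apply: (iffP (imfsetP _ _ _ _)) => -[a].
  by move=> aC ->; exists a.
by move=> aC ->; exists a.
Qed.

Lemma ir_ok_proper L p :
  (forall C, C \in L -> proper C) -> ir_ok Phi L p -> proper p.1.
Proof.
move=> pL; case: p => C' [C|C b|C1 C2 x t]; rewrite /ir_ok /=.
- move=> [_ cC ->] p /mem_ax_concl[a /andP[_ ae] ->] /=; split=> //.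
    by move=> l; rewrite mem_restr => /andP[].
  exact: consistent_restr.
- move=> [CL cb _ ->] p /mem_inst_concl[q qC ->] /=.
  have [qe qd qc] := pL C CL q qC; split=> //.
    by move=> l; rewrite mem_restr => /andP[].
  by apply: consistent_restr; apply: consistent_comp.
- move=> [[C1L C2L] _ _ ->] p; rewrite !inE => /orP[] /andP[_]; exact: pL.
Qed.

Lemma ir_valid_proper L pi :
  (forall C, C \in L -> proper C) -> ir_valid Phi L pi ->
  forall C, C \in map fst pi -> proper C.
Proof.
elim: pi L => //= p pi IH L pL [ok v] C; rewrite inE => /predU1P[->|].
  exact: ir_ok_proper ok.
by apply: IH v C => D; rewrite inE => /predU1P[->|/pL //]; apply: ir_ok_proper ok.
Qed.

End Invariant.

Lemma mem_raw (C : aclause) q :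
  q \in raw_clause C -> exists2 p, p \in C & q = (p.1, enum_fset p.2).
Proof. by rewrite /raw_clause => h;
  have [p pC ->] := @mapP (alit : eqType) _ _ _ _ h; exists p. Qed.

Lemma raw_mem (C : aclause) p : p \in C -> (p.1, enum_fset p.2) \in raw_clause C.
Proof. by move=> pC; apply/(@mapP (alit : eqType)); exists p. Qed.

Lemma size_raw (C : aclause) : size (raw_clause C) <= aclause_size C.
Proof.
rewrite /raw_clause size_map /aclause_size; elim: (enum_fset C) => //= p s IH.
by rewrite big_cons; lia.
Qed.

Lemma size_annot (C : aclause) p : p \in C -> size (enum_fset p.2) < aclause_size C.
Proof. by move=> pC; apply: (leq_sum_mem (fun p : alit => 1 + #|` p.2|) pC). Qed.

(** Reductions ask for distinct variables, while annotations are given as consistent sets of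
    literals. *)
Lemma uniq_vars (s : seq lit) :
  uniq s -> {in s, forall l, negl l \notin s} -> uniq (map snd s).
Proof.
move=> us cs; rewrite map_inj_in_uniq // => -[b x] [c y] ls ks /= xy.
rewrite xy in ls *; case: (eqVneq b c) => [-> //|bc].
have := cs _ ls; have -> : negl (b, y) = (c, y) by case: (b) (c) bc => [] [].
by rewrite ks.
Qed.

Lemma uniq_fst_inj (A B : eqType) (s : seq (A * B)) x y :
  uniq (map fst s) -> x \in s -> y \in s -> x.1 = y.1 -> x = y.
Proof.
elim: s => //= a s IH /andP[na us]; rewrite !inE.
case/predU1P=> [->|xs] /predU1P[->|ys] // xy; last exact: IH.
  by rewrite xy map_f in na.
by rewrite -xy map_f in na.
Qed.

(** * Simulation of the single inferences *)

Section Simulation.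
Context (F : seq frege_rule) (pfs : seq (seq form)) (Phi : dqbf) (W : nat).
Context (k : seq bool) (T : seq (nat * seq lit)).
Context (hpfs : forall i, i < size schemes ->
  let r := nth ([::], FTrue) schemes i in
  frege_proof F r.1 (rcons (nth [::] pfs i) r.2)).
Context (wf : wf_dqbf Phi).
Let P := dprefix Phi.
Let P' := ext_prefix k P T.
Let M := conjuncts Phi.
Context (longk : {in pvars P, forall x, size (digits x) <= size k}).
Context (hT : table_ok P T).
Local Notation valid_lines := (valid_lines F M P' (pf_bound pfs * (9 * W + 9))).

Definition tabled (C : aclause) : Prop :=
  {in C, forall p, (p.1.2, enum_fset p.2) \in T}.

Definition ready (L : seq form) (C : aclause) : Prop :=
  [/\ proper Phi C, tabled C, aclause_size C <= W & {subset ext_lines k T <= L}].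

Lemma uniqP' : uniq (pvars P').
Proof. by apply: uniq_ext => //; case: wf. Qed.

(** Distinctness of the prefix variables singles out the entry of this name, and its dependency set
    omits the annotated variables. *)
Lemma indep_name_of q u : q \in T -> (u \in dep P q.1 -> u \in map snd q.2) ->
  indep P' u (name_of k T q).
Proof.
move=> qT uD xD xDe xq; have [nmE _] := name_ofP longk hT qT.
have -> : xD = (name_of k T q, [seq u <- dep P q.1 | u \notin map snd q.2]).
  have ux : uniq (map fst (exis P')) by have := uniqP';
    rewrite /pvars cat_uniq => /and3P[].
  exact: uniq_fst_inj ux xDe nmE xq.
by rewrite mem_filter negb_and negbK; case: (boolP (_ \in dep _ _)) => [/uD ->|];
  rewrite ?orbT.
Qed.

Lemma univP' : univ P' = univ P.
Proof. exact: univ_ext. Qed.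

Lemma exis_pvars x : x \in map fst (exis P) -> x \in pvars P'.
Proof. by move=> xe; apply: sub_pvars_ext; rewrite /pvars mem_cat xe orbT. Qed.

Lemma linked_name_of L C p : ready L C -> p \in C ->
  linked P' W L (name_of k T (p.1.2, enum_fset p.2)) p.1.2 (enum_fset p.2).
Proof.
case=> pC tC CW extL pinC; have [pe pd pc] := pC p pinC.
have qT := tC p pinC; have [nmE nmL] := name_ofP longk hT qT; split.
- split; last exact: (univ_exis uniqP' nmE).
  by rewrite /pvars mem_cat (map_f fst nmE) orbT.
- exact: exis_pvars.
- split; last by apply: ltnW; apply: leq_trans (size_annot pinC) CW.
  by apply/allP => l /pd ld; rewrite univP' (dep_univ wf pe).
- exact: extL.
- by move=> l la; apply: indep_name_of => // _; apply: map_f.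
Qed.

Lemma uniq_annot C p : proper Phi C -> p \in C -> uniq (map snd (enum_fset p.2)).
Proof.
by move=> pC /pC[_ _ /consistentP cp]; apply: uniq_vars (fset_uniq _) cp.
Qed.

Lemma size_ready L C : ready L C -> size (raw_clause C) <= W.
Proof. by case=> _ _ CW _; apply: leq_trans (size_raw C) CW. Qed.

Lemma ready_names L C q : ready L C -> q \in raw_clause C ->
  name_of k T (q.1.2, q.2) \in pvars P'.
Proof. by move=> rC /mem_raw[p pC ->]; have [[]] := linked_name_of rC pC. Qed.

Lemma res_sim L C1 C2 x t :
  ready L C1 -> ready L C2 -> ready L (res_concl C1 C2 x t) ->
  ((true, x), t) \in C1 ->
  disj_form (lits (name_of k T) (raw_clause C1)) \in L ->
  disj_form (lits (name_of k T) (raw_clause C2)) \in L ->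
  let s := res_lines pfs (name_of k T) (raw_clause C1) (raw_clause C2) x (enum_fset t)
    (raw_clause (res_concl C1 C2 x t)) in
  valid_lines L s /\ disj_form (lits (name_of k T) (raw_clause (res_concl C1 C2 x
    t))) \in s.
Proof.
move=> r1 r2 r3 xC1 d1 d2; apply: (resP M hpfs uniqP') => //.
- by have := ready_names r1 (raw_mem xC1).
- exact: size_ready r1.
- exact: size_ready r2.
- exact: size_ready r3.
- by move=> q; rewrite 2!(mem_cat q) => /or3P[];
  [move/(ready_names r1)|move/(ready_names r2)|move/(ready_names r3)].
- move=> q /mem_raw[p pC ->]; case: (eqVneq p ((true, x), t)) => [->|np];
  first by right.
  by left; apply: raw_mem; rewrite !inE np pC.
- move=> q /mem_raw[p pC ->]; case: (eqVneq p ((false, x), t)) => [->|np];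
  first by right.
  by left; apply: raw_mem; rewrite !inE np pC orbT.
Qed.

Lemma inst_sim L C b :
  {in b, forall l, l.2 \in univ P} -> consistent b ->
  ready L C -> ready L (inst_concl P C b) ->
  disj_form (lits (name_of k T) (raw_clause C)) \in L ->
  let s := inst_lines pfs (name_of k T) (raw_clause C) (enum_fset b)
    (raw_clause (inst_concl P C b)) in
  valid_lines L s /\ disj_form (lits (name_of k T) (raw_clause (inst_concl P C b)))
    \in s.
Proof.
move=> bU cb rC rC' dL; set C' := inst_concl P C b in rC' *.
rewrite /inst_lines; set B := [seq l <- _ | _]; cbv zeta.
have BP l : l \in B -> l \in b /\ exists2 p, p \in C' & l \in p.2.
  rewrite mem_filter => /andP[/hasP[q /mem_raw[p pC' ->]] lp lb].
  by split=> //; exists p.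
have [pC _ _ _] := rC; have [pC' _ CW' _] := rC'.
apply: (linkP M hpfs uniqP') => //.
- by apply/allP => l /BP[/bU lU _]; rewrite univP'.
(* The literals of [B] are distinct and each occurs in an annotation of [C'], so the size of [C']
   counts them all. *)
- apply: leq_trans CW'; rewrite /aclause_size.
  apply: leq_trans (_ : size (flatten [seq enum_fset p.2 | p <- enum_fset C']) <= _).
    apply: uniq_leq_size; first by apply: filter_uniq; apply: fset_uniq.
    by move=> l /BP[_ [p pC0 lp]];
      exact: (@mem_flatmap alit _ (fun p => enum_fset p.2) _ p).
  by elim: (enum_fset C') => //= p s IH; rewrite big_cons size_cat leq_add // leqnSn.
- apply: uniq_vars; first by apply: filter_uniq; apply: fset_uniq.
  move=> l /BP[lb _]; apply/negP => /BP[nlb _].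
  by move/consistentP/(_ l lb): cb; rewrite nlb.
- move=> q /mem_raw[p pinC' ->]; split.
  + exact: (linked_name_of rC' pinC').
  + exact: uniq_annot pC' pinC'.
  move=> l /BP[lb _] /=; apply: indep_name_of; first by have [_ tC' _ _] := rC';
    apply: tC'.
  case/mem_inst_concl: pinC' => [p0 p0C ->] /= lD.
  (* A variable of [b] in the dependency set is fixed by the annotation of the conclusion: by the
     opposite literal if the premise already had it, otherwise by [l]. *)
  case: (boolP (negl l \in p0.2)) => nl.
    by apply/mapP; exists (negl l) => //; rewrite mem_restr mem_comp nl lD.
  by apply/mapP; exists l => //; rewrite mem_restr mem_comp lb nl lD orbT.
- exact: size_ready rC'.
- move=> it /mapP[q /mem_raw[p pinC ->] ->] /=; split;
  first exact: (linked_name_of rC pinC).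
  pose p' := (p.1, restr (dep P p.1.2) (annot_comp p.2 b)).
  have p'C : p' \in C' by apply/mem_inst_concl; exists p.
  exists (p'.1, enum_fset p'.2); first exact: raw_mem.
  rewrite /matches /=; apply/and3P; split; first by case: (p.1).
    have [_ pd _] := pC p pinC; apply/allP => l lp.
    by rewrite mem_restr mem_comp lp pd.
  apply/allP => l; rewrite mem_restr mem_comp => lp'.
  have /andP[/orP[->//|/andP[lb nl]] lD] := lp'.
  rewrite mem_filter lb andbT; apply/orP; right; apply/hasP.
  by exists (p'.1, enum_fset p'.2); [exact: raw_mem|rewrite /= mem_restr mem_comp].
- move=> l /mapP[q qC ->]; right.
  exists ((q.1.1, name_of k T (q.1.2, q.2)), (q.1.2, q.2)) => //.
  by apply/mapP; exists q.
- by rewrite size_map; apply: size_ready rC.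
Qed.

Lemma ax_sim L C :
  C \in matrix Phi -> consistent (ax_annot P C) -> size C <= W ->
  ready L (ax_concl P C) ->
  let s := ax_lines pfs (name_of k T) (univ P) C (raw_clause (ax_concl P C)) in
  valid_lines L s /\ disj_form (lits (name_of k T) (raw_clause (ax_concl P C))) \in s.
Proof.
move=> CM cC CW rC; set C' := ax_concl P C in rC *; rewrite /ax_lines.
set us := [seq l <- C | l.2 \in univ P]; set es := [seq l <- C | l.2 \notin univ P].
set B := undup _; cbv zeta; set t2 := flatten _; set t3 := link _ _ _ _ _ _ _.
have BP l : (l \in B) = (l \in ax_annot P C).
  rewrite mem_undup mem_ax_annot; apply/mapP/andP => [[j]|[lC lU]].
    by rewrite mem_filter => /andP[jU jC] ->; rewrite /negl /= negbK; case: (j) jU jC.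
  exists (negl l); first by rewrite mem_filter lU.
  by case: (l) => s x; rewrite /negl /= negbK.
have [pC' _ _ extL] := rC.
have Cvars l : l \in C -> l.2 \in pvars P by case: wf => _ _ /(_ C CM); apply.
have esP l : l \in es -> l \in C /\ l.2 \in map fst (exis P).
  rewrite mem_filter => /andP[lU lC]; split=> //.
  by have := Cvars l lC; rewrite /pvars mem_cat (negbTE lU).
have smC : small P' W C.
  by rewrite /small CW andbT; apply/allP => l /Cvars; apply: sub_pvars_ext.
have v1 : valid_lines L [:: disj_form C].
  split=> //; have /andP[/allP vC sC] := good_disj smC; split.
  - exact: vC.
  - by apply: leq_trans sC _; rewrite leq_pmull.
  - by constructor 2; apply: map_f.
have v2 : valid_lines (disj_form C :: L) t2.
  apply: valid_lines_flatten => l /esP[_ le].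
  by apply: (instanceP M hpfs); rewrite //= good_var //; apply: exis_pvars.
have m2 l : l \in es -> FImp FTrue (FIff (FVar l.2) (FVar l.2)) \in t2.
  by move=> le; apply: mem_flatmap le _;
    exact: (mem_instance pfs s_refl [:: FVar l.2]).
have sub : {subset L <= t2 ++ disj_form C :: L}.
  by move=> A AL; rewrite mem_cat inE AL !orbT.
have rC2 : ready (t2 ++ disj_form C :: L) C'.
  by case: rC => ? ? ? exL; split=> // A /exL /sub.
have [v3 m3] : valid_lines (t2 ++ disj_form C :: L) t3 /\
    disj_form (lits (name_of k T) (raw_clause C')) \in t3.
  apply: (linkP M hpfs uniqP') => //.
  - by apply/allP => l; rewrite BP mem_ax_annot univP' => /andP[].
  - apply: leq_trans CW; apply: leq_trans (size_undup _) _; rewrite size_map.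
    by rewrite size_filter count_size.
  - apply: uniq_vars; first exact: undup_uniq.
    by move=> l; rewrite !BP; move/consistentP: cC; apply.
  - move=> q /mem_raw[p pC ->]; split;
    [exact: (linked_name_of rC2 pC)|exact: (uniq_annot pC' pC)|].
    move=> l; rewrite BP /= => lA; apply: indep_name_of;
      first by have [_ tC _ _] := rC; apply: tC.
    (* All literals of the universal annotation belong to [B], and the restriction keeps each one
       whose variable lies in the dependency set. *)
    case/mem_ax_concl: pC => a _ -> /= lD.
    by apply/mapP; exists l => //; rewrite mem_restr lA.
  - exact: size_ready rC.
  - move=> it /mapP[l les ->] /=; have [lC le] := esP l les; split.
      split=> //; [split|exact: exis_pvars|by rewrite mem_cat m2].
      + exact: exis_pvars.
      + by rewrite univP' exis_univ.
    exists (l, enum_fset (restr (dep P l.2) (ax_annot P C))).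
      have h : (l, restr (dep P l.2) (ax_annot P C)) \in C'.
        by apply/mem_ax_concl; exists l; rewrite ?lC.
      exact: (raw_mem h).
    rewrite /matches /=; case: (l) => a y; rewrite eqxx /=.
    by apply/allP => j; rewrite BP mem_restr => /andP[].
  - move=> l; rewrite mem_filter univP' => /andP[lU lC]; split=> //.
    by rewrite BP mem_ax_annot -/(negl l) neglK lC.
  - move=> l lC; case: (boolP (l.2 \in univ P)) => lU.
      by left; rewrite mem_filter lU.
    right; exists ((l.1, l.2), (l.2, [::])); last by case: (l).
    by apply/mapP; exists l => //; rewrite mem_filter lU.
  - by rewrite mem_cat mem_head orbT.
clearbody t2 t3; split; last by rewrite !mem_cat m3 !orbT.
by apply: valid_lines_cat v1 _; apply: valid_lines_cat v2 _.
Qed.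

Definition covered (L : seq form) (C : aclause) : Prop :=
  ready L C /\ disj_form (lits (name_of k T) (raw_clause C)) \in L.

Lemma line_sim Lir L p :
  (forall C, C \in Lir -> covered L C) -> ir_ok Phi Lir p ->
  ready L p.1 -> ir_line_width p <= W ->
  let s := line_lines pfs (name_of k T) (univ P) (raw_line p) in
  valid_lines L s /\ disj_form (lits (name_of k T) (raw_clause p.1)) \in s.
Proof.
move=> cov; case: p => C' [C|C b|C1 C2 x t]; rewrite /ir_ok /line_lines /=.
- move=> [CM cC ->] rC; rewrite /ir_line_width geq_max /= => /andP[_ CW].
  exact: ax_sim.
- move=> [CL cb bU ->] rC _; have [rC0 dL] := cov C CL; exact: inst_sim.
- move=> [[L1 L2] x1 _ ->] rC _; have [r1 d1] := cov C1 L1; have [r2 d2] := cov C2 L2.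
  exact: res_sim.
Qed.

Lemma ready_sub L L' C : {subset L <= L'} -> ready L C -> ready L' C.
Proof. by move=> LL' [? ? ? exL]; split=> // A /exL /LL'. Qed.

(** [Lir] and [L] grow in parallel. The names come from the table of the whole refutation, so the
    disjunction standing for a clause never changes as lines are added. *)
Lemma pi_sim Lir L pi :
  {subset ext_lines k T <= L} ->
  (forall C, C \in Lir -> covered L C) -> ir_valid Phi Lir pi ->
  (forall C, C \in map fst pi -> tabled C) -> ir_width pi <= W ->
  let s := flatten [seq line_lines pfs (name_of k T) (univ P) (raw_line p) | p <- pi]
    in
  valid_lines L s /\
  forall C, C \in map fst pi -> disj_form (lits (name_of k T) (raw_clause C)) \in s.
Proof.
elim: pi Lir L => [|p pi IH] Lir L exL cov; first by [].
rewrite /ir_width big_cons geq_max => -[ok v] tab /andP[pW piW]; cbv zeta.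
rewrite map_cons [flatten _]/=; set s1 := line_lines _ _ _ _; set s2 := flatten _.
have rp : ready L p.1.
  split=> //; last by apply: leq_trans pW; rewrite leq_maxl.
    by apply: ir_ok_proper ok => // C /cov[[]].
  by apply: tab; rewrite mem_head.
have [v1 m1] := line_sim cov ok rp pW.
have sub : {subset L <= s1 ++ L} by move=> A AL; rewrite mem_cat AL orbT.
have [|||v2 m2] := IH (p.1 :: Lir) (s1 ++ L) _ _ v _ piW.
- by move=> A /exL /sub.
- move=> C; rewrite inE => /predU1P[->|/cov[rC dC]].
    by split; [apply: ready_sub rp|rewrite mem_cat m1].
  by split; [apply: ready_sub rC|apply: sub].
- by move=> C Cpi; apply: tab; rewrite inE Cpi orbT.
split; first exact: valid_lines_cat v2.
move=> C; rewrite inE mem_cat => /predU1P[->|/m2 ->]; first by rewrite m1.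
by rewrite orbT.
Qed.

End Simulation.

(** * Size of the translation *)

(** Bounds the number of lines of an instance, as [pf_bound] bounds their size; the 1 is the
    conclusion. *)
Definition instance_bound (pfs : seq (seq form)) : nat :=
  1 + \sum_(pf <- pfs) size pf.

Section Count.
Context (pfs : seq (seq form)) (name_of : nat * seq lit -> nat).
Let K := instance_bound pfs.
Local Notation instance := (instance pfs).

Lemma size_instance i args : size (instance i args) <= K.
Proof.
rewrite /instance size_map size_rcons /K /instance_bound add1n ltnS.
have [lt|ge] := ltnP i (size pfs); last by rewrite nth_default.
exact: (leq_sum_mem size (mem_nth _ lt)).
Qed.

Lemma size_sweep (T U : Type) (g : T -> seq T -> seq U) n s :
  (forall a l, size (g a l) <= n) -> size (sweep g s) <= n * size s.
Proof.
move=> gn; elim: s => // a s IH.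
by rewrite sweep_cons size_cat mulnS leq_add.
Qed.

Lemma size_sweepr (T U : Type) (g : T -> seq T -> seq U) n s :
  (forall a l, size (g a l) <= n) -> size (sweepr g s) <= n * size s.
Proof.
move=> gn; elim: s => // a s IH.
by rewrite sweepr_cons size_cat mulnS addnC leq_add.
Qed.

Lemma size_flatmap (T U : Type) (g : T -> seq U) (w : T -> nat) n s :
  (forall a, size (g a) <= n * w a) ->
  size (flatten [seq g a | a <- s]) <= n * \sum_(a <- s) w a.
Proof.
move=> gn; elim: s => [|a s IH] /=; first by rewrite big_nil.
by rewrite size_cat big_cons mulnDr leq_add.
Qed.

Lemma size_disj_inj ls : size (disj_inj pfs ls) <= K * (1 + 2 * size ls).
Proof.
rewrite /disj_inj size_cat mulnDr muln1 leq_add ?size_instance // mulnA.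
apply: size_sweep => l s; case: ifP => _ //.
by rewrite size_cat muln2 -addnn leq_add ?size_instance.
Qed.

Lemma size_conj_proj ls : size (conj_proj pfs ls) <= K * (1 + 2 * size ls).
Proof.
rewrite /conj_proj size_cat mulnDr muln1 leq_add ?size_instance // mulnA.
apply: size_sweep => l s.
by rewrite size_cat muln2 -addnn leq_add ?size_instance.
Qed.

Lemma size_disj_elim Z ls : size (disj_elim pfs Z ls) <= K * (1 + size ls).
Proof.
rewrite /disj_elim size_cat mulnDr muln1 leq_add ?size_instance //.
by apply: size_sweepr => l s; case: ifP => _ //; apply: size_instance.
Qed.

Lemma size_conj_build H ls : size (conj_build pfs H ls) <= K * (1 + size ls).
Proof.
rewrite /conj_build size_cat mulnDr muln1 leq_add ?size_instance //.
by apply: size_sweepr => l s; case: ifP => _ //; apply: size_instance.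
Qed.

Lemma size_hconj_build H ls : size (hconj_build pfs H ls) <= K * (1 + size ls).
Proof.
rewrite /hconj_build size_cat mulnDr muln1 leq_add ?size_instance //.
by apply: size_sweepr => l s; apply: size_instance.
Qed.

Lemma size_reduce X t ls : size (reduce pfs X t ls) <= K * (2 * size ls).
Proof.
rewrite /reduce mulnA; apply: size_sweep => l s;
  rewrite /reduce_step /= muln2 -addnn -add1n.
by apply: leq_add => //; case: l.1; apply: size_instance.
Qed.

Lemma size_group B q : size (group pfs name_of B q) <= 7 * K * (1 + size q.2).
Proof.
rewrite /group (size_cat (conj_proj _ _)) (size_cat (conj_build _ _ _)) (size_cat
  (instance _ _)); set a := q.2.
have := size_conj_proj (fixed B a ++ moved B a); rewrite (perm_size (perm_split B a)).
have := size_conj_build (hyp B a) a; have := size_hconj_build (hconj B) (moved B a).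
have : size (moved B a) <= size a by rewrite size_filter count_size.
have := size_instance s_trans [:: hyp B a; conj_form a;
  FIff (FVar (name_of (q.1.2, a))) (FVar q.1.2)].
move: (size (instance _ _)) (size (conj_proj _ _)) (size (conj_build _ _ _)) (size
  (hconj_build _ _ _)).
move: (size (moved _ _)) (size a) K => m n K' n1 n2 n3 n4 h1 mn h2 h3 h4.
have : K' * m <= K' * n by rewrite leq_mul2l mn orbT.
lia.
Qed.

(** The cost is charged to the annotation of the premise literal: the literals to be reduced, those
    of [q.2] outside [B], lie in it. Charging [q.2] would be too much, as many premise literals may
    share one conclusion literal. *)
Lemma size_item_step B Z it q : uniq q.2 -> matches B it q ->
  size (item_step pfs name_of B Z it q) <= 6 * K * (1 + size it.2.2).
Proof.
move=> uq /and3P[_ _ /allP qB];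
  rewrite /item_step (size_cat (conj_build _ _ _)) 2!(size_cat (instance _ _))
  (size_cat (reduce _ _ _ _)); set a := it.2.2.
have fx : size (fixed B q.2) <= size a.
  apply: uniq_leq_size; first exact: filter_uniq.
  by move=> l; rewrite mem_filter => /andP[lB /qB]; rewrite (negbTE lB) orbF.
have := size_conj_build (hyp B q.2) a.
have := size_instance s_trans [:: hyp B q.2; conj_form a;
  FIff (FVar it.1.2) (FVar it.2.1)].
set v := FVar (name_of _); set f := FVar _; set x := FVar _.
have := size_instance s_iff [:: hyp B q.2; f; x; v].
have := size_reduce (FIff f v) (moved B q.2) (fixed B q.2).
set s5 := if _ then _ else _; have : size s5 <= K.
  by rewrite /s5; case: ifP => _; apply: size_instance.
move: (size s5) (size (reduce _ _ _ _)) (size (instance s_iff _)) (size (instance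
  s_trans _)) (size (conj_build _ _ _)).
move: fx; move: (size (fixed _ _)) (size a) K.
move=> m n K' mn n1 n2 n3 n4 n5 h1 h2 h3 h4 h5.
have : K' * m <= K' * n by rewrite leq_mul2l mn orbT.
lia.
Qed.

Lemma size_onfirst (T U : Type) (p : pred T) (g : T -> seq U) n (s : seq T) :
  all (fun q => p q ==> (size (g q) <= n)) s -> size (onfirst p g s) <= n.
Proof.
elim: s => //= a s IH /andP[ga gs]; rewrite /onfirst /= -/(onfirst p g s).
by case: ifP ga => //= _ _; apply: IH.
Qed.

(** The blocks add up to at most [26 * K * W], with [0 < W] absorbing those of constant length; 40
    leaves slack. *)
Lemma size_link W B us its C' ls :
  0 < W -> size B <= W -> size us <= W -> size ls <= W ->
  \sum_(it <- its) (1 + size it.2.2) <= W ->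
  \sum_(q <- C') (1 + size q.2) <= W -> all (fun q => uniq q.2) C' ->
  size (link pfs name_of B us its C' ls) <= 40 * K * W.
Proof.
move=> W0 BW usW lsW itsW CW uC;
  rewrite /link (size_cat (disj_inj _ _)) (size_cat (conj_proj _ _)) 3!(size_cat
  (flatten _)) (size_cat (disj_elim _ _ _)) (size_cat (instance _ _)) (size_cat
  (reduce _ _ _ _)).
have CW' : size (lits name_of C') <= W.
  rewrite size_map; apply: leq_trans CW; elim: (C') => //= a s IH.
  by rewrite big_cons; lia.
have := size_disj_inj (lits name_of C'); have := size_conj_proj B.
have : size (flatten [seq group pfs name_of B q | q <- C']) <= 7 * K * W.
  apply: leq_trans (size_flatmap (w := fun q : lit * seq lit =>
    1 + size q.2) _ (size_group B)) _.
  by rewrite leq_mul2l CW orbT.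
set Z := disj_form (lits name_of C').
set t4 := flatten [seq onfirst _ _ _ | it <- its]; have : size t4 <= 6 * K * W.
  apply: leq_trans (size_flatmap (n := 6 * K) (w := fun it : item =>
    1 + size it.2.2) _ _) _.
    move=> it; apply: size_onfirst; apply: sub_all uC => q uq; apply/implyP.
    exact: size_item_step.
  by rewrite leq_mul2l itsW orbT.
set t5 := flatten [seq if _ then _ else _ | l <- us]; have : size t5 <= K * W.
  apply: leq_trans (size_flatmap (n := K) (w := fun=> 1) _ _) _.
    by move=> l; case: ifP => _; rewrite muln1; apply: size_instance.
  by rewrite sum1_size leq_mul2l usW orbT.
set X := FImp _ _; have := size_disj_elim X ls; have := size_reduce Z [::] B.
have := size_instance s_mp [:: disj_form ls; X]; have := size_instance s_top [:: Z].
have h n : n <= W -> K * n <= K * W by move=> nW; rewrite leq_mul2l nW orbT.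
have := h _ BW; have := h _ lsW; have := h _ CW'; have := h _ W0.
move: K; clear; lia.
Qed.

Lemma size_res C1 C2 x t C' W :
  0 < W -> size C1 <= W -> size C2 <= W -> size C' <= W ->
  size (res_lines pfs name_of C1 C2 x t C') <= 40 * K * W.
Proof.
move=> W0 W1 W2 W';
  rewrite /res_lines (size_cat (disj_inj _ _)) (size_cat (flatten _)) (size_cat
  (disj_elim _ _ _)) (size_cat (instance _ _)) (size_cat (disj_elim _ _ _)).
rewrite -(size_map (fun p : lit * seq lit => (p.1.1, name_of (p.1.2, p.2)))) in W1.
rewrite -(size_map (fun p : lit * seq lit => (p.1.1, name_of (p.1.2, p.2)))) in W2.
rewrite -(size_map (fun p : lit * seq lit => (p.1.1, name_of (p.1.2, p.2)))) in W'.
rewrite -/(lits name_of C1) in W1; rewrite -/(lits name_of C2) in W2;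
  rewrite -/(lits name_of C') in W'.
have := size_disj_inj (lits name_of C').
set t2 := flatten _; have : size t2 <= K * W.
  apply: leq_trans (size_flatmap (n := K) (w := fun=> 1) _ _) _.
    by move=> l; case: ifP => _; rewrite muln1; apply: size_instance.
  by rewrite sum1_size leq_mul2l W2 orbT.
set Z := disj_form (lits name_of C'); set X := FImp _ _.
have := size_disj_elim X (lits name_of C2);
  have := size_disj_elim Z (lits name_of C1).
have := size_instance s_mp [:: disj_form (lits name_of C2); X].
have := size_instance s_mp [:: disj_form (lits name_of C1); Z].
have h n : n <= W -> K * n <= K * W by move=> nW; rewrite leq_mul2l nW orbT.
have := h _ W1; have := h _ W2; have := h _ W'; have := h _ W0.
move: (size (disj_inj _ _)) (size t2) (size (disj_elim _ X _)) (size (disj_elim _ Z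
  _)).
move: (size (instance _ [:: _; X])) (size (instance _ [:: _; Z])) K.
by move: (size (lits name_of C1)) (size (lits name_of C2)) (size (lits name_of C'));
  clear; lia.
Qed.

End Count.

Section LineCount.
Context (pfs : seq (seq form)) (name_of : nat * seq lit -> nat) (Phi : dqbf) (W :
  nat).
Let K := instance_bound pfs.
Let P := dprefix Phi.
Context (W0 : 0 < W).

Lemma sum_raw (C : aclause) : \sum_(q <- raw_clause C) (1 + size q.2) =
  aclause_size C.
Proof. by rewrite /raw_clause big_map. Qed.

Lemma uniq_raw (C : aclause) : all (fun q : lit * seq lit => uniq q.2) (raw_clause C).
Proof. by apply/allP => q /mem_raw[p _ ->]; apply: fset_uniq. Qed.

Lemma size_line L p :
  (forall C, C \in L -> aclause_size C <= W) -> ir_ok Phi L p ->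
  ir_line_width p <= W ->
  size (line_lines pfs name_of (univ P) (raw_line p)) <= 42 * K * W.
Proof.
move=> LW; have le40 : 40 * K * W <= 42 * K * W by rewrite !leq_mul2r orbT.
case: p => C' [C|C b|C1 C2 x t]; rewrite /ir_ok /line_lines /ir_line_width geq_max /=.
- move=> [CM _ _] /andP[C'W CW]; rewrite /ax_lines.
  set us := [seq l <- C | l.2 \in _]; set es := [seq l <- C | l.2 \notin _].
  have usW : size us <= W by rewrite size_filter (leq_trans (count_size _ _)).
  have esW : size es <= W by rewrite size_filter (leq_trans (count_size _ _)).
  set t3 := link _ _ _ _ _ _ _; have h3 : size t3 <= 40 * K * W.
    apply: size_link; rewrite ?sum_raw ?uniq_raw //.
      by apply: leq_trans (size_undup _) _; rewrite size_map.
    rewrite big_map; apply: leq_trans esW; by rewrite sum1_size.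
  have h2 : size (flatten [seq instance pfs s_refl [:: FVar l.2] | l <- es]) <= K * W.
    apply: leq_trans (size_flatmap (n := K) (w := fun=> 1) _ _) _.
      by move=> l; rewrite muln1; apply: size_instance.
    by rewrite sum1_size leq_mul2l esW orbT.
  have h1 : 1 <= K * W by rewrite muln_gt0 W0 andbT /K /instance_bound.
  (* An axiom adds to [link] the clause itself and one reflexivity instance for each existential
     literal; hence 42. *)
  apply: (@leq_trans (1 + (K * W + 40 * K * W))); last by move: h1; clear; lia.
  by rewrite /= ltnS size_cat leq_add.
- move=> [CL cb bU C'E] /andP[C'W _]; apply: leq_trans le40.
  have CW := LW C CL; apply: size_link; rewrite ?sum_raw ?uniq_raw //.
  + apply: leq_trans C'W; rewrite /aclause_size.
    apply: leq_trans (_ : size (flatten [seq enum_fset p.2 | p <- enum_fset C']) <=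
      _).
      apply: uniq_leq_size; first by apply: filter_uniq; apply: fset_uniq.
      move=> l; rewrite mem_filter => /andP[/hasP[q /mem_raw[p pC' ->] lp] _].
      exact: (@mem_flatmap alit _ (fun p => enum_fset p.2) _ p).
    by elim: (enum_fset C') => //= p s IH;
      rewrite big_cons size_cat leq_add // leqnSn.
  + by rewrite size_map; apply: leq_trans (size_raw C) CW.
  + by rewrite big_map sum_raw.
- move=> [[C1L C2L] _ _ _] /andP[C'W _]; apply: leq_trans le40.
  apply: size_res => //.
  + exact: leq_trans (size_raw _) (LW _ C1L).
  + exact: leq_trans (size_raw _) (LW _ C2L).
  + exact: leq_trans (size_raw _) C'W.
Qed.

Lemma size_pi L pi :
  (forall C, C \in L -> aclause_size C <= W) -> ir_valid Phi L pi ->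
  ir_width pi <= W ->
  size (flatten [seq line_lines pfs name_of (univ P) (raw_line p) | p <- pi])
    <= 42 * K * W * size pi.
Proof.
elim: pi L => // p pi IH L LW [ok v];
  rewrite /ir_width big_cons geq_max => /andP[pW piW].
rewrite map_cons [flatten _]/= size_cat mulnS leq_add //;
  first exact: size_line ok pW.
apply: IH v piW => C; rewrite inE => /predU1P[->|/LW //].
by apply: leq_trans pW; rewrite leq_maxl.
Qed.

End LineCount.

(** With [n] literals in the annotation, the extension axiom has size at most [3 * n + 5]. *)
Lemma size_exts k T :
  dfr_size (exts k T) <= 5 * \sum_(q <- T) (1 + size q.2).
Proof.
rewrite /dfr_size /exts; elim: T => [|q T IH]; first by rewrite !big_nil.
rewrite sweepr_cons big_cat [X in 5 * X]big_cons mulnDr addnC leq_add //.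
rewrite big_seq1 /=; have := fsize_conj q.2; lia.
Qed.

Lemma sum_flatten_aclause (pi : seq ir_line) :
  \sum_(q <- table (map raw_line pi)) (1 + size q.2) <= ir_width pi * size pi.
Proof.
rewrite /table /ir_width; elim: pi => [|p pi IH]; first by rewrite /= !big_nil.
rewrite !map_cons [flatten _]/= big_cat big_cons /= big_map sum_raw mulnS leq_add //.
  by rewrite leq_max /ir_line_width leq_max leqnn.
by apply: leq_trans IH _; rewrite leq_mul2r leq_maxr orbT.
Qed.

Lemma mem_table (pi : seq ir_line) C p :
  C \in map fst pi -> p \in C -> (p.1.2, enum_fset p.2) \in table (map raw_line pi).
Proof.
move=> Cpi pC; rewrite /table; elim: pi Cpi => //= ln pi IH.
rewrite inE mem_cat => /predU1P[<-|/IH ->]; last by rewrite orbT.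
apply/orP; left; apply/mapP; exists (p.1, enum_fset p.2) => //; exact: raw_mem.
Qed.

Lemma table_mem (pi : seq ir_line) q : q \in table (map raw_line pi) ->
  exists C p, [/\ C \in map fst pi, p \in C & q = (p.1.2, enum_fset p.2)].
Proof.
rewrite /table; elim: pi => //= ln pi IH; rewrite mem_cat => /orP[/mapP[r]|].
  by move=> /mem_raw[p pC ->] ->; exists ln.1, p; rewrite mem_head.
by move=> /IH[C [p [Cpi pC ->]]]; exists C, p; rewrite inE Cpi orbT.
Qed.

(** * Correctness and size of the whole translation *)

Section Correctness.
Context (F : seq frege_rule) (pfs : seq (seq form)).
Context (hpfs : forall i, i < size schemes ->
  let r := nth ([::], FTrue) schemes i in
  frege_proof F r.1 (rcons (nth [::] pfs i) r.2)).
Context (Phi : dqbf) (pi : seq ir_line).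
Context (wf : wf_dqbf Phi).
Context (ref : ir_refutation Phi pi).

Let P := dprefix Phi.
Let W := maxn (ir_width pi) 1.
Let k := flatten [seq digits v | v <- pvars P].
Let T := table (map raw_line pi).
Let M := conjuncts Phi.
Let s := flatten [seq line_lines pfs (name_of k T) (univ P) (raw_line p) | p <- pi].
Let b := pf_bound pfs * (9 * W + 9).

Lemma longk : {in pvars P, forall x, size (digits x) <= size k}.
Proof.
move=> x xP; rewrite /k; elim: (pvars P) xP => //= y l IH.
rewrite inE size_cat => /predU1P[->|/IH]; first by rewrite leq_addr.
by move=> h; apply: leq_trans h (leq_addl _ _).
Qed.

Lemma translate_ok :
  [/\ table_ok P T, {in M, forall A, {subset fvars A <= pvars P}} &
  valid_lines F M (ext_prefix k P T) b (ext_lines k T) (s ++ instance pfs s_dup_false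
    [::] ++ instance pfs s_undup_false [::])].
Proof.
have [vpi emp] := ref.
have prop : forall C, C \in map fst pi -> proper Phi C.
  exact: (@ir_valid_proper _ [::] pi _ vpi).
have hT : table_ok P T.
  move=> q /table_mem[C [p [Cpi pC ->]]] /=; have [pe pd _] := prop C Cpi p pC; split.
    by rewrite /pvars mem_cat pe orbT.
  by apply/allP => l /pd; apply: (dep_univ wf pe).
have hM : {in M, forall A, {subset fvars A <= pvars P}}.
  move=> A /mapP[C CM ->] x; rewrite fvars_disj => /mapP[l lC ->].
  by case: wf => _ _ /(_ C CM); apply.
split=> //.
have piW : ir_width pi <= W by rewrite leq_maxl.
have [|||vs ins] := @pi_sim F pfs Phi W k T hpfs wf longk hT [::] (ext_lines k T) pi
  _ _ vpi _ piW.
- by [].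
- by [].
- by move=> C Cpi p; apply: mem_table.
(* The empty clause translates to [FFalse], wherever it occurs in the refutation. *)
have sF : FFalse \in s by have := ins fset0 emp; rewrite /raw_clause.
have uP' : uniq (pvars (ext_prefix k P T)) by apply: uniq_ext;
  [exact: longk|case: wf].
apply: valid_lines_cat vs _; apply: valid_lines_cat.
  by apply: (instanceP M hpfs); rewrite //= mem_cat sF.
by apply: (instanceP M hpfs); rewrite //= mem_cat (mem_instance pfs s_dup_false [::]).
Qed.

Lemma translate_refutation :
  dfr_refutation F Phi (translate pfs (Phi, map raw_line pi)).
Proof.
have [hT hM vs] := translate_ok.
split.
  apply: (@exts_valid F M k P longk T _ [::] hM hT); rewrite cats0 [(_, _).2]/=.
  rewrite -map_comp; exact: valid_lines_dfr vs.
(* The output without its final line; 23 is [s_undup_false], whose conclusion is that line. *)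
exists (exts k T ++ [seq Line A | A <- s ++ instance pfs s_dup_false [::] ++
   [seq fsubst (nth FFalse [::]) A | A <- nth [::] pfs 23]]).
have e : instance pfs s_undup_false [::] =
    rcons [seq fsubst (nth FFalse [::]) A | A <- nth [::] pfs 23] FFalse.
  by rewrite /instance map_rcons.
by rewrite /translate; cbv zeta; rewrite e -!rcons_cat map_rcons -rcons_cat -map_comp.
Qed.

(** Beyond the extensions there are at most [44 * instance_bound pfs * (W * size pi)] lines, 42 for
    the inferences and 2 for the final instances, each of size at most [pf_bound pfs * (18 * W)].
    The product 792 is rounded up to 1000; the 5 comes from the extension axioms. *)
Lemma translate_size :
  dfr_size (translate pfs (Phi, map raw_line pi))
    <= (1000 * instance_bound pfs * pf_bound pfs + 5) * (W ^ 2 * size pi).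
Proof.
have [_ _ vs] := translate_ok; have [vpi emp] := ref.
have W0 : 0 < W by rewrite leq_maxr.
have pi0 : 0 < size pi by case: (pi) emp.
have piW : ir_width pi <= W by rewrite leq_maxl.
rewrite /translate /= -map_comp; set t := _ ++ _ ++ _.
rewrite {1}/dfr_size big_cat /= -/(dfr_size _) -/k -/T.
have -> : \sum_(i <- [seq Line A | A <- t]) dfr_step_size i = \sum_(A <- t) fsize A.
  by rewrite big_map.
have h1 : dfr_size (exts k T) <= 5 * (W ^ 2 * size pi).
  apply: leq_trans (size_exts k T) _; rewrite leq_mul2l /=.
  apply: leq_trans (sum_flatten_aclause pi) _; apply: leq_mul => //.
  by apply: leq_trans piW _; rewrite expnS leq_pmulr // expn_gt0 W0.
have h2 := valid_lines_size vs.
have h3 : size s <= 42 * instance_bound pfs * W * size pi.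
  exact: (@size_pi pfs (name_of k T) Phi W W0 [::] pi _ vpi piW).
have h4 : size t <= 44 * instance_bound pfs * (W * size pi).
  rewrite !size_cat; have := size_instance pfs s_dup_false [::];
    have := size_instance pfs s_undup_false [::].
  have : instance_bound pfs * 1 <= instance_bound pfs * (W * size pi).
    by rewrite leq_mul2l muln_gt0 W0 pi0 orbT.
  move: h3; rewrite -/s;
    move: (size (instance _ _ _)) (size (instance _ _ _)) (size s) => n1 n2 n3.
  by move: (instance_bound pfs) W (size pi); clear; lia.
have h5 : b <= pf_bound pfs * (18 * W) by rewrite leq_mul2l; apply/orP; right; lia.
rewrite mulnDl [X in _ <= X]addnC; apply: (leq_add h1); apply: leq_trans h2 _.
apply: leq_trans (leq_mul h4 h5) _; rewrite expnS expn1.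
move: (instance_bound pfs) (pf_bound pfs) (size pi) => x y z.
by have : 44 * x * (W * z) * (y * (18 * W)) = 792 * (x * y * (W * W * z)); nia.
Qed.

End Correctness.

(** * Polynomial time of the translation *)

Notation elits := (enc_seq elit).
Notation eforms := (enc_seq enc_form).
Notation erclause := (enc_seq (enc_pair elit elits)).
Notation ename := (enc_pair enc_nat elits).

Section Specific.
Context (X : Type) (eX : X -> tree).

Lemma pt_mem_lit (s : X -> seq lit) l :
  pt eX elits s -> pt eX elit l -> pt eX enc_bool (fun x => l x \in s x).
Proof. exact: (pt_mem elit_inj). Qed.

Lemma pt_mem_nat (s : X -> seq nat) l :
  pt eX (enc_seq enc_nat) s -> pt eX enc_nat l -> pt eX enc_bool (fun x =>
    l x \in s x).
Proof. exact: (pt_mem enc_nat_inj). Qed.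

Lemma pt_undup_lit (s : X -> seq lit) :
  pt eX elits s -> pt eX elits (fun x => undup (s x)).
Proof. exact: (pt_undup elit_inj). Qed.

Lemma pt_eq_lit (f g : X -> lit) :
  pt eX elit f -> pt eX elit g -> pt eX enc_bool (fun x => f x == g x).
Proof. exact: (pt_eq elit_inj). Qed.

Lemma pt_eq_name (f g : X -> nat * seq lit) :
  pt eX ename f -> pt eX ename g -> pt eX enc_bool (fun x => f x == g x).
Proof. exact: (pt_eq (enc_pair_inj enc_nat_inj (enc_seq_inj elit_inj))). Qed.

Lemma pt_FVar f : pt eX enc_nat f -> pt eX enc_form (fun x => FVar (f x)).
Proof. by move=> Hf; apply: computes_node Hf; apply: computes_const. Qed.

Lemma pt_FNot f : pt eX enc_form f -> pt eX enc_form (fun x => FNot (f x)).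
Proof. by move=> Hf; apply: computes_node Hf; apply: computes_const. Qed.

Lemma pt_FAnd f g : pt eX enc_form f -> pt eX enc_form g ->
  pt eX enc_form (fun x => FAnd (f x) (g x)).
Proof. by move=> Hf Hg; apply: computes_node (computes_node Hf Hg);
  apply: computes_const. Qed.

Lemma pt_FOr f g : pt eX enc_form f -> pt eX enc_form g ->
  pt eX enc_form (fun x => FOr (f x) (g x)).
Proof. by move=> Hf Hg; apply: computes_node (computes_node Hf Hg);
  apply: computes_const. Qed.

Lemma pt_FImp f g : pt eX enc_form f -> pt eX enc_form g ->
  pt eX enc_form (fun x => FImp (f x) (g x)).
Proof. by move=> Hf Hg; apply: computes_node (computes_node Hf Hg);
  apply: computes_const. Qed.

Lemma pt_FIff f g : pt eX enc_form f -> pt eX enc_form g ->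
  pt eX enc_form (fun x => FIff (f x) (g x)).
Proof. by move=> Hf Hg; apply: computes_node (computes_node Hf Hg);
  apply: computes_const. Qed.

Lemma pt_lit_form l : pt eX elit l -> pt eX enc_form (fun x => lit_form (l x)).
Proof.
move=> Hl; apply: pt_if; first exact: pt_fst Hl.
  by apply: pt_FVar; apply: pt_snd Hl.
by apply: pt_FNot; apply: pt_FVar; apply: pt_snd Hl.
Qed.

End Specific.

Ltac pt_step :=
  first
  [ eassumption
  | match goal with
    | H : pt ?e1 ?e2 ?f |- pt _ _ (fun z => ?f (@?u z)) =>
        eapply (pt_comp (u := u) (f := f)); [ | exact H ]
    end
  | simple eapply pt_id
  | simple eapply pt_proj1
  | simple eapply pt_proj2
  | simple eapply pt_const
  | simple eapply pt_pair
  | simple eapply pt_cons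
  | simple eapply pt_cat
  | simple eapply pt_if
  | simple eapply pt_not
  | simple eapply pt_and
  | simple eapply pt_or
  | simple eapply pt_nilp
  | simple eapply pt_FVar
  | simple eapply pt_FNot
  | simple eapply pt_FAnd
  | simple eapply pt_FOr
  | simple eapply pt_FImp
  | simple eapply pt_FIff
  | simple eapply pt_lit_form
  | simple eapply pt_mem_lit
  | simple eapply pt_mem_nat
  | simple eapply pt_undup_lit
  | simple eapply pt_eq_lit
  | simple eapply pt_eq_name
  | simple eapply pt_fst
  | simple eapply pt_snd ].

Ltac pts := repeat (cbv beta; pt_step).

Section Forms.
Context (X : Type) (eX : X -> tree).

Lemma pt_hconj s : pt eX elits s -> pt eX enc_form (fun x => hconj (s x)).
Proof.
move=> Hs.
have Hl : pt (enc_pair eX (enc_pair elit elits)) enc_form (fun y =>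
  lit_form y.2.1) by pts.
apply: (@pt_lrec _ _ _ _ _ _ _ _ (fun _ l _ A => FAnd (lit_form l) A)
  (fun y => tsize (enc_form (lit_form y.2.1)) + 20) Hs); first by pts.
- by pts.
- by apply: pbounded_add; [exact: pt_pbounded Hl|exact: pbounded_const].
- by move=> x l r A /=; lia.
Qed.

Lemma pt_conj s : pt eX elits s -> pt eX enc_form (fun x => conj_form (s x)).
Proof.
(* [conj_form] treats the last literal differently, so the fold tests whether the tail is empty. *)
move=> Hs; apply: (@pt_ext _ _ _ _ (fun x =>
    lrec (fun l s A =>
      if nilp s then lit_form l else FAnd (lit_form l) A) FTrue (s x))).
  by move=> x; elim: (s x) => // l [|l' r] //= ->.
have Hl : pt (enc_pair eX (enc_pair elit elits)) enc_form (fun y =>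
  lit_form y.2.1) by pts.
apply: (@pt_lrec _ _ _ _ _ _ _ _ (fun _ l s A =>
  if nilp s then lit_form l else FAnd (lit_form l) A)
  (fun y => tsize (enc_form (lit_form y.2.1)) + 20) Hs); first by pts.
- by pts.
- by apply: pbounded_add; [exact: pt_pbounded Hl|exact: pbounded_const].
- by move=> x l r A; case: ifP => _ /=; lia.
Qed.

Lemma pt_disj s : pt eX elits s -> pt eX enc_form (fun x => disj_form (s x)).
Proof.
move=> Hs; apply: (@pt_ext _ _ _ _ (fun x =>
    lrec (fun l s A =>
      if nilp s then lit_form l else FOr (lit_form l) A) FFalse (s x))).
  by move=> x; elim: (s x) => // l [|l' r] //= ->.
have Hl : pt (enc_pair eX (enc_pair elit elits)) enc_form (fun y =>
  lit_form y.2.1) by pts.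
apply: (@pt_lrec _ _ _ _ _ _ _ _ (fun _ l s A =>
  if nilp s then lit_form l else FOr (lit_form l) A)
  (fun y => tsize (enc_form (lit_form y.2.1)) + 20) Hs); first by pts.
- by pts.
- by apply: pbounded_add; [exact: pt_pbounded Hl|exact: pbounded_const].
- by move=> x l r A; case: ifP => _ /=; lia.
Qed.

Lemma pt_head (A : Type) (eA : A -> tree) d s :
  pt eX (enc_seq eA) s -> pt eX eA (fun x => head d (s x)).
Proof.
move=> Hs; apply: (@pt_ext _ _ _ _ (fun x => lrec (fun a _ _ => a) d (s x))).
  by move=> x; case: (s x).
apply: (@pt_lrec _ _ _ _ _ _ _ _ (fun _ a _ _ => a) (fun y => tsize (eA y.2.1)) Hs);
  first exact: pt_const.
- by pts.
- by apply: (@pt_pbounded _ (enc_pair eX (enc_pair eA (enc_seq eA))) _ eA (fun y =>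
  y.2.1)); pts.
- by move=> x l r a /=; lia.
Qed.

Lemma pt_behead (A : Type) (eA : A -> tree) s :
  pt eX (enc_seq eA) s -> pt eX (enc_seq eA) (fun x => behead (s x)).
Proof.
move=> Hs; apply: (@pt_ext _ _ _ _ (fun x => lrec (fun _ l _ => l) [::] (s x))).
  by move=> x; case: (s x).
apply: (@pt_lrec _ _ _ _ _ _ _ _ (fun _ _ l _ => l) (fun y =>
  tsize (enc_seq eA y.2.2)) Hs);
  first exact: pt_const.
- by pts.
- by apply: (@pt_pbounded _ (enc_pair eX (enc_pair eA (enc_seq eA))) _ (enc_seq eA)
  (fun y => y.2.2)); pts.
- by move=> x l r a /=; lia.
Qed.

Lemma pt_nth (A : Type) (eA : A -> tree) d n s :
  pt eX (enc_seq eA) s -> pt eX eA (fun x => nth d (s x) n).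
Proof.
elim: n s => [|n IH] s Hs; first by apply: pt_ext (pt_head d Hs) => x; case: (s x).
by apply: pt_ext (IH _ (pt_behead Hs)) => x; case: (s x) => //=; rewrite nth_nil.
Qed.

(** [A] is fixed, so the recursion over it takes place while the program is assembled; recursion on
    encoded formulas is never programmed. *)
Lemma pt_fsubst s A : pt eX eforms s ->
  pt eX enc_form (fun x => fsubst (nth FFalse (s x)) A).
Proof.
move=> Hs; elim: A => /= [n| | |B HB|B HB D HD|B HB D HD|B HB D HD|B HB D HD].
- exact: pt_nth.
all: by pts.
Qed.

Context (pfs : seq (seq form)).

Lemma pt_instance i args : pt eX eforms args -> pt eX eforms (fun x =>
  instance pfs i (args x)).
Proof.
move=> Ha; rewrite /instance; elim: rcons => /= [|A l IH]; first exact: pt_const.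
by apply: pt_cons IH; apply: pt_fsubst.
Qed.

End Forms.

Ltac pt_list_step :=
  first
  [ pt_step
  | simple eapply pt_hconj
  | simple eapply pt_conj
  | simple eapply pt_disj
  | simple eapply pt_instance
  | simple eapply pt_sweep
  | simple eapply pt_sweepr
  | simple eapply pt_onfirst
  | simple eapply pt_flatmap
  | simple eapply pt_filter
  | simple eapply pt_map
  | simple eapply pt_has
  | simple eapply pt_all ].

Ltac ptl := repeat (cbv beta zeta; pt_list_step).

Section Macros.
Context (pfs : seq (seq form)).
Context (X : Type) (eX : X -> tree).

Lemma pt_disj_inj ls : pt eX elits ls -> pt eX eforms (fun x => disj_inj pfs (ls x)).
Proof. by move=> Hl; rewrite /disj_inj; ptl. Qed.

Lemma pt_disj_elim Z ls : pt eX enc_form Z -> pt eX elits ls ->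
  pt eX eforms (fun x => disj_elim pfs (Z x) (ls x)).
Proof. by move=> HZ Hl; rewrite /disj_elim; ptl. Qed.

Lemma pt_conj_proj ls : pt eX elits ls -> pt eX eforms (fun x =>
  conj_proj pfs (ls x)).
Proof. by move=> Hl; rewrite /conj_proj; ptl. Qed.

Lemma pt_conj_build H ls : pt eX enc_form H -> pt eX elits ls ->
  pt eX eforms (fun x => conj_build pfs (H x) (ls x)).
Proof. by move=> HH Hl; rewrite /conj_build; ptl. Qed.

Lemma pt_hconj_build H ls : pt eX enc_form H -> pt eX elits ls ->
  pt eX eforms (fun x => hconj_build pfs (H x) (ls x)).
Proof. by move=> HH Hl; rewrite /hconj_build; ptl. Qed.

Lemma pt_reduce F t ls : pt eX enc_form F -> pt eX elits t -> pt eX elits ls ->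
  pt eX eforms (fun x => reduce pfs (F x) (t x) (ls x)).
Proof. by move=> HF Ht Hl; rewrite /reduce /reduce_step; ptl. Qed.

Lemma pt_fixed B a : pt eX elits B -> pt eX elits a ->
  pt eX elits (fun x => fixed (B x) (a x)).
Proof. by move=> HB Ha; rewrite /fixed; ptl. Qed.

Lemma pt_moved B a : pt eX elits B -> pt eX elits a ->
  pt eX elits (fun x => moved (B x) (a x)).
Proof. by move=> HB Ha; rewrite /moved; ptl. Qed.

End Macros.

Ltac pt_macro_step :=
  first
  [ pt_list_step
  | simple eapply pt_disj_inj
  | simple eapply pt_disj_elim
  | simple eapply pt_conj_proj
  | simple eapply pt_conj_build
  | simple eapply pt_hconj_build
  | simple eapply pt_reduce
  | simple eapply pt_fixed
  | simple eapply pt_moved ].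

Ltac ptm := repeat (cbv beta zeta; pt_macro_step).

Lemma pt_name (X : Type) (eX : X -> tree) k s :
  pt eX (enc_seq enc_bool) k -> pt eX (enc_seq ename) s ->
  pt eX enc_nat (fun x => name (k x) (s x)).
Proof. by move=> Hk Hs; apply: (@pt_ones _ _ _ enc_bool); ptm. Qed.

Lemma pt_name_of (X : Type) (eX : X -> tree) k T q :
  pt eX (enc_seq enc_bool) k -> pt eX (enc_seq ename) T -> pt eX ename q ->
  pt eX enc_nat (fun x => name_of (k x) (T x) (q x)).
Proof.
move=> Hk HT Hq; rewrite /name_of.
have Hn : pt (enc_pair eX (enc_pair ename (enc_seq ename))) enc_nat
    (fun y => name (k y.1) y.2.2) by apply: pt_name; ptm.
apply: (@pt_lrec _ _ _ _ _ _ _ _ (fun x a s r => if a == q x then name (k x) s else r)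
  (fun y => tsize (enc_nat (name (k y.1) y.2.2))) HT).
- exact: pt_const.
- apply: pt_if; first by ptm.
    by apply: (pt_comp (u := fst) (f := fun y => name (k y.1) y.2.2) _ Hn); ptm.
  by ptm.
- exact: pt_pbounded Hn.
- by move=> x a l r; case: ifP => _ /=; lia.
Qed.

Section Pieces.
Context (pfs : seq (seq form)).
Context (X : Type) (eX : X -> tree).
Context (k : X -> seq bool) (T : X -> seq (nat * seq lit)).
Context (Hk : pt eX (enc_seq enc_bool) k).
Context (HT : pt eX (enc_seq ename) T).

Lemma pt_lits C : pt eX erclause C -> pt eX elits (fun x =>
  lits (name_of (k x) (T x)) (C x)).
Proof. by move=> HC; rewrite /lits; repeat (cbv beta;
  first [pt_macro_step|simple eapply pt_name_of]). Qed.

Lemma pt_group B q : pt eX elits B -> pt eX (enc_pair elit elits) q ->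
  pt eX eforms (fun x => group pfs (name_of (k x) (T x)) (B x) (q x)).
Proof.
by move=> HB Hq; rewrite /group /hyp; repeat (cbv beta zeta;
  first [pt_macro_step|simple eapply pt_name_of]).
Qed.

Notation eitem := (enc_pair (enc_pair enc_bool enc_nat) (enc_pair enc_nat elits)).

Lemma pt_matches B it q : pt eX elits B -> pt eX eitem it ->
  pt eX (enc_pair elit elits) q ->
  pt eX enc_bool (fun x => matches (B x) (it x) (q x)).
Proof.
by move=> HB Hi Hq; rewrite /matches; ptm.
Qed.

Lemma pt_item_step B Z it q : pt eX elits B -> pt eX enc_form Z -> pt eX eitem it ->
  pt eX (enc_pair elit elits) q ->
  pt eX eforms (fun x =>
    item_step pfs (name_of (k x) (T x)) (B x) (Z x) (it x) (q x)).
Proof.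
move=> HB HZ Hi Hq; rewrite /item_step /hyp.
by repeat (cbv beta zeta; first [pt_macro_step|simple eapply pt_name_of]).
Qed.

End Pieces.

Notation eitem := (enc_pair (enc_pair enc_bool enc_nat) (enc_pair enc_nat elits)).

Ltac pt_piece_step :=
  first
  [ pt_macro_step
  | simple eapply pt_name_of
  | simple eapply pt_lits
  | simple eapply pt_group
  | simple eapply pt_matches
  | simple eapply pt_item_step ].

Ltac ptp := repeat (cbv beta zeta; pt_piece_step).

Section Lines.
Context (pfs : seq (seq form)).
Context (X : Type) (eX : X -> tree).
Context (k : X -> seq bool) (T : X -> seq (nat * seq lit)).
Context (Hk : pt eX (enc_seq enc_bool) k).
Context (HT : pt eX (enc_seq ename) T).

Lemma pt_link B us its C' ls : pt eX elits B -> pt eX elits us ->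
  pt eX (enc_seq eitem) its -> pt eX erclause C' -> pt eX elits ls ->
  pt eX eforms (fun x =>
    link pfs (name_of (k x) (T x)) (B x) (us x) (its x) (C' x) (ls x)).
Proof. by move=> HB Hus Hits HC Hls; rewrite /link; ptp. Qed.

Lemma pt_res_lines C1 C2 v t C' : pt eX erclause C1 -> pt eX erclause C2 ->
  pt eX enc_nat v -> pt eX elits t -> pt eX erclause C' ->
  pt eX eforms (fun x =>
    res_lines pfs (name_of (k x) (T x)) (C1 x) (C2 x) (v x) (t x) (C' x)).
Proof. by move=> H1 H2 Hv Ht HC; rewrite /res_lines; ptp. Qed.

Lemma pt_inst_lines C b C' : pt eX erclause C -> pt eX elits b -> pt eX erclause C' ->
  pt eX eforms (fun x => inst_lines pfs (name_of (k x) (T x)) (C x) (b x) (C' x)).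
Proof.
move=> HC Hb HC'; rewrite /inst_lines; apply: pt_link; ptp.
Qed.

Lemma pt_ax_lines U C C' : pt eX (enc_seq enc_nat) U -> pt eX elits C ->
  pt eX erclause C' ->
  pt eX eforms (fun x => ax_lines pfs (name_of (k x) (T x)) (U x) (C x) (C' x)).
Proof.
move=> HU HC HC'; rewrite /ax_lines; cbv zeta; apply: pt_cat; first by ptp.
apply: pt_cat; first by ptp.
by apply: pt_link; ptp.
Qed.

End Lines.

(** * Dispatch on the inference rule, and the whole translation *)

Definition enc_rrule (r : rrule) : tree :=
  match r with
  | RAx C => tagged_tree 0 (elits C)
  | RInst C b => tagged_tree 1 (Node (erclause C) (elits b))
  | RRes C1 C2 x t =>
      tagged_tree 2 (Node (Node (erclause C1) (erclause C2)) (Node (enc_nat x) (elits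
        t)))
  end.

Definition rule_tag (r : rrule) : nat :=
  match r with RAx _ => 0 | RInst _ _ => 1 | RRes _ _ _ _ => 2 end.

Definition rule_payload (r : rrule) : tree :=
  match r with
  | RAx C => elits C
  | RInst C b => Node (erclause C) (elits b)
  | RRes C1 C2 x t =>
    Node (Node (erclause C1) (erclause C2)) (Node (enc_nat x) (elits t))
  end.

Lemma enc_rruleE r : enc_rrule r = Node (enc_nat (rule_tag r)) (rule_payload r).
Proof. by case: r. Qed.

(** Two tests on the binary tag decide: 0 is encoded by [Leaf], and 1 and 2 differ in their least
    significant digit, which is [true] for 1. *)
Lemma pt_rrule_case (X B : Type) (eX : X -> tree) (eB : B -> tree) r
    (fa : X -> seq lit -> B) (fi : X -> rclause -> seq lit -> B)
    (fr : X -> rclause -> rclause -> nat -> seq lit -> B) :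
  pt eX enc_rrule r ->
  pt (enc_pair eX elits) eB (fun y => fa y.1 y.2) ->
  pt (enc_pair eX (enc_pair erclause elits)) eB (fun y => fi y.1 y.2.1 y.2.2) ->
  pt (enc_pair eX (enc_pair (enc_pair erclause erclause) (enc_pair enc_nat elits))) eB
    (fun y => fr y.1 y.2.1.1 y.2.1.2 y.2.2.1 y.2.2.2) ->
  pt eX eB (fun x => match r x with
                     | RAx C => fa x C
                     | RInst C b => fi x C b
                     | RRes C1 C2 v t => fr x C1 C2 v t
                     end).
Proof.
move=> Hr Ha Hi Hs.
have {}Hr : computes eX (fun x =>
  Node (enc_nat (rule_tag (r x))) (rule_payload (r x))).
  by apply: computes_ext Hr => x; rewrite enc_rruleE.
have Htag := computes_fst Hr; have Hpay := computes_snd Hr.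
have restr (Y : Type) (u : Y -> X) o : computes eX o ->
    computes (fun y => eX (u y)) (fun y => o (u y)).
  by move=> Ho; apply: computes_comp Ho; apply: computes_id.
(* On its branch the payload already is the encoding of some [c y] and is passed on unchanged; the
   default values in the definitions of [c] below belong to constructors excluded there. *)
have use (Y : Type) (u : Y -> X) (A : Type) (eA : A -> tree) (c : Y -> A)
    (f : X -> A -> B) :
    (forall y, eA (c y) = rule_payload (r (u y))) ->
    pt (enc_pair eX eA) eB (fun y => f y.1 y.2) ->
    computes (fun y => eX (u y)) (fun y => eB (f (u y) (c y))).
  move=> ce Hf.
  apply: (@computes_comp _ _ _ (enc_pair eX eA) (fun y => eB (f y.1 y.2))
    (fun y => (u y, c y)) _ Hf).
  apply: computes_node; first exact: computes_id.
  by apply: (computes_ext _ (restr Y u _ Hpay)) => y; rewrite ce.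
apply: (computes_match Htag).
  pose c (x : {x | is_leaf (enc_nat (rule_tag (r x)))}) :=
    if r (sval x) is RAx C then C else [::].
  apply: (computes_ext _ (use _ _ _ elits c fa _ Ha)) => [[x h]|[x h]] /=;
    by move: h; rewrite /c /=; case: (r x).
pose hd t := if t is Node l _ then l else Leaf.
pose Y := {x | ~~ is_leaf (enc_nat (rule_tag (r x)))}.
pose t (y : Y) := hd (enc_nat (rule_tag (r (sval y)))).
have Ht : computes (fun y : Y => eX (sval y)) t.
  apply: (computes_fst (b := fun y => if r (sval y) is RInst _ _ then Leaf else
    Node (Node Leaf Leaf) Leaf)).
  apply: (computes_ext _ (restr Y _ _ Htag)) => -[x /=].
  by rewrite /t /=; case: (r x).
apply: (computes_match Ht).
  pose c (z : {y : Y | is_leaf (t y)}) : rclause * rclause * (nat * seq lit) :=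
    if r (sval (sval z)) is RRes C1 C2 v s then ((C1, C2), (v, s))
    else (([::], [::]), (0, [::])).
  apply: (computes_ext _ (use _ (fun z => sval (sval z)) _ _ c
    (fun x a => fr x a.1.1 a.1.2 a.2.1 a.2.2) _ Hs)) => [[[x h] h']|[[x h] h']] /=;
    by move: h h'; rewrite /c /t /=; case: (r x).
pose c (z : {y : Y | ~~ is_leaf (t y)}) : rclause * seq lit :=
  if r (sval (sval z)) is RInst C b then (C, b) else ([::], [::]).
apply: (computes_ext _ (use _ (fun z => sval (sval z)) _ _ c
  (fun x a => fi x a.1 a.2) _ Hi)) => [[[x h] h']|[[x h] h']] /=;
  by move: h h'; rewrite /c /t /=; case: (r x).
Qed.

Lemma pt_Line (X : Type) (eX : X -> tree) f :
  pt eX enc_form f -> pt eX enc_dfr_step (fun x => Line (f x)).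
Proof. by move=> Hf; apply: computes_node Hf; apply: computes_const. Qed.

Lemma pt_Ext (X : Type) (eX : X -> tree) b a Y v :
  pt eX enc_bool b -> pt eX elits a -> pt eX elits Y -> pt eX enc_nat v ->
  pt eX enc_dfr_step (fun x => Ext (b x) (a x) (Y x) (v x)).
Proof.
move=> Hb Ha HY Hv; apply: computes_node; first exact: computes_const.
exact: computes_node (computes_node Hb Hv) (computes_node Ha HY).
Qed.

Notation erline := (enc_pair erclause enc_rrule).

Definition enc_raw (x : dqbf * seq (rclause * rrule)) : tree :=
  Node (enc_dqbf x.1) (enc_seq erline x.2).

Section Translate.
Context (pfs : seq (seq form)).
Context (X : Type) (eX : X -> tree).

Lemma pt_exts k T : pt eX (enc_seq enc_bool) k -> pt eX (enc_seq ename) T ->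
  pt eX enc_output (fun x => exts (k x) (T x)).
Proof.
move=> Hk HT; rewrite /exts; apply: (pt_sweepr HT); cbv beta.
by repeat (first [pt_piece_step|simple eapply pt_Ext|simple eapply pt_name]).
Qed.

Lemma pt_table s : pt eX (enc_seq erline) s ->
  pt eX (enc_seq ename) (fun x => table (s x)).
Proof. by move=> Hs; rewrite /table; ptp. Qed.

(** [enc_nat] is by definition the encoding of the list of digits. *)
Lemma pt_digits n : pt eX enc_nat n -> pt eX (enc_seq enc_bool) (fun x =>
  digits (n x)).
Proof. by []. Qed.

Lemma pt_line_lines k T U p :
  pt eX (enc_seq enc_bool) k -> pt eX (enc_seq ename) T ->
  pt eX (enc_seq enc_nat) U -> pt eX erline p ->
  pt eX eforms (fun x => line_lines pfs (name_of (k x) (T x)) (U x) (p x)).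
Proof.
move=> Hk HT HU Hp; rewrite /line_lines.
apply: (@pt_rrule_case _ _ _ _ (fun x => (p x).2)
  (fun x C => ax_lines pfs (name_of (k x) (T x)) (U x) C (p x).1)
  (fun x C b => inst_lines pfs (name_of (k x) (T x)) C b (p x).1)
  (fun x C1 C2 v t => res_lines pfs (name_of (k x) (T x)) C1 C2 v t (p x).1)).
- exact: pt_snd Hp.
- by apply: pt_ax_lines; ptp.
- by apply: pt_inst_lines; ptp.
- by apply: pt_res_lines; ptp.
Qed.

End Translate.

Lemma pt_translate pfs : pt enc_raw enc_output (translate pfs).
Proof.
have Huni : pt enc_raw (enc_seq enc_nat) (fun x => univ (dprefix x.1)).
  by apply: computes_fst (computes_fst (computes_fst (computes_id _))).
have Hexi : pt enc_raw (enc_seq (enc_pair enc_nat (enc_seq enc_nat)))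
    (fun x => exis (dprefix x.1)).
  by apply: computes_snd (computes_fst (computes_fst (computes_id _))).
have Hpi : pt enc_raw (enc_seq erline) (fun x => x.2).
  by apply: computes_snd (computes_id _).
have Hk : pt enc_raw (enc_seq enc_bool)
    (fun x => flatten [seq digits v | v <- pvars (dprefix x.1)]).
  apply: (pt_flatmap (eA := enc_nat)); last by apply: pt_digits; ptp.
  by rewrite /pvars; ptp.
have HT := pt_table Hpi.
rewrite /translate; cbv zeta; apply: pt_cat; first exact: pt_exts.
apply: (pt_map (eA := enc_form)); last by apply: pt_Line; ptp.
apply: pt_cat; last by ptp.
apply: (pt_flatmap Hpi); apply: pt_line_lines.
- apply: (pt_comp (u := fst) (f := fun x =>
  flatten [seq digits v | v <- pvars (dprefix x.1)]) _ Hk); ptp.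
- apply: (pt_comp (u := fst) (f := fun x => table x.2) _ HT); ptp.
- apply: (pt_comp (u := fst) (f := fun x => univ (dprefix x.1)) _ Huni); ptp.
- exact: pt_proj2.
Qed.

Lemma enc_seq_map (A B : Type) (eB : B -> tree) (g : A -> B) s :
  enc_seq eB (map g s) = enc_seq (fun a => eB (g a)) s.
Proof. by elim: s => //= a s ->. Qed.

Lemma enc_aclause_raw C : enc_aclause C = erclause (raw_clause C).
Proof. by rewrite /raw_clause enc_seq_map. Qed.

(** Finite sets are encoded through their enumerations, so passing to raw clauses leaves the tree
    unchanged and costs no computation. *)
Lemma enc_input_raw x : enc_input x = enc_raw (x.1, map raw_line x.2).
Proof.
case: x => Phi pi; rewrite /enc_input /enc_raw /enc_pair /=; congr (Node _ _).
rewrite enc_seq_map; elim: pi => //= p pi ->; congr (Node (Node _ _) _).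
  exact: enc_aclause_raw.
by case: p => C [C0|C0 b|C1 C2 y t] /=; rewrite ?enc_aclause_raw.
Qed.

(* w is read as at least 1: it vanishes only if the matrix contains the empty
   clause, and then the output still has to contain the line 0. *)
Theorem theorem1 (F : seq frege_rule) (hF : frege_system F) :
  exists f : dqbf * seq ir_line -> seq dfr_step,
    polytime enc_input enc_output f /\
    exists c : nat, forall (Phi : dqbf) (pi : seq ir_line),
      wf_dqbf Phi -> ir_refutation Phi pi ->
      dfr_refutation F Phi (f (Phi, pi)) /\
      dfr_size (f (Phi, pi)) <= c * (maxn (ir_width pi) 1 ^ 2 * size pi).
Proof.
have [pfs hpfs] := frege_proofs hF schemes_sound.
exists (fun x => translate pfs (x.1, map raw_line x.2)); split.
  apply: pt_polytime; apply: computes_comp (pt_translate pfs).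
  exact: computes_ext enc_input_raw (computes_id _).
exists (1000 * instance_bound pfs * pf_bound pfs + 5) => Phi pi wf ref.
split; first exact: (translate_refutation hpfs wf ref).
exact: (translate_size hpfs wf ref).
Qed.
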